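(* Consider the problem Sparse Spanning Subgraph: given an $n$-node undirected graph $G=(V,E)$ and $\varepsilon>0$, output an edge-subgraph $H\subseteq G$ with at most $(1+\varepsilon)n$ edges that spans $G$. (Upper bound) For every $0<\varepsilon<1$ there is a randomized algorithm which, on any $n$-node input graph $G$, runs in $\widetilde{O}(n\varepsilon^{-1})$ time and with high probability outputs an adjacency oracle for a subgraph $H$ solving Sparse Spanning Subgraph on $(G,\varepsilon)$. (Lower bound) For every constant $\delta>0$, no algorithm as in the upper bound (that is, one outputting, with high probability, an adjacency oracle for a solution to Sparse Spanning Subgraph) can run in $O(n^{1-\delta})$ time.
   Context: An edge-subgraph $H$ of $G$ spans $G$ if $H$ has the same connected components as $G$. The input graph $G$ is given both as an adjacency list (for each vertex $v$ one can read $\deg(v)$, read its neighbor list, and query a uniformly random neighbor, each in $\widetilde{O}(1)$ time) and as an adjacency matrix/oracle (one can test whether $(u,v)\in E(G)$ in $\widetilde{O}(1)$ time). An adjacency oracle for a graph $H$ is a data structure that, on query $(u,v)$, deterministically returns in $\widetilde{O}(1)$ time a bit indicating whether $(u,v)\in E(H)$; the graph $H$ it represents is fixed at the end of the construction (preprocessing) phase and does not depend on the order of queries. The oracle may use access to $G$. The running time of the algorithm is the time to construct the oracle. $\widetilde{O}(\cdot)$ hides $\mathrm{polylog}(n)$ factors; ''with high probability'' means with probability at least $1-1/n^{c}$ for an absolute constant $c>0$. *)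

(* Defs.v *)
From HB Require Import structures.
From mathcomp Require Import all_boot all_order all_algebra.
From mathcomp Require Import all_classical all_reals all_analysis.

Set Implicit Arguments.
Unset Strict Implicit.
Unset Printing Implicit Defensive.

Import Order.TTheory GRing.Theory Num.Theory.

Local Open Scope ring_scope.

(* A simple undirected graph on {0, ..., n-1}, given both as an adjacency
   matrix and as an adjacency list, the latter in an arbitrary order. *)
Record graph (n : nat) := Graph {
  adj : rel 'I_n;
  adj_sym : symmetric adj;
  adj_irr : irreflexive adj;
  nbrs : 'I_n -> seq 'I_n;
  nbrs_uniq : forall u, uniq (nbrs u);
  mem_nbrs : forall u v, (v \in nbrs u) = adj u v
}.

Definition edges (T : finType) (e : rel T) : {set {set T}} :=
  [set [set p.1; p.2] | p in [set p : T * T | e p.1 p.2]].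

Definition same_components (T : finType) (e f : rel T) : Prop :=
  forall u v, connect e u v = connect f u v.

Definition sparse_spanning_subgraph (R : realType) (n : nat) (G : graph n)
    (eps : R) (H : rel 'I_n) : Prop :=
  [/\ symmetric H,
      subrel H (adj G),
      #|edges H|%:R <= (1 + eps) * n%:R &
      same_components H (adj G)].

(* A randomized word RAM with access to a graph. Every instruction, including
   each access to the graph, takes one unit of time. Registers are indexed by
   nat, but a program mentions only finitely many of them; the memory is
   addressed indirectly, through the contents of registers. *)

Inductive binop := Plus | Minus | Times | Quo | Rem | Less | Same.

Inductive instr :=
| Const (x a : nat)               (* r_x := a *)
| Bin (o : binop) (x y z : nat)   (* r_x := r_y o r_z *)
| Get (x y : nat)                 (* r_x := cell[r_y] *)
| Put (x y : nat)                (* cell[r_x] := r_y *)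
| Deg (x y : nat)                 (* r_x := deg(r_y) *)
| Nbr (x y z : nat)               (* r_x := entry r_z of the list of r_y *)
| Adj (x y z : nat)               (* r_x := 1 if (r_y, r_z) is an edge, or 0 *)
| RandNbr (x y : nat)             (* r_x := uniformly random neighbor of r_y *)
| Rand (x y : nat)                (* r_x := uniformly random in [0, r_y) *)
| If (x : nat) (c1 c2 : seq instr)  (* r_x <> 0 is true *)
| While (x : nat) (c : seq instr).

Definition eval_binop (o : binop) (a b : nat) : nat :=
  match o with
  | Plus => (a + b)%N
  | Minus => (a - b)%N
  | Times => (a * b)%N
  | Quo => (a %/ b)%N
  | Rem => (a %% b)%N
  | Less => (a < b)%N
  | Same => (a == b)
  end.

Fixpoint deterministic (i : instr) : bool :=
  match i with
  | RandNbr _ _ | Rand _ _ => false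
  | If _ c1 c2 => all deterministic c1 && all deterministic c2
  | While _ c => all deterministic c
  | _ => true
  end.

Record state := State { reg : nat -> nat; cell : nat -> nat }.

(* All stored values are words, that is, numbers modulo W. *)
Definition set_reg (W : nat) (s : state) (x a : nat) : state :=
  State (fun y => if y == x then (a %% W)%N else reg s y) (cell s).

Definition set_cell (W : nat) (s : state) (x a : nat) : state :=
  State (reg s) (fun y => if y == x then (a %% W)%N else cell s y).

(* Empty if the word a is not a vertex. *)
Definition nbr_words (n : nat) (G : graph n) (a : nat) : seq nat :=
  if insub a is Some v then [seq val u | u <- nbrs G v] else [::].

(* The equally likely results of a random choice from l; 0 if l is empty. *)
Definition choices (l : seq nat) : seq nat := if l is [::] then [:: 0%N] else l.

(* What remains to be executed, and the current state. *)
Definition config := (seq instr * state)%type.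

Definition halted (cf : config) : bool := nilp cf.1.

(* The equally likely successors of a configuration. *)
Definition step (W n : nat) (G : graph n) (cf : config) : seq config :=
  let: (k, s) := cf in
  let r := reg s in
  if k is i :: k' then
    let assign x a : config := (k', set_reg W s x a) in
    match i with
    | Const x a => [:: assign x a]
    | Bin o x y z => [:: assign x (eval_binop o (r y) (r z))]
    | Get x y => [:: assign x (cell s (r y))]
    | Put x y => [:: (k', set_cell W s (r x) (r y))]
    | Deg x y => [:: assign x (size (nbr_words G (r y)))]
    | Nbr x y z => [:: assign x (nth 0%N (nbr_words G (r y)) (r z))]
    | Adj x y z => [:: assign x (r z \in nbr_words G (r y) : nat)]
    | RandNbr x y => [seq assign x a | a <- choices (nbr_words G (r y))]
    | Rand x y => [seq assign x a | a <- choices (iota 0 (r y))]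
    | If x c1 c2 => [:: ((if r x != 0%N then c1 else c2) ++ k', s)]
    | While x c => [:: (if r x != 0%N then c ++ k else k', s)]
    end
  else [:: cf].

(* The configurations that can be reached after t steps. *)
Fixpoint outcomes (W n : nat) (G : graph n) (t : nat) (cf : config) :
    seq config :=
  if t is t'.+1 then flatten [seq outcomes W G t' d | d <- step W G cf]
  else [:: cf].

(* The probability that the configuration reached after t steps satisfies E. *)
Fixpoint prob (R : realType) (W n : nat) (G : graph n) (t : nat) (cf : config)
    (E : config -> Prop) : R :=
  if t is t'.+1 then
    (\sum_(d <- step W G cf) prob R W G t' d E) / (size (step W G cf))%:R
  else `[< E cf >]%:R.

Definition bit_length (n : nat) : nat := (trunc_log 2 n).+1.

(* An algorithm fixes the word length, as a multiple of the bit length of n,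
   a program that builds the oracle, and a program that answers the queries. *)
Record algorithm := Algorithm {
  word_factor : nat;
  construction : seq instr;
  query : seq instr;
  query_deterministic : all deterministic query
}.

Definition word_bound (A : algorithm) (n : nat) : nat :=
  (2 ^ (word_factor A * bit_length n))%N.

(* The construction starts with n in register 0, with eps as a fixed-point
   binary fraction, truncated to one word, in register 1, and with 0 in all
   other registers and in the whole memory. *)
Definition initial_state (R : realType) (A : algorithm) (n : nat) (eps : R) :
    state :=
  let W := word_bound A n in
  set_reg W
    (set_reg W (State (fun=> 0%N) (fun=> 0%N)) 0 n)
    1 (Num.truncn (eps * W%:R)).

(* The query (u, v) is put in registers 0 and 1, and is answered in register 0.
   Each query is run on the state s left by the construction, so the answers
   do not depend on the order of the queries. *)
Definition adjacency_oracle (R : realType) (A : algorithm) (n : nat)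
    (G : graph n) (s : state) (q : R) (H : rel 'I_n) : Prop :=
  let W := word_bound A n in
  forall u v : 'I_n, exists2 t : nat, t%:R <= q &
    all (fun cf => halted cf && ((reg cf.2 0 != 0%N) == H u v))
      (outcomes W G t (query A, set_reg W (set_reg W s 0 u) 1 v)).

(* On (G, eps), A always halts within time T and, with probability at least
   1 - p, it leaves an adjacency oracle, with query time q, for a solution. *)
Definition solves_within (R : realType) (A : algorithm) (eps : R) (n : nat)
    (G : graph n) (T q p : R) : Prop :=
  let W := word_bound A n in
  let start : config := (construction A, initial_state A n eps) in
  exists t : nat,
    [/\ t%:R <= T,
        all halted (outcomes W G t start) &
        1 - p <= prob R W G t start (fun cf =>
          exists2 H, sparse_spanning_subgraph G eps H &
            adjacency_oracle A G cf.2 q H)].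

(* log^k n, with the bit length of n for the logarithm, so that it is at least
   1 for every n. *)
Definition polylog (R : realType) (k n : nat) : R := (bit_length n)%:R ^+ k.

(* Main.v *)
(** Upper bound. Union-find keeps a spanning forest of the edges found so far,
    and the oracle keeps the forest together with every edge of [G] whose ends
    lie in different classes. It remains to make the number of such crossing
    edges at most [eps * n]. For the thresholds [d = n/2, n/4, ..., 0], every
    vertex of degree more than [d] probes some random neighbors: if one of them
    is marked, the vertex joins its class; otherwise its whole neighborhood is
    scanned, marked and joined, and since with high probability half of it was
    unmarked, all the scans together cost O(n). Afterwards every class is larger
    than half of each degree in it, so the sum over the classes of the largest
    degree is at most [2n]. Sampling a random vertex and a random neighbor of it
    lowers this potential by a constant fraction of [crossings / n] on average,
    so that O~(n / eps) samples suffice.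

    Lower bound. Take a random [h]-fold lift of [K_{16,16}] and a double cover of
    it. If the cover is trivial, a sparse subgraph omits both lifts of most base
    edges; if it is trivial except for the sign of one base edge, the two lifts of
    that edge form a cut, so one of them is kept. The few vertices which are
    explored by the construction and the query on a base edge see, with high
    probability, a forest, hence do not distinguish the two covers: the vertices
    on one side of the edge can be exchanged with their twins. *)

Require Import Defs.
From HB Require Import structures.
From mathcomp Require Import all_boot all_order all_algebra.
From mathcomp Require Import fingroup perm.
From mathcomp Require Import boolp reals sequences exp.
From mathcomp Require Import zify ring lra.

Set Implicit Arguments.
Unset Strict Implicit.
Unset Printing Implicit Defensive.

Import Order.TTheory GRing.Theory Num.Theory.

Local Open Scope ring_scope.

(** Upper bound: thresholds come before sampling because the potential of the singletons is the sum
    of all degrees, possibly of order n^2, whereas a sample removes about [crossings / n] on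
    average; only against a potential of at most 2n is this a sufficient rate. The time bound must
    hold on every run, lucky or not, so the program itself checks a scan budget. Lower bound: a
    construction of n^(1-delta) steps may far exceed sqrt n steps, so its own exploration can close
    cycles. What is needed is weaker: the base edge starts at a vertex away from everything explored
    so far, and the polylogarithmically many questions asked from then on close no cycle; each of
    them fails with probability at most D M / (h - 2 M), where M counts all questions. The random
    gauge makes the comparison of the two covers an injection on a finite probability space, with
    tape, matchings and edge fixed. Base degree D = 16: there are D^2 h = 256 h base edges, while a
    sparse subgraph keeps at most 2 * 4 D h = 128 h edges, so half of the base edges lose both
    lifts. *)

(** * A calculus of running time and success probability *)

Section Judgement.
Variables (R : realType) (W n : nat) (G : graph n).
Variables (F : pred config) (E : config -> Prop).

(** [F] is required of every run, [E] only with probability [v]. Specifications are later written in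
    continuation style, the rest of the program being assumed to satisfy [ensures] with its own
    value. A value [v <= 0] marks a run that is given up: only [F] and the time still have to be
    respected. *)
Definition ensures (T : nat) (cf : config) (v : R) : Prop :=
  all F (outcomes W G T cf) /\ v <= prob R W G T cf E.

Hypothesis F_halted : forall cf, F cf -> halted cf.

Lemma step_halted cf : halted cf -> step W G cf = [:: cf].
Proof. by case: cf => -[]. Qed.

Lemma outcomes_halted t cf : halted cf -> outcomes W G t cf = [:: cf].
Proof. by move=> h; elim: t => //= t IH; rewrite step_halted //= IH. Qed.

Lemma prob_halted t cf : halted cf -> prob R W G t cf E = `[< E cf >]%:R.
Proof.
by move=> h; elim: t => //= t IH; rewrite step_halted //= big_seq1 IH divr1.
Qed.

Lemma size_step cf : (0 < size (step W G cf))%N.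
Proof.
case: cf => -[|[]] * //=; rewrite size_map.
  by case: nbr_words.
by case: (reg _ _).
Qed.

Lemma ensures_halt T k s v : k = [::] ->
  F (k, s) -> v <= `[< E (k, s) >]%:R -> ensures T (k, s) v.
Proof.
by move=> -> Fs vE; split; rewrite ?outcomes_halted ?prob_halted //= Fs.
Qed.

(** [f] plays the role of a conditional success probability; single branches may fall below [v]. *)
Lemma ensures_branch T cf (l : seq nat) (g : nat -> config) (f : nat -> R) v :
  step W G cf = [seq g a | a <- l] ->
  {in l, forall a, ensures T (g a) (f a)} ->
  v <= (\sum_(a <- l) f a) / (size l)%:R -> ensures T.+1 cf v.
Proof.
move=> stE ok vle; split => /=; rewrite stE.
  elim: l {stE vle} ok => //= a l IH ok; rewrite all_cat IH ?andbT.
    by have [] := ok a (mem_head _ _).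
  by move=> b bl; apply: ok; rewrite inE bl orbT.
apply: le_trans vle _; rewrite big_map size_map ler_wpM2r ?invr_ge0 ?ler0n //.
by rewrite big_seq [leRHS]big_seq; apply: ler_sum => a /ok[].
Qed.

Lemma ensures_det T cf d v :
  step W G cf = [:: d] -> ensures T d v -> ensures T.+1 cf v.
Proof.
move=> stE ok; apply: (@ensures_branch T cf [:: 0%N] (fun=> d) (fun=> v)) => //.
by rewrite big_seq1 divr1.
Qed.

(** [F] forces all outcomes to be halted, and halted configurations are fixed by [step], so
    additional steps change nothing. This is what allows one time bound for branches of different
    lengths. *)
Lemma ensures_le T T' cf v v' :
  ensures T cf v -> (T <= T')%N -> v' <= v -> ensures T' cf v'.
Proof.
move=> ok leT lev; suff [? ?] : ensures T' cf v by split=> //; apply: le_trans lev _.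
move: leT => /subnK <-; elim: {T'} (T' - T)%N => // m; rewrite addSn.
move: (m + T)%N => {}T {m ok} []; elim: T cf v {lev} => [|T IH] cf v.
  rewrite /= andbT => Fcf vle; split; rewrite /= step_halted ?F_halted //= ?Fcf //.
  by rewrite big_seq1 divr1.
have /= := size_step cf.
set l := step W G cf => l0 allF vle.
split.
  move: allF; rewrite -[outcomes _ _ T.+2 _]/(flatten [seq outcomes W G T.+1 d | d <- l]).
  elim: l {l0 vle} => //= d l IHl; rewrite !all_cat => /andP[Fd Fl].
  rewrite -[flatten _]/(outcomes W G T.+1 d) IHl // andbT.
  by have [] := IH d (prob R W G T d E) Fd (lexx _).
apply: le_trans vle _.
rewrite -[leRHS]/((\sum_(d <- l) prob R W G T.+1 d E) / (size l)%:R).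
rewrite ler_wpM2r ?invr_ge0 ?ler0n //.
elim: l allF {l0} => [|d l IHl] /=; first by rewrite !big_nil.
rewrite all_cat !big_cons => /andP[Fd Fl]; rewrite lerD ?IHl //.
by have [] := IH d _ Fd (lexx _).
Qed.

Lemma nbr_wordsE (u : 'I_n) : nbr_words G u = [seq val w | w <- nbrs G u].
Proof. by rewrite /nbr_words valK. Qed.

Lemma ensures_rand T x y k s (f : nat -> R) v : (0 < reg s y)%N ->
  (forall a, (a < reg s y)%N -> ensures T (k, set_reg W s x a) (f a)) ->
  v <= (\sum_(a < reg s y) f a) / (reg s y)%:R ->
  ensures T.+1 (Rand x y :: k, s) v.
Proof.
move=> y0 ok vle.
apply: (@ensures_branch _ _ (iota 0 (reg s y)) (fun a => (k, set_reg W s x a)) f).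
- by rewrite /=; case: (reg s y) y0.
- by move=> a; rewrite mem_iota => ay; apply: ok.
- by rewrite size_iota -{1}[reg s y]subn0 -/(index_iota _ _) big_mkord.
Qed.

Lemma ensures_randnbr T x y k s (u : 'I_n) (f : 'I_n -> R) v :
  reg s y = u -> nbrs G u != [::] ->
  (forall w, adj G u w -> ensures T (k, set_reg W s x w) (f w)) ->
  v <= (\sum_(w <- nbrs G u) f w) / (size (nbrs G u))%:R ->
  ensures T.+1 (RandNbr x y :: k, s) v.
Proof.
move=> yu u0 ok vle; rewrite -(size_map val) in vle.
apply: (@ensures_branch _ _ [seq val w | w <- nbrs G u]
   (fun a => (k, set_reg W s x a)) (fun a => oapp f 0 (insub a))).
- by rewrite /= yu nbr_wordsE; case: (nbrs G u) u0.
- by move=> a /mapP[w]; rewrite mem_nbrs => uw ->; rewrite valK /=; apply: ok.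
- by rewrite big_map; under eq_bigr do rewrite valK /=.
Qed.

Lemma ensures_randnbr0 T x y k s (u : 'I_n) v :
  reg s y = u -> nbrs G u = [::] -> ensures T (k, set_reg W s x 0) v ->
  ensures T.+1 (RandNbr x y :: k, s) v.
Proof.
by move=> yu u0; apply: ensures_det; rewrite /= yu nbr_wordsE u0.
Qed.

End Judgement.

(** * Union-find and the potential *)

Section UnionFind.
Variables (n : nat) (G : graph n).

(** A full bit matrix gives constant-time lookup and needs no initialization, since the memory
    starts at zero. *)
Definition tree (m : nat -> nat) : rel 'I_n :=
  fun u v => m (3 * n + u * n + v)%N != 0%N.

Definition component (c : 'I_n -> 'I_n) (x : 'I_n) : {set 'I_n} :=
  [set y | c y == c x].

(** [c] is a ghost map to class representatives, not stored anywhere. Strictly increasing ranks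
    together with [forest_rank] bound the depth logarithmically; [tree_edges] charges each tree edge
    to a vertex that has ceased to be a root. *)
Record forest (m : nat -> nat) (c : 'I_n -> 'I_n) : Prop := Forest {
  forest_root : forall x : 'I_n, m x = 0%N -> c x = x;
  forest_parent : forall x : 'I_n, m x != 0%N -> exists2 y : 'I_n,
    m x = y.+1 & c y = c x /\ (m (n + x) < m (n + y))%N;
  forest_rootP : forall x : 'I_n, m (c x) = 0%N;
  forest_rank : forall x : 'I_n, (2 ^ m (n + c x) <= #|component c x|)%N;
  tree_bit : forall u v : 'I_n, (m (3 * n + u * n + v) <= 1)%N;
  tree_sym : symmetric (tree m);
  tree_sub : subrel (tree m) (adj G);
  tree_connect : forall u v, c u = c v -> connect (tree m) u v;
  tree_edges : (#|edges (tree m)| + #|[set x | c x == x]| <= n)%N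
}.

Lemma forest_idem m c x : forest m c -> c (c x) = c x.
Proof. by move=> fm; apply: (forest_root fm); apply: forest_rootP fm _. Qed.

Definition merge (c : 'I_n -> 'I_n) (l w : 'I_n) : 'I_n -> 'I_n :=
  fun x => if c x == l then w else c x.

Lemma edges_set2 (e : rel 'I_n) u v : e u v -> [set u; v] \in edges e.
Proof. by move=> uv; apply/imsetP; exists (u, v); rewrite ?inE. Qed.

(** One statement for all cases of union by rank: [r] is the new rank of the winner [w], namely its
    old rank if it was larger than that of the loser [l], or one more after a tie. Either way
    [2 ^ r] is at most the sum of both powers, hence at most the size of the merged class. *)
Lemma forest_link (m m' : nat -> nat) c (u v l w : 'I_n) (r : nat) :
  forest m c -> adj G u v -> c u != c v ->
  ((l == c u) && (w == c v)) || ((l == c v) && (w == c u)) ->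
  (m (n + l) < r)%N -> (m (n + w) <= r)%N ->
  (2 ^ r <= 2 ^ m (n + l) + 2 ^ m (n + w))%N ->
  m' l = w.+1 -> (forall x : 'I_n, x != l -> m' x = m x) ->
  m' (n + w)%N = r -> (forall x : 'I_n, x != w -> m' (n + x)%N = m (n + x)%N) ->
  (forall x y : 'I_n, m' (3 * n + x * n + y)%N =
    if ((x == u) && (y == v)) || ((x == v) && (y == u)) then 1%N
    else m (3 * n + x * n + y)%N) ->
  forest m' (merge c l w).
Proof.
move=> fm uv cuv lw lr wr rle m'l m'x m'w m'rk m'te.
have wl : w != l by case/orP: lw => /andP[/eqP-> /eqP->] //; rewrite eq_sym.
have cw : c w = w.
  by case/orP: lw => /andP[_ /eqP->]; apply: forest_idem fm.
have cl : c l = l.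
  by case/orP: lw => /andP[/eqP-> _]; apply: forest_idem fm.
have treeE x y : tree m' x y =
    [|| (x == u) && (y == v), (x == v) && (y == u) | tree m x y].
  by rewrite /tree m'te; case: (_ && _); case: (_ && _).
have treeS x y : tree m x y -> tree m' x y by rewrite treeE => ->; rewrite !orbT.
have treeC : symmetric (tree m').
  move=> x y; rewrite !treeE (tree_sym fm).
  by rewrite [(y == u) && _]andbC [(y == v) && _]andbC orbCA.
have conS x y : connect (tree m) x y -> connect (tree m') x y.
  by apply: connect_sub => a b /treeS; apply: connect1.
split.
- move=> x; case: (eqVneq x l) => [->|xl]; first by rewrite m'l.
  rewrite m'x // => /(forest_root fm) cx.
  by rewrite /merge cx (negPf xl).
- move=> x; case: (eqVneq x l) => [-> _|xl].
    by exists w; rewrite // /merge cw cl eqxx (negPf wl) m'w m'rk // eq_sym.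
  rewrite m'x // => /(forest_parent fm)[y xy [cyx rxy]]; exists y => //.
  rewrite /merge cyx; split=> //; case: (eqVneq x w) => [xw|xw].
    by move: (forest_rootP fm w); rewrite cw -xw xy.
  rewrite m'rk //; case: (eqVneq y w) => [yw|yw]; last by rewrite m'rk.
  by rewrite yw m'w; apply: leq_trans wr; rewrite -yw.
- move=> x; rewrite /merge; case: (eqVneq (c x) l) => [_|cxl].
    by rewrite m'x // -cw; apply: forest_rootP fm _.
  by rewrite m'x //; apply: forest_rootP fm _.
- have rlw : (2 ^ r <= #|[set y | (c y == l) || (c y == w)]|)%N.
    apply: leq_trans rle _.
    have := leq_add (forest_rank fm l) (forest_rank fm w); rewrite cl cw.
    move/leq_trans; apply; rewrite -cardsUI.
    rewrite [X in (_ + X)%N](_ : _ = 0%N) ?addn0.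
      by apply/subset_leq_card/subsetP=> y; rewrite !inE cl cw.
    apply/eqP; rewrite cards_eq0 -subset0; apply/subsetP=> y; rewrite !inE cl cw.
    by case/andP=> /eqP-> /eqP lw'; rewrite lw' eqxx in wl.
  move=> x; rewrite /component /merge.
  case: (eqVneq (c x) l) => [cxl|cxl].
    rewrite m'w (leq_trans rlw) //; apply/subset_leq_card/subsetP=> y.
    by rewrite !inE; case: ifP => //=; rewrite eqxx.
  case: (eqVneq (c x) w) => [cxw|cxw].
    rewrite cxw m'w (leq_trans rlw) //; apply/subset_leq_card/subsetP=> y.
    by rewrite !inE; case: ifP => //=; rewrite eqxx.
  rewrite m'rk //; apply: leq_trans (forest_rank fm x) _.
  apply/subset_leq_card/subsetP=> y; rewrite !inE => /eqP->.
  by rewrite (negPf cxl).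
- by move=> x y; rewrite m'te; case: ifP => // _; apply: tree_bit fm _ _.
- exact: treeC.
- move=> x y; rewrite treeE => /or3P[/andP[/eqP-> /eqP->]|/andP[/eqP-> /eqP->]|] //.
    by rewrite adj_sym.
  exact: tree_sub fm _ _.
- have tuv : tree m' u v by rewrite treeE !eqxx.
  have link : connect (tree m') l w.
    have cx z : connect (tree m') z (c z).
      by apply/conS/(tree_connect fm); rewrite (forest_idem _ fm).
    have xc z : connect (tree m') (c z) z.
      by apply/conS/(tree_connect fm); rewrite (forest_idem _ fm).
    case/orP: lw => /andP[/eqP-> /eqP->].
      by apply: connect_trans (xc u) (connect_trans (connect1 tuv) (cx v)).
    rewrite treeC in tuv.
    by apply: connect_trans (xc v) (connect_trans (connect1 tuv) (cx u)).
  move=> x y; rewrite /merge.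
  case: (eqVneq (c x) l) => [cxl|cxl]; case: (eqVneq (c y) l) => [cyl|cyl] cxy.
  + by apply/conS/(tree_connect fm); rewrite cxl.
  + apply: (connect_trans (y := l)); last apply: (connect_trans link).
      by apply/conS/(tree_connect fm); rewrite cl.
    by apply/conS/(tree_connect fm); rewrite cw.
  + apply: (connect_trans (y := w)).
      by apply/conS/(tree_connect fm); rewrite cw.
    rewrite (sym_connect_sym treeC); apply: (connect_trans (y := l)).
      by apply/conS/(tree_connect fm); rewrite cl.
    exact: link.
  + exact/conS/(tree_connect fm).
- apply: leq_trans (tree_edges fm).
  have : (#|edges (tree m')| <= #|edges (tree m)| + 1)%N.
    rewrite -(cards1 [set u; v]); apply: leq_trans (leq_card_setU _ _).
    apply/subset_leq_card/subsetP=> e /imsetP[[x y]]; rewrite inE /= treeE => xy ->.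
    rewrite !inE; case/or3P: xy => [/andP[/eqP-> /eqP->]|/andP[/eqP-> /eqP->]|xy].
    + by rewrite eqxx orbT.
    + by rewrite [X in _ || (X == _)]setUC eqxx orbT.
    + by rewrite edges_set2.
  (* The loser [l] is no longer a root, which pays for the new tree edge. *)
  have : (#|[set x | merge c l w x == x]| + 1 <= #|[set x | c x == x]|)%N.
    rewrite (cardsD1 l [set x | c x == x]) inE cl eqxx addnC leq_add2l.
    apply/subset_leq_card/subsetP=> x; rewrite !inE /merge.
    case: (eqVneq (c x) l) => [cxl /eqP<-|cxl /eqP cx]; first by rewrite wl cw eqxx.
    by rewrite cx eqxx -{1}cx cxl.
  lia.
Qed.

End UnionFind.

(** * The largest degrees of the classes as a potential *)

Section Potential.
Variables (n : nat) (G : graph n).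
Implicit Types (c : 'I_n -> 'I_n) (u v l w : 'I_n).

(** The direction of the merge is left open: ranks decide it, and the potential argument is
    symmetric in it. *)
Definition united (c : 'I_n -> 'I_n) (u v : 'I_n) (c' : 'I_n -> 'I_n) : Prop :=
  if adj G u v && (c u != c v) then
    exists l w, ((l == c u) && (w == c v)) || ((l == c v) && (w == c u)) /\
      c' = merge c l w
  else c' = c.

Definition deg u : nat := size (nbrs G u).

Definition weight c (r : 'I_n) : nat := \max_(u | c u == r) deg u.

Definition potential c : nat := \sum_r weight c r.

Definition cross c : rel 'I_n := fun u v => adj G u v && (c u != c v).

Definition crossings c : nat := #|edges (cross c)|.

Definition coarser c c' : Prop := forall x y, c x = c y -> c' x = c' y.

Lemma edges_card (e f : rel 'I_n) : subrel e f -> (#|edges e| <= #|edges f|)%N.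
Proof.
move=> ef; apply/subset_leq_card/subsetP=> A /imsetP[p pe ->].
by apply/imsetP; exists p => //; move: pe; rewrite !inE => /ef.
Qed.

Lemma crossings_coarser c c' : coarser c c' -> (crossings c' <= crossings c)%N.
Proof.
move=> cc'; apply: edges_card => u v /andP[uv cuv]; rewrite /cross uv /=.
by apply: contra cuv => /eqP/cc' ->.
Qed.

Lemma coarser_trans c1 c2 c3 : coarser c1 c2 -> coarser c2 c3 -> coarser c1 c3.
Proof. by move=> c12 c23 x y /c12/c23. Qed.

Lemma united_coarser c u v c' : united c u v c' -> coarser c c'.
Proof.
rewrite /united; case: ifP => [_ [l [w [_ ->]]]|_ ->] x y //.
by rewrite /merge => ->.
Qed.

Lemma weight_merge c l w r : l != w ->
  weight (merge c l w) r =
  if r == l then 0%N else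
  if r == w then maxn (weight c l) (weight c w) else weight c r.
Proof.
move=> lw; rewrite /weight /merge.
case: eqVneq => [->|rl].
  rewrite big_pred0 // => u; case: (eqVneq (c u) l) => [_|/negPf->//].
  by rewrite eq_sym (negPf lw).
case: eqVneq => [->|rw].
  rewrite (bigID (fun u => c u == l)) /=; congr maxn; apply: eq_bigl => u.
    by case: (eqVneq (c u) l); rewrite ?eqxx ?andbF.
  by case: (eqVneq (c u) l) => [->|_]; rewrite ?(negPf lw) ?andbF ?andbT.
apply: eq_bigl => u; case: (eqVneq (c u) l) => [->|//].
by rewrite ![_ == r]eq_sym (negPf rl) (negPf rw).
Qed.

(** Two summands are replaced by their maximum, so exactly the smaller one is lost. *)
Lemma potential_merge c l w : l != w ->
  (potential (merge c l w) + minn (weight c l) (weight c w) = potential c)%N.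
Proof.
move=> lw; rewrite /potential.
rewrite (bigD1 l) //= (bigD1 w) 1?eq_sym //= [in RHS](bigD1 l) //=.
rewrite [in RHS](bigD1 w) 1?eq_sym //= !weight_merge // eqxx.
rewrite eq_sym (negPf lw) eqxx.
rewrite (eq_bigr (weight c)); last first.
  by move=> r /andP[rl rw]; rewrite weight_merge // (negPf rl) (negPf rw).
by lia.
Qed.

Lemma deg_weight c u : (deg u <= weight c (c u))%N.
Proof. exact: (@leq_bigmax_cond _ _ deg). Qed.

Definition gain c u v : nat := if c u != c v then minn (deg u) (deg v) else 0.

Lemma potential_united c u v c' : adj G u v -> united c u v c' ->
  (potential c' + gain c u v <= potential c)%N.
Proof.
rewrite /united /gain => -> /=; case: ifP => [cuv [l [w [lw ->]]]|_ ->]; last first.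
  by rewrite addn0.
have := deg_weight c u; have := deg_weight c v.
case/orP: lw => /andP[/eqP-> /eqP->]; last rewrite eq_sym in cuv.
  by have := potential_merge c cuv; lia.
by have := potential_merge c cuv; lia.
Qed.

Lemma potential_le c c' u v : united c u v c' ->
  (potential c' <= potential c)%N.
Proof.
have [uv un|/negPf uv] := boolP (adj G u v).
  by have := potential_united uv un; lia.
by rewrite /united uv => /= ->.
Qed.

Lemma crossings_potential c : (0 < crossings c)%N -> (0 < potential c)%N.
Proof.
case/card_gt0P=> e /imsetP[[u v]]; rewrite inE => /andP[/= uv _] _.
rewrite /potential (bigD1 (c u)) //= (leq_trans _ (leq_addr _ _)) //.
apply: leq_trans (deg_weight c u).
by rewrite /deg; move: uv; rewrite -mem_nbrs; case: (nbrs G u).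
Qed.

(* The endpoint of smaller degree of a crossing edge pays for it. *)
Lemma sum_gain (R : realType) c :
  (crossings c)%:R <= \sum_u (\sum_(v <- nbrs G u) (gain c u v)%:R) / (deg u)%:R :> R.
Proof.
(* Orient each crossing edge away from its endpoint of smaller degree: the gain is then [deg u],
   which cancels the probability [1 / deg u] of choosing that neighbor. *)
pose D := [set p : 'I_n * 'I_n | cross c p.1 p.2 & (deg p.1 <= deg p.2)%N].
have crossC : symmetric (cross c).
  by move=> u v; rewrite /cross adj_sym eq_sym.
have : (crossings c <= #|D|)%N.
  apply: leq_trans (leq_imset_card (fun p => [set p.1; p.2]) D).
  apply/subset_leq_card/subsetP=> A /imsetP[[u v]]; rewrite inE /= => uv ->.
  case: (leqP (deg u) (deg v)) => [duv|/ltnW dvu].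
    by apply/imsetP; exists (u, v) => //; rewrite inE /= uv.
  apply/imsetP; exists (v, u); rewrite ?inE /= ?dvu ?andbT 1?crossC //.
  by rewrite setUC.
rewrite -(ler_nat R) => /le_trans; apply.
have -> : #|D| = (\sum_u \sum_(v | (u, v) \in D) 1)%N.
  by rewrite -sum1_card pair_big_dep /=; apply: eq_bigl => -[].
rewrite natr_sum; apply: ler_sum => u _.
rewrite big_uniq ?nbrs_uniq //= mulr_suml natr_sum [leRHS](bigID (fun v => (u, v) \in D)) /=.
rewrite -[leLHS]addr0 lerD ?sumr_ge0 //; last by move=> v _; rewrite divr_ge0 ?ler0n.
rewrite [leRHS](eq_bigl (fun v => (u, v) \in D)) => [|v]; last first.
  rewrite mem_nbrs; case: ((u, v) \in D) / boolP => [|_]; last by rewrite andbF.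
  by rewrite inE => /andP[/andP[-> _] _].
apply: ler_sum => v; rewrite inE /= => /andP[/andP[uv cuv] duv].
rewrite /gain cuv (minn_idPl duv) divff // pnatr_eq0 -lt0n.
by rewrite /deg; move: uv; rewrite -mem_nbrs; case: (nbrs G u).
Qed.

End Potential.

(** * The sparsifier *)

Definition upd_reg (s : state) (x a : nat) : state :=
  State (fun y => if y == x then a else reg s y) (cell s).

Definition upd_cell (s : state) (x a : nat) : state :=
  State (reg s) (fun y => if y == x then a else cell s y).

(* Cell x holds the parent of x plus one, or 0 at a root; cells n + x and
   2n + x hold the rank and the mark of x, and cell 3n + un + v the bit of the
   tree edge uv. Registers 2, 3, 4, 7, 8 hold 1, 0, n, 2n, 3n. *)
Definition find_root : seq instr :=
  [:: Get 11 10; While 11 [:: Bin Minus 10 11 2; Get 11 10]].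

Definition link_roots : seq instr :=
  [:: Bin Plus 14 13 4; Get 15 14; Bin Plus 16 10 4; Get 17 16;
      Bin Less 11 15 17;
      If 11 [:: Bin Plus 11 10 2; Put 13 11]
            [:: Bin Plus 11 13 2; Put 10 11; Bin Same 11 15 17;
                If 11 [:: Bin Plus 15 15 2; Put 14 15] [::]];
      Bin Times 11 5 4; Bin Plus 11 11 6; Bin Plus 11 11 8; Put 11 2;
      Bin Times 11 6 4; Bin Plus 11 11 5; Bin Plus 11 11 8; Put 11 2].

Definition unite : seq instr :=
  [:: Adj 12 5 6;
      If 12 (Bin Plus 10 5 3 :: find_root ++ Bin Plus 13 10 3 ::
             Bin Plus 10 6 3 :: find_root ++
             [:: Bin Same 11 13 10; If 11 [::] link_roots])
            [::]].

Definition scratch (y : nat) : bool := (9 < y < 18)%N.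

(** * Execution of union-find on the word RAM *)

Section Steps.
Variables (R : realType) (W n : nat) (G : graph n).
Variables (F : pred config) (E : config -> Prop).
Hypothesis F_halted : forall cf, F cf -> halted cf.
Hypothesis W_big : (4 * n * n + 8 * n + 8 < W)%N.

Local Notation ens := (@ensures R W n G F E).

Lemma set_regE s x a : (a < W)%N -> set_reg W s x a = upd_reg s x a.
Proof. by move=> aW; rewrite /set_reg modn_small. Qed.

Lemma ens_time T T' cf v : (T <= T')%N -> ens T cf v -> ens T' cf v.
Proof. by move=> leT ok; apply: ensures_le ok leT _. Qed.

Lemma ens_const T x a k s v : (a < W)%N ->
  ens T (k, upd_reg s x a) v -> ens T.+1 (Const x a :: k, s) v.
Proof. by move=> aW; apply: ensures_det; rewrite /= set_regE. Qed.

Lemma ens_bin a T o x y z k s v :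
  eval_binop o (reg s y) (reg s z) = a -> (a < W)%N ->
  ens T (k, upd_reg s x a) v -> ens T.+1 (Bin o x y z :: k, s) v.
Proof. by move=> ea aW; apply: ensures_det; rewrite /= ea set_regE. Qed.

Lemma ens_get a T x y k s v : cell s (reg s y) = a -> (a < W)%N ->
  ens T (k, upd_reg s x a) v -> ens T.+1 (Get x y :: k, s) v.
Proof. by move=> ea aW; apply: ensures_det; rewrite /= ea set_regE. Qed.

Lemma ens_put a b T x y k s v : reg s x = a -> reg s y = b -> (b < W)%N ->
  ens T (k, upd_cell s a b) v -> ens T.+1 (Put x y :: k, s) v.
Proof.
by move=> xa yb bW; apply: ensures_det; rewrite /= /set_cell xa yb modn_small.
Qed.

Lemma card_nbrs (u : 'I_n) : (size (nbrs G u) <= n)%N.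
Proof. by rewrite -(card_uniqP (nbrs_uniq G u)) -[X in (_ <= X)%N]card_ord max_card. Qed.

Lemma ltnW_big a : (a <= n * n + 8 * n + 8)%N -> (a < W)%N.
Proof. by nia. Qed.

Lemma ens_deg (u : 'I_n) T x y k s v : reg s y = u ->
  ens T (k, upd_reg s x (size (nbrs G u))) v -> ens T.+1 (Deg x y :: k, s) v.
Proof.
move=> yu; apply: ensures_det; rewrite /= yu nbr_wordsE size_map set_regE //.
by apply/ltnW_big/(leq_trans (card_nbrs u)); nia.
Qed.

Lemma ens_nbr (u w : 'I_n) T x y z k s v : reg s y = u ->
  nth 0%N [seq val a | a <- nbrs G u] (reg s z) = w ->
  ens T (k, upd_reg s x w) v -> ens T.+1 (Nbr x y z :: k, s) v.
Proof.
move=> yu zw; apply: ensures_det; rewrite /= yu nbr_wordsE zw set_regE //.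
by apply: ltnW_big; have := ltn_ord w; nia.
Qed.

Lemma ens_adj (u w : 'I_n) T x y z k s v : reg s y = u -> reg s z = w ->
  ens T (k, upd_reg s x (adj G u w)) v -> ens T.+1 (Adj x y z :: k, s) v.
Proof.
move=> yu zw; apply: ensures_det; rewrite /= yu zw nbr_wordsE.
rewrite (mem_map val_inj) mem_nbrs set_regE //.
by apply: ltnW_big; case: adj; nia.
Qed.

Lemma ens_if T x c1 c2 k s v :
  ens T ((if reg s x != 0%N then c1 else c2) ++ k, s) v ->
  ens T.+1 (If x c1 c2 :: k, s) v.
Proof. exact: ensures_det. Qed.

Lemma ens_while T x c k s v :
  ens T (if reg s x != 0%N then c ++ While x c :: k else k, s) v ->
  ens T.+1 (While x c :: k, s) v.
Proof. exact: ensures_det. Qed.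

Lemma ens_rand T x y k s (f : nat -> R) v : (0 < reg s y <= n)%N ->
  (forall a, (a < reg s y)%N -> ens T (k, upd_reg s x a) (f a)) ->
  v <= (\sum_(a < reg s y) f a) / (reg s y)%:R ->
  ens T.+1 (Rand x y :: k, s) v.
Proof.
move=> /andP[y0 yn] ok; apply: ensures_rand => // a ay.
by rewrite set_regE; [apply: ok|apply: ltnW_big; nia].
Qed.

Lemma ens_randnbr T x y k s (u : 'I_n) (f : 'I_n -> R) v :
  reg s y = u -> nbrs G u != [::] ->
  (forall w, adj G u w -> ens T (k, upd_reg s x w) (f w)) ->
  v <= (\sum_(w <- nbrs G u) f w) / (size (nbrs G u))%:R ->
  ens T.+1 (RandNbr x y :: k, s) v.
Proof.
move=> yu u0 ok; apply: ensures_randnbr yu u0 _ => w uw.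
by rewrite set_regE; [apply: ok|apply: ltnW_big; have := ltn_ord w; nia].
Qed.

Lemma ens_randnbr0 T x y k s (u : 'I_n) v :
  reg s y = u -> nbrs G u = [::] -> ens T (k, upd_reg s x 0) v ->
  ens T.+1 (RandNbr x y :: k, s) v.
Proof.
move=> yu u0 ok; apply: ensures_randnbr0 yu u0 _; rewrite set_regE //.
exact: ltnW_big.
Qed.

Lemma forest_rank_bound m c (x : 'I_n) : forest G m c ->
  (m (n + c x) < bit_length n)%N.
Proof.
move=> fm; have := leq_trans (forest_rank fm x) (max_card _); rewrite card_ord.
by rewrite /bit_length ltnS => /(trunc_log_max (isT : 1 < 2)%N).
Qed.

Lemma bit_length_le : (0 < n)%N -> (bit_length n <= n)%N.
Proof.
move=> n0; have /andP[le_n _] := trunc_log_bounds (isT : 1 < 2)%N n0.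
by apply: leq_trans le_n; apply: ltn_expl.
Qed.

Lemma forest_rank_le m c (x : 'I_n) : forest G m c ->
  (m (n + x) <= m (n + c x))%N.
Proof.
move=> fm; have [->|x0] := eqVneq (c x) x; first exact: leqnn.
have leM (y : 'I_n) : (m (n + y) <= \max_(z < n) m (n + z))%N.
  exact: (@leq_bigmax _ (fun z : 'I_n => m (n + z)%N)).
have [k] := ubnP (\max_(z < n) m (n + z) - m (n + x))%N.
elim: k x {x0} => // k IH x lek.
have [/(forest_root fm)->//|/(forest_parent fm)[y _ [<- xy]]] := eqVneq (m x) 0%N.
by apply: leq_trans (ltnW xy) (IH y _); have := leM y; lia.
Qed.

Lemma forest_rankW m c (x : 'I_n) : forest G m c -> (m (n + x) < n)%N.
Proof.
move=> fm; have n0 : (0 < n)%N by apply: leq_ltn_trans (ltn_ord x).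
apply: leq_ltn_trans (forest_rank_le x fm) _.
exact: leq_trans (forest_rank_bound x fm) (bit_length_le n0).
Qed.

Lemma forest_cellW m c (x : 'I_n) : forest G m c -> (m x <= n)%N.
Proof.
move=> fm; have [->//|x0] := eqVneq (m x) 0%N.
by have [y -> _] := forest_parent fm x0.
Qed.

Definition frame (s s' : state) : Prop :=
  forall y, ~~ scratch y -> reg s' y = reg s y.

(** The rank gap to the root bounds the number of parent steps, and each step takes three
    instructions. *)
Lemma find_root_loop c (m : nat) (x : 'I_n) T k s v :
  forest G (cell s) c -> reg s 2 = 1%N -> reg s 10 = x -> reg s 11 = cell s x ->
  (cell s (n + c x) - cell s (n + x) <= m)%N ->
  (forall s', cell s' = cell s -> reg s' 10 = c x ->
     (forall y, y != 10%N -> y != 11%N -> reg s' y = reg s y) ->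
     ens T (k, s') v) ->
  ens (3 * m + 1 + T) (While 11 [:: Bin Minus 10 11 2; Get 11 10] :: k, s) v.
Proof.
elim: m x s => [|m IH] x s fs one r10 r11 le_m ok.
all: have [x0|x0] := eqVneq (cell s x) 0%N.
- rewrite add1n; apply: ens_while; rewrite r11 x0 /=; apply: ok => //.
  by rewrite r10 (forest_root fs x0).
- have [y xy [cyx rxy]] := forest_parent fs x0.
  by have := forest_rank_le y fs; rewrite cyx; lia.
- apply: (@ens_time T.+1); first lia.
  apply: ens_while; rewrite r11 x0 /=; apply: ok => //.
  by rewrite r10 (forest_root fs x0).
- have [y xy [cyx rxy]] := forest_parent fs x0.
  rewrite (_ : (_ + T)%N = (3 * m + 1 + T).+3); last lia.
  apply: ens_while; rewrite r11 x0 /=.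
  apply: (@ens_bin y); first by rewrite /= r11 one xy subn1.
    by apply: ltnW_big; have := ltn_ord y; nia.
  apply: (@ens_get (cell s y)); first by [].
    by apply: ltnW_big; have := forest_cellW y fs; nia.
  apply: IH => //=; first by rewrite cyx; lia.
  move=> s' cs' r10' fr; apply: ok => //; first by rewrite r10' cyx.
  by move=> z z10 z11; rewrite fr //= (negPf z10) (negPf z11).
Qed.

Definition consts (s : state) : Prop :=
  [/\ reg s 2 = 1%N, reg s 3 = 0%N, reg s 4 = n, reg s 7 = (2 * n)%N &
      reg s 8 = (3 * n)%N].

Lemma frame_consts s s' : frame s s' -> consts s -> consts s'.
Proof. by move=> fr []; rewrite /consts !fr. Qed.

Lemma frame_trans s1 s2 s3 : frame s1 s2 -> frame s2 s3 -> frame s1 s3.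
Proof. by move=> f12 f23 y sy; rewrite f23 ?f12. Qed.

Definition same_marks (s s' : state) : Prop :=
  forall x : 'I_n, cell s' (2 * n + x) = cell s (2 * n + x).

Lemma tree_address (x y u v : 'I_n) :
  ((3 * n + x * n + y == 3 * n + u * n + v) = (x == u) && (y == v))%N.
Proof.
apply/eqP/andP => [xy|[/eqP-> /eqP->]//].
have n0 : (0 < n)%N by apply: leq_ltn_trans (ltn_ord x).
have {}xy : (x * n + y = u * n + v)%N by lia.
have := congr1 (fun a => a %/ n)%N xy; have := congr1 (fun a => a %% n)%N xy.
rewrite /= !modnMDl !divnMDl // !modn_small // !divn_small // !addn0.
by move=> /val_inj-> /val_inj->.
Qed.

Lemma link_roots_spec c (u v : 'I_n) T k s val :
  forest G (cell s) c -> consts s -> reg s 5 = u -> reg s 6 = v ->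
  reg s 13 = c u -> reg s 10 = c v -> adj G u v -> c u != c v ->
  (forall s' c', forest G (cell s') c' -> same_marks s s' -> frame s s' ->
    united G c u v c' -> ens T (k, s') val) ->
  ens (T + 20) (link_roots ++ k, s) val.
Proof.
move=> fs [r2 r3 r4 r7 r8] r5 r6 r13 r10 uv cuv ok.
have ltu := ltn_ord u; have ltv := ltn_ord v.
have lta := ltn_ord (c u); have ltb := ltn_ord (c v).
have ra := forest_rankW (c u) fs; have rb := forest_rankW (c v) fs.
have un : (u * n <= n * n)%N by rewrite leq_mul2r ltnW ?orbT.
have vn : (v * n <= n * n)%N by rewrite leq_mul2r ltnW ?orbT.
have Euv : (v + (u * n + 3 * n) = 3 * n + u * n + v)%N by lia.
rewrite addnC.
apply: (@ens_bin (n + c u)); first by rewrite /= r13 r4 addnC.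
  by apply: ltnW_big; nia.
apply: (@ens_get (cell s (n + c u))) => //; first by apply: ltnW_big; nia.
apply: (@ens_bin (n + c v)); first by rewrite /= r10 r4 addnC.
  by apply: ltnW_big; nia.
apply: (@ens_get (cell s (n + c v))) => //; first by apply: ltnW_big; nia.
apply: (@ens_bin (cell s (n + c u) < cell s (n + c v))%N) => //.
  by apply: ltnW_big; case: (_ < _)%N; nia.
(* The tail that writes the two bits of the tree edge is common to the three rank cases, so it is
   executed once here. Each case then only has to show that its pointers and ranks, below [3 * n],
   form a forest with the new bits. *)
have last c' s1 : frame s s1 -> united G c u v c' ->
    (forall x, (2 * n <= x)%N -> cell s1 x = cell s x) ->
    (forall m', (forall x y : 'I_n, m' (3 * n + x * n + y)%N =
        if ((x == u) && (y == v)) || ((x == v) && (y == u)) then 1%N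
        else cell s (3 * n + x * n + y)%N) ->
      (forall x, (x < 3 * n)%N -> m' x = cell s1 x) -> forest G m' c') ->
    ens (8 + T) ([:: Bin Times 11 5 4; Bin Plus 11 11 6; Bin Plus 11 11 8;
      Put 11 2; Bin Times 11 6 4; Bin Plus 11 11 5; Bin Plus 11 11 8; Put 11 2]
      ++ k, s1) val.
  move=> fr un' s1x fm'.
  apply: (@ens_bin (u * n)) => /=; first by rewrite !fr // r5 r4.
    by apply: ltnW_big; nia.
  apply: (@ens_bin (u * n + v)) => /=; first by rewrite !fr // r6.
    by apply: ltnW_big; nia.
  apply: (@ens_bin (3 * n + u * n + v)) => /=; first by rewrite !fr // r8; lia.
    by apply: ltnW_big; nia.
  apply: (@ens_put (3 * n + u * n + v) 1) => //=; first by rewrite fr.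
    by apply: ltnW_big; nia.
  apply: (@ens_bin (v * n)) => /=; first by rewrite !fr // r6 r4.
    by apply: ltnW_big; nia.
  apply: (@ens_bin (v * n + u)) => /=; first by rewrite !fr // r5.
    by apply: ltnW_big; nia.
  apply: (@ens_bin (3 * n + v * n + u)) => /=; first by rewrite !fr // r8; lia.
    by apply: ltnW_big; nia.
  apply: (@ens_put (3 * n + v * n + u) 1) => //=; first by rewrite fr.
    by apply: ltnW_big; nia.
  apply: ok un' => /=.
  - apply: fm' => [x y|x xn] /=.
      rewrite !tree_address s1x; last lia.
      by case: (_ && _); case: (_ && _).
    by rewrite !ifF //; apply/eqP; lia.
  - move=> x /=; rewrite !ifF ?s1x //; try by apply/eqP; have := ltn_ord x; lia.
  - move=> y sy /=; rewrite !ifF ?fr //; apply/eqP => yE; by rewrite yE in sy.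
have U1 : united G c u v (merge c (c v) (c u)).
  by rewrite /united uv cuv /=; exists (c v), (c u); rewrite !eqxx orbT.
have U2 : united G c u v (merge c (c u) (c v)).
  by rewrite /united uv cuv /=; exists (c u), (c v); rewrite !eqxx.
have lt2 (x : 'I_n) : (n + x < 3 * n)%N by have := ltn_ord x; lia.
have lt1 (x : 'I_n) : (x < 3 * n)%N by have := ltn_ord x; lia.
apply: ens_if => /=; case: ltnP => /= rab.
  apply: (@ens_bin (c v).+1) => /=; first by rewrite r10 r2 addn1.
    by apply: ltnW_big; nia.
  apply: (@ens_put (c u) (c v).+1) => //=; first by apply: ltnW_big; nia.
  apply: (@ens_time (8 + T)%N); first lia.
  apply: last U2 _ _.
  - by move=> y sy /=; rewrite !ifF //; apply/eqP => yE; rewrite yE in sy.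
  - by move=> x xn /=; rewrite ifF //; apply/eqP; lia.
  - move=> m' m'te m'x.
    apply: (forest_link (r := cell s (n + c v)%N) fs uv cuv) => //.
    + by rewrite !eqxx.
    + by rewrite leq_addl.
    + by rewrite m'x //= eqxx.
    + move=> x; rewrite m'x //= => /negPf xu; rewrite ifF //.
    + by rewrite m'x //= ifF //; apply/eqP; lia.
    + by move=> x _; rewrite m'x //= ifF //; apply/eqP; lia.
apply: (@ens_bin (c u).+1) => /=; first by rewrite r13 r2 addn1.
  by apply: ltnW_big; nia.
apply: (@ens_put (c v) (c u).+1) => //=; first by apply: ltnW_big; nia.
apply: (@ens_bin (cell s (n + c u) == cell s (n + c v))%N) => //.
  by apply: ltnW_big; case: (_ == _)%N; nia.
apply: ens_if => /=; case: (eqVneq (cell s (n + c u)%N) _) => rE /=.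
  apply: (@ens_bin (cell s (n + c u)).+1) => /=; first by rewrite r2 addn1.
    by apply: ltnW_big; nia.
  apply: (@ens_put (n + c u) (cell s (n + c u)).+1) => //=.
    by apply: ltnW_big; nia.
  apply: last U1 _ _.
  - by move=> y sy /=; rewrite !ifF //; apply/eqP => yE; rewrite yE in sy.
  - by move=> x xn /=; rewrite !ifF //; apply/eqP; lia.
  - move=> m' m'te m'x.
    apply: (forest_link (r := (cell s (n + c u)).+1) fs uv cuv) => //.
    + by rewrite !eqxx orbT.
    + by rewrite -rE expnS mul2n addnn.
    + by rewrite m'x //= eqxx ifF //; apply/eqP; lia.
    + move=> x; rewrite m'x //= => /negPf xu; rewrite !ifF //; apply/eqP; have := ltn_ord x; lia.
    + by rewrite m'x //= eqxx.
    + move=> x xu; rewrite m'x //= !ifF //; apply/eqP; first by have := ltn_ord x; lia.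
      by move/addnI/val_inj; apply/eqP.
apply: (@ens_time (8 + T)%N); first lia.
apply: last U1 _ _.
- by move=> y sy /=; rewrite !ifF //; apply/eqP => yE; rewrite yE in sy.
- by move=> x xn /=; rewrite !ifF //; apply/eqP; lia.
- move=> m' m'te m'x.
  apply: (forest_link (r := cell s (n + c u)%N) fs uv cuv) => //.
  + by rewrite !eqxx orbT.
  + by rewrite ltn_neqAle rab andbT eq_sym.
  + by rewrite leq_addl.
  + by rewrite m'x //= eqxx.
  + by move=> x; rewrite m'x //= => /negPf xu; rewrite !ifF.
  + by rewrite m'x //= ifF //; apply/eqP; lia.
  + by move=> x _; rewrite m'x //= ifF //; apply/eqP; lia.
Qed.

Lemma find_root_spec c (x : 'I_n) T k s v :
  forest G (cell s) c -> reg s 2 = 1%N -> reg s 10 = x ->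
  (forall s', cell s' = cell s -> reg s' 10 = c x ->
     (forall y, y != 10%N -> y != 11%N -> reg s' y = reg s y) ->
     ens T (k, s') v) ->
  ens (3 * bit_length n + 2 + T) (find_root ++ k, s) v.
Proof.
move=> fs r2 r10 ok.
rewrite (_ : (_ + _)%N = (3 * bit_length n + 1 + T).+1); last lia.
apply: (@ens_get (cell s x)); first by rewrite r10.
  by apply: ltnW_big; have := forest_cellW x fs; nia.
apply: (@find_root_loop c (bit_length n) x) => //=.
  by apply: leq_trans (leq_subr _ _) _; apply/ltnW/(forest_rank_bound x fs).
move=> s' cs' r10' fr; apply: ok => // y y10 y11.
by rewrite fr //= (negPf y11).
Qed.

Definition unite_time : nat := (6 * bit_length n + 31)%N.

Lemma unite_spec c (u v : 'I_n) T k s val :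
  forest G (cell s) c -> consts s -> reg s 5 = u -> reg s 6 = v ->
  (forall s' c', forest G (cell s') c' -> same_marks s s' -> frame s s' ->
    united G c u v c' -> ens T (k, s') val) ->
  ens (unite_time + T) (unite ++ k, s) val.
Proof.
move=> fs cs r5 r6 ok; have [r2 r3 r4 r7 r8] := cs.
rewrite (_ : (unite_time + T)%N =
  (3 * bit_length n + 2 + (3 * bit_length n + 2 + (22 + T)).+2).+3); last first.
  by rewrite /unite_time; lia.
have small (x : 'I_n) : (x < W)%N by apply: ltnW_big; have := ltn_ord x; nia.
apply: (ens_adj r5 r6); apply: ens_if => /=.
case: ifP => [uv|uv]; last first.
  apply: (@ens_time T); first by lia.
  apply: (ok _ c) => // [y sy /=|]; last by rewrite /united; case: adj uv.
  by rewrite ifF //; apply/eqP => yE; rewrite yE in sy.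
have {}uv : adj G u v by case: adj uv.
apply: (@ens_bin u) => //=; first by rewrite r5 r3 addn0.
apply: (@find_root_spec c u) => //= s1 cs1 r10 fr1.
apply: (@ens_bin (c u)) => //=.
  by rewrite r10 fr1 //= r3 addn0.
apply: (@ens_bin v) => //=; first by rewrite !fr1 //= r6 r3 addn0.
apply: (@find_root_spec c v) => //=; rewrite ?cs1 //=.
  by rewrite fr1.
move=> s2 cs2 r10' fr2.
have fr : frame s s2.
  move=> y sy; rewrite fr2 ?fr1 /= ?fr1 ?ifF //=;
  by apply/eqP => yE; rewrite yE in sy.
apply: (@ens_bin (c u == c v)) => /=.
- by rewrite r10' fr2.
- by apply: ltnW_big; case: (_ == _); nia.
apply: ens_if; case: (eqVneq (c u) (c v)) => cuv /=.
  apply: (@ens_time T); first by lia.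
  apply: (ok _ c) => //=; rewrite ?cs2 //; last by rewrite /united cuv eqxx andbF.
    by move=> x /=; rewrite cs2.
  move=> y sy /=; rewrite ifF ?fr //; apply/eqP => yE; by rewrite yE in sy.
have cs3 : consts s2 by apply: frame_consts cs.
apply: (@ens_time (T + 20)); first by lia.
have fr3 : frame s (upd_reg s2 11 0).
  move=> y sy /=; rewrite ifF ?fr //; apply/eqP => yE; by rewrite yE in sy.
apply: (@link_roots_spec c u v) => //=; rewrite ?cs2 //.
- by rewrite fr.
- by rewrite fr.
- by rewrite fr2.
- move=> s' c' fs' sm fr' un; apply: ok fs' _ (frame_trans fr3 fr') un.
  by move=> x; rewrite sm /= cs2.
Qed.

(** * Sampling random edges *)

Definition sample_edge : seq instr :=
  [:: Rand 5 4; RandNbr 6 5] ++ unite ++ [:: Bin Minus 33 33 2].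

Section Sampling.
Variables (eps lam : R).
Hypotheses (eps0 : 0 <= eps) (lam0 : 0 <= lam) (lam1 : lam <= 1).

Definition good (c : 'I_n -> 'I_n) : bool := (crossings G c)%:R <= eps * n%:R.

Hypothesis drift : forall c, ~~ good c ->
  (1 - lam) * (2 * n)%:R * n%:R <= (crossings G c)%:R.

(** The values that can be promised with [r] samples left. The last bound is Markov's inequality as
    an invariant: while the partition is bad, the expected potential shrinks by [lam] per sample,
    and a bad partition has potential at least 1, so that at [r = 0] a bad partition promises
    nothing. *)
Definition sampling_value (r : nat) (c : 'I_n -> 'I_n) (v : R) : Prop :=
  v <= 0 \/ [/\ (potential G c <= 2 * n)%N, v <= 1 &
                good c || (v <= 1 - lam ^+ r * (potential G c)%:R)].

Lemma sampling_value_united r c c' u w v : adj G u w -> united G c u w c' ->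
  (potential G c <= 2 * n)%N ->
  v <= 1 - lam ^+ r * ((potential G c)%:R - (gain G c u w)%:R) ->
  sampling_value r c' v.
Proof.
move=> uw un Pn vle; have := potential_united uw un => Pc'.
have Pc'R : (potential G c')%:R <= (potential G c)%:R - (gain G c u w)%:R :> R.
  by rewrite lerBrDr -natrD ler_nat.
right; split; first by apply: leq_trans Pn; lia.
- apply: le_trans vle _; rewrite gerBl mulr_ge0 ?exprn_ge0 //.
  by apply: le_trans Pc'R; rewrite ler0n.
- apply/orP; right; apply: le_trans vle _; rewrite lerD2l lerN2.
  by rewrite ler_wpM2l ?exprn_ge0.
Qed.

Lemma good_united c c' u w : united G c u w c' -> good c -> good c'.
Proof.
move=> /united_coarser/crossings_coarser-/(_ G) le_cr; apply: le_trans.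
by rewrite ler_nat.
Qed.

(** By [sum_gain] the mean gain is at least [crossings / n]; as the potential is at most [2 * n],
    [drift] makes this at least a fraction [1 - lam] of it. *)
Lemma sample_edge_drift r c v : (0 < n)%N -> ~~ good c ->
  (potential G c <= 2 * n)%N ->
  v <= 1 - lam ^+ r.+1 * (potential G c)%:R ->
  v <= (\sum_(u < n) (1 - lam ^+ r * ((potential G c)%:R -
         (\sum_(w <- nbrs G u) (gain G c u w)%:R) / (deg G u)%:R))) / n%:R.
Proof.
move=> n0 bad Pn /le_trans; apply.
have n0R : (0 < n%:R :> R) by rewrite ltr0n.
rewrite ler_pdivlMr //.
under eq_bigr do rewrite mulrBr opprB addrA [1 + _]addrC addrAC -addrA.
rewrite big_split /= -mulr_sumr sumr_const card_ord -mulr_natr.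
set P := (potential G c)%:R.
have := sum_gain G R c; set S := \sum_u _ => Sge.
have lamr : 0 <= lam ^+ r by rewrite exprn_ge0.
suff : (1 - lam) * P * n%:R <= S.
  move=> /(ler_wpM2l lamr); rewrite exprSr => h; nra.
apply: le_trans Sge; apply: le_trans (drift bad).
apply: ler_wpM2r; first exact: ltW.
by apply: ler_wpM2l; rewrite ?subr_ge0 ?ler_nat.
Qed.

(** The choice has two stages, hence [g] for the vertex and [f] for its neighbor. Both are constant
    on runs given up and on good partitions, which stay good because merging creates no crossing
    edges. *)
Lemma sampling_value_step r c v : (0 < n)%N -> sampling_value r.+1 c v ->
  exists2 g : 'I_n -> R, v <= (\sum_(u < n) g u) / n%:R & forall u,
    (nbrs G u = [::] -> sampling_value r c (g u)) /\
    (nbrs G u != [::] -> exists2 f : 'I_n -> R,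
      g u <= (\sum_(w <- nbrs G u) f w) / (deg G u)%:R &
      forall w c', adj G u w -> united G c u w c' -> sampling_value r c' (f w)).
Proof.
move=> n0 vok; have n0R : n%:R != 0 :> R by rewrite pnatr_eq0 -lt0n.
have degR u : nbrs G u != [::] -> (deg G u)%:R != 0 :> R.
  by rewrite pnatr_eq0 /deg; case: nbrs.
have avg_cst (x : R) : x <= (\sum_(u < n) x) / n%:R.
  by rewrite sumr_const card_ord -[x *+ n]mulr_natr mulfK.
have avg_nbrs (x : R) u : nbrs G u != [::] -> x <= (\sum_(w <- nbrs G u) x) / (deg G u)%:R.
  move=> u0; rewrite big_const_seq count_predT iter_addr_0 -[x *+ _]mulr_natr mulfK //.
  exact: degR.
case: vok => [v0|[Pn v1 gv]].
  exists (fun=> v) => // u; split=> [_|/avg_nbrs-/(_ v) ?]; first by left.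
  by exists (fun=> v) => // *; left.
have [gc|bad] := boolP (good c).
  exists (fun=> v) => // u; split=> [_|/avg_nbrs-/(_ v) ?].
    by right; split; rewrite ?gc.
  exists (fun=> v) => // w c' uw un; right; split=> //.
    by apply: leq_trans Pn; apply: potential_le un.
  by rewrite (good_united un gc).
rewrite (negPf bad) /= in gv.
exists (fun u => 1 - lam ^+ r * ((potential G c)%:R -
    (\sum_(w <- nbrs G u) (gain G c u w)%:R) / (deg G u)%:R)).
  exact: sample_edge_drift.
move=> u; split=> [->|u0].
  rewrite big_nil mul0r subr0; right; split=> //; last by rewrite lexx orbT.
  by rewrite gerBl mulr_ge0 ?exprn_ge0.
exists (fun w => 1 - lam ^+ r * ((potential G c)%:R - (gain G c u w)%:R)).
  rewrite [X in _ <= X / _](eq_bigr (fun w =>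
    (1 - lam ^+ r * (potential G c)%:R) + lam ^+ r * (gain G c u w)%:R)); last first.
    by move=> w _; ring.
  rewrite big_split /= -mulr_sumr big_const_seq count_predT iter_addr_0.
  rewrite -[_ *+ size _]mulr_natr le_eqVlt; apply/orP; left; apply/eqP.
  by field; apply: degR.
by move=> w c' uw un; apply: sampling_value_united uw un Pn _.
Qed.

Lemma sampling_spec r T k s c v :
  (0 < n)%N -> forest G (cell s) c -> consts s -> reg s 33 = r -> (r < W)%N ->
  sampling_value r c v ->
  (forall s' c' v', forest G (cell s') c' -> consts s' ->
     v' <= 0 \/ v' <= 1 /\ good c' -> ens T (k, s') v') ->
  ens (r * (unite_time + 4) + 1 + T) (While 33 sample_edge :: k, s) v.
Proof.
move=> n0; elim: r s c v => [|r IH] s c v fs cs r33 rW vok ok.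
  rewrite add0n; apply: ens_while; rewrite r33 /=; apply: ok fs cs _.
  case: vok => [|[_ v1]]; [by left|rewrite expr0 mul1r].
  case: (boolP (good c)) => [gc _|bad /= vle]; first by right.
  left; apply: le_trans vle _; rewrite subr_le0 ler1n; apply: crossings_potential.
  rewrite lt0n; apply: contra bad => /eqP c0.
  by rewrite /good c0 mulr_ge0.
have [r2 r3 r4 r7 r8] := cs.
rewrite (_ : (r.+1 * _ + 1 + T)%N =
  (unite_time + (1 + (r * (unite_time + 4) + 1 + T))).+3); last lia.
apply: ens_while; rewrite r33 /=.
have rest s1 (u w : 'I_n) v1 : cell s1 = cell s ->
    (forall y, y != 5%N -> y != 6%N -> reg s1 y = reg s y) ->
    reg s1 5 = u -> reg s1 6 = w ->
    (forall c', united G c u w c' -> sampling_value r c' v1) ->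
    ens (unite_time + (1 + (r * (unite_time + 4) + 1 + T)))
      (unite ++ Bin Minus 33 33 2 :: While 33 sample_edge :: k, s1) v1.
  move=> cs1 fr1 r5 r6 okv.
  have cst1 : consts s1 by split; rewrite fr1.
  apply: (@unite_spec c u w) => //=; first by rewrite cs1.
  move=> s2 c2 fs2 _ fr2 un; have cst2 := frame_consts fr2 cst1.
  have [c2_2 c2_3 c2_4 c2_7 c2_8] := cst2.
  apply: (@ens_bin r) => /=.
  - by rewrite fr2 // fr1 // r33 c2_2 subn1.
  - exact: ltnW.
  - by apply: (IH _ c2) => //=; [apply: ltnW|apply: okv].
have [g vle gok] := sampling_value_step n0 vok.
apply: (@ens_rand _ _ _ _ _ (fun a => oapp g 0 (insub a))); rewrite r4 ?n0 ?leqnn //; last first.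
  by under eq_bigr do rewrite valK /=.
move=> a an; have -> : a = Ordinal an by []; rewrite valK /=.
set u := Ordinal an; have [g0 gf] := gok u.
have [u0|u0] := eqVneq (nbrs G u) [::].
  (* The random neighbor of an isolated vertex is 0 by default; it is not adjacent to [u], so
     nothing is merged. *)
  apply: (@ens_randnbr0 _ _ _ _ _ u) => //.
  apply: (rest _ u (Ordinal n0)) => //=.
    by move=> y /negPf y5 /negPf y6; rewrite y5 y6.
  have nuw w : adj G u w = false by rewrite -mem_nbrs u0.
  by move=> c'; rewrite /united nuw /= => ->; apply: g0.
have [f gle fok] := gf u0.
apply: (@ens_randnbr _ _ _ _ _ u f) => // w uw.
apply: (rest _ u w) => //=.
  by move=> y /negPf y5 /negPf y6; rewrite y5 y6.
by move=> c' un; apply: fok un.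
Qed.

End Sampling.

(** * Probing and scanning neighborhoods *)

Definition scan_nbrs : seq instr :=
  [:: Bin Minus 31 31 2; Nbr 6 5 31; Bin Plus 28 7 6; Put 28 2] ++ unite.

Definition marked (s : state) : {set 'I_n} :=
  [set x : 'I_n | cell s (2 * n + x)%N != 0%N].

Definition marks_bit (s : state) : Prop :=
  forall x : 'I_n, (cell s (2 * n + x) <= 1)%N.

Lemma same_marks_marked s s' : same_marks s s' -> marked s' = marked s.
Proof. by move=> sm; apply/setP=> x; rewrite !inE sm. Qed.

Lemma same_marks_bit s s' : same_marks s s' -> marks_bit s -> marks_bit s'.
Proof. by move=> sm sb x; rewrite sm. Qed.

(** The cells between [2 * n] and [3 * n] hold the marks, which [forest] does not read. *)
Lemma forest_low m m' c : forest G m c -> (forall x, (x < 2 * n)%N -> m' x = m x) ->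
  (forall x, (3 * n <= x)%N -> m' x = m x) -> forest G m' c.
Proof.
move=> fm lo hi.
have lo1 (x : 'I_n) : m' x = m x by apply: lo; have := ltn_ord x; lia.
have lo2 (x : 'I_n) : m' (n + x)%N = m (n + x)%N by apply: lo; have := ltn_ord x; lia.
have hi3 (u v : 'I_n) : m' (3 * n + u * n + v)%N = m (3 * n + u * n + v)%N.
  by apply: hi; lia.
have treeE : @tree n m' = @tree n m.
  by apply/funext=> u; apply/funext=> v; rewrite /tree hi3.
case: fm => f1 f2 f3 f4 f5 f6 f7 f8 f9; split; rewrite ?treeE //.
- by move=> x; rewrite lo1 => /f1.
- by move=> x; rewrite lo1 => /f2[y xy [cyx rxy]]; exists y; rewrite ?lo2.
- by move=> x; rewrite lo1.
- by move=> x; rewrite lo2.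
- by move=> u v; rewrite hi3.
Qed.

Lemma scan_nbrs_spec j T k s c (u : 'I_n) v :
  forest G (cell s) c -> consts s -> marks_bit s -> reg s 5 = u ->
  reg s 31 = j -> (j <= deg G u)%N ->
  (forall s' c', forest G (cell s') c' -> consts s' -> marks_bit s' ->
    (forall y, y \in [:: 18; 19; 20; 21; 22; 33]%N -> reg s' y = reg s y) ->
    coarser c c' ->
    (forall w, w \in take j (nbrs G u) -> c' w = c' u) ->
    marked s' = marked s :|: [set w in take j (nbrs G u)] ->
    ens T (k, s') v) ->
  ens (j * (unite_time + 5) + 1 + T) (While 31 scan_nbrs :: k, s) v.
Proof.
elim: j s c => [|j IH] s c fs cs mb r5 r31 jdeg ok.
  apply: ens_while; rewrite r31 /=; apply: (ok s c) => //.
    by move=> w; rewrite take0.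
  by apply/setP=> x; rewrite !inE take0 orbF.
rewrite (_ : (_ + T)%N = (unite_time + (j * (unite_time + 5) + 1 + T)).+4.+1); last lia.
have [r2 r3 r4 r7 r8] := cs; have un := ltn_ord u.
have jn : (j < n)%N by apply: leq_trans jdeg (card_nbrs u).
apply: ens_while; rewrite r31 /=.
apply: (@ens_bin j) => /=; [by rewrite r31 r2 subn1|by apply: ltnW_big; nia|].
set w := nth u (nbrs G u) j; have wn := ltn_ord w.
have uw : adj G u w by rewrite -mem_nbrs mem_nth.
apply: (@ens_nbr u w) => //=.
  by rewrite (nth_map u).
apply: (@ens_bin (2 * n + w)) => /=; [by rewrite r7|by apply: ltnW_big; nia|].
apply: (@ens_put (2 * n + w) 1) => //=; [by apply: ltnW_big; nia|].
apply: (@unite_spec c u w) => //=.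
- by apply: forest_low fs _ _ => x xn /=; rewrite ifF //; apply/eqP; lia.
move=> s1 c1 fs1 sm1 fr1 un1; have cs1 : consts s1.
  by have [c2 c3 c4 c7 c8] := cs; apply: frame_consts fr1 _; split.
have cc1 := united_coarser un1.
have c1w : c1 w = c1 u.
  move: un1; rewrite /united uw /=; case: eqVneq => [cuw -> //|cuw [l [z [lz ->]]]].
  rewrite /merge; case/orP: lz => /andP[/eqP-> /eqP->]; rewrite !eqxx; by case: eqP.
have m1 : marked s1 = w |: marked s.
  rewrite (same_marks_marked sm1); apply/setP=> x; rewrite !inE /= eqn_add2l.
  by rewrite -(inj_eq val_inj) /=; case: ifP.
have mb1 : marks_bit s1.
  apply: same_marks_bit sm1 _ => x /=; case: ifP => // _; exact: mb.
apply: (IH _ c1) => //; [by rewrite fr1|by rewrite fr1| exact: ltnW|].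
move=> s2 c2 fs2 cs2 mb2 fr2 cc2 c2w m2; apply: (ok s2 c2) => //.
- by move=> y yin; rewrite fr2 // fr1; move: yin; rewrite !inE => /or4P[/eqP->|/eqP->|/eqP->|/or3P[/eqP->|/eqP->|/eqP->]].
- exact: coarser_trans cc1 cc2.
- move=> z; rewrite (take_nth u) // mem_rcons inE => /orP[/eqP->|/c2w //].
  exact: cc2.
- rewrite m2 m1; apply/setP=> x; rewrite !inE (take_nth u) // mem_rcons inE.
  by rewrite orbA; congr orb; apply: orbC.
Qed.

Definition probe_nbrs : seq instr :=
  [:: RandNbr 27 5; Bin Plus 28 7 27; Get 29 28;
      If 29 [:: Bin Plus 6 27 3; Const 26 1] [::]; Bin Minus 25 25 2].

(* Registers: 18, the number of probes; 19, the remaining scan budget; 20, the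
   degree threshold; 22, the next vertex. *)
Definition visit : seq instr :=
  [:: Bin Plus 5 22 3; Deg 23 5; Bin Less 24 20 23;
      If 24 [:: Bin Plus 25 18 3; Const 26 0; While 25 probe_nbrs;
                If 26 unite
                   [:: Bin Less 24 19 23;
                       If 24 [::] [:: Bin Minus 19 19 23; Bin Plus 31 23 3;
                                      While 31 scan_nbrs]]]
            [::]].

Section Visits.
Variables (L : nat) (V : R).
Hypotheses (LW : (L < W)%N) (V1 : V <= 1).

Definition unmarked_nbrs (s : state) (u : 'I_n) : nat :=
  count (fun w => w \notin marked s) (nbrs G u).

(* Half of the neighbors being unmarked is what pays for a scan. *)
Definition probe_value (j : nat) (found : bool) (few : bool) (ok : Prop) (v : R) :=
  v <= 0 \/ [/\ ok, v <= V & [|| found, few | v <= V - 2 ^- j]].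

(** If fewer than half of the neighbors are unmarked, a probe misses the marked ones with
    probability below 1/2, so each probe halves the risk of finding none. *)
Lemma probe_value_step s (u : 'I_n) j ok v :
  nbrs G u != [::] ->
  probe_value j.+1 false (deg G u <= 2 * unmarked_nbrs s u)%N ok v ->
  exists2 f : 'I_n -> R, v <= (\sum_(w <- nbrs G u) f w) / (deg G u)%:R &
   forall w, probe_value j (w \in marked s)
     (deg G u <= 2 * unmarked_nbrs s u)%N ok (f w).
Proof.
move=> u0; have d0 : (0 < (deg G u)%:R :> R).
  by rewrite ltr0n /deg; case: nbrs u0.
have avg_cst (x : R) : x <= (\sum_(w <- nbrs G u) x) / (deg G u)%:R.
  by rewrite big_const_seq count_predT iter_addr_0 -[x *+ _]mulr_natr mulfK ?gt_eqF.
case=> [v0|[okk vV]]; first by exists (fun=> v) => // w; left.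
case: leqP => [le_u /= _|lt_u /= vj].
  by exists (fun=> v) => // w; right; rewrite orbT.
(* A hit restores the full value; a miss leaves the risk of the [j] remaining probes. *)
exists (fun w => if w \in marked s then V else V - 2 ^- j); last first.
  move=> w; right; split=> //; case: ifP => //=.
  by rewrite gerBl invr_ge0 exprn_ge0.
rewrite (eq_bigr (fun w => V - 2 ^- j * (w \notin marked s)%:R)); last first.
  by move=> w _; case: (w \in _); rewrite ?mulr0 ?subr0 ?mulr1.
rewrite sumrB -mulr_sumr -natr_sum -big_mkcond /= sum1_count.
rewrite -/(unmarked_nbrs s u) big_const_seq count_predT iter_addr_0.
rewrite -/(deg G u) -[V *+ _]mulr_natr mulrBl mulfK ?gt_eqF //.
apply: le_trans vj _; rewrite lerD2l lerN2 -mulrA exprS invfM [_^-1 * _]mulrC.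
rewrite ler_wpM2l ?invr_ge0 ?exprn_ge0 // ler_pdivrMr //.
have : ((2 * unmarked_nbrs s u)%:R <= (deg G u)%:R :> R) by rewrite ler_nat ltnW.
by rewrite natrM; lra.
Qed.

Definition kept (s s' : state) : Prop :=
  forall y, y \in [:: 5; 18; 19; 20; 21; 22; 23; 33]%N -> reg s' y = reg s y.

Lemma probe_nbrs_spec j (found : bool) T k s (u w0 : 'I_n) ok v :
  consts s -> marks_bit s -> reg s 5 = u -> nbrs G u != [::] ->
  reg s 25 = j -> (j < W)%N -> reg s 26 = found ->
  (found -> exists2 w : 'I_n, reg s 6 = w & adj G u w && (w \in marked s)) ->
  probe_value j found (deg G u <= 2 * unmarked_nbrs s u)%N ok v ->
  (forall s' (found' : bool) v', cell s' = cell s -> consts s' -> kept s s' ->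
    reg s' 26 = found' ->
    (found' -> exists2 w : 'I_n, reg s' 6 = w & adj G u w && (w \in marked s)) ->
    probe_value 0 found' (deg G u <= 2 * unmarked_nbrs s u)%N ok v' ->
    ens T (k, s') v') ->
  ens (8 * j + 1 + T) (While 25 probe_nbrs :: k, s) v.
Proof.
elim: j found s v => [|j IH] found s v cs mb r5 u0 r25 jW r26 fnd vok okk.
  by apply: ens_while; rewrite r25 /=; apply: okk fnd vok.
have [r2 r3 r4 r7 r8] := cs.
rewrite (_ : (8 * j.+1 + 1 + T)%N = (8 * j + 1 + T).+4.+4); last lia.
apply: ens_while; rewrite r25 /=.
have [f vle fok] : exists2 f : 'I_n -> R,
    v <= (\sum_(w <- nbrs G u) f w) / (deg G u)%:R &
    forall w, probe_value j (found || (w \in marked s))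
     (deg G u <= 2 * unmarked_nbrs s u)%N ok (f w).
  case: found vok {r26 fnd} => [vok|]; last exact: probe_value_step.
  exists (fun=> v); last by case: vok => [|[? ? _]]; [left|right].
  rewrite big_const_seq count_predT iter_addr_0 -[v *+ _]mulr_natr mulfK //.
  by rewrite pnatr_eq0; case: nbrs u0.
apply: (@ens_randnbr _ _ _ _ _ u f) => // w uw; have wn := ltn_ord w.
apply: (@ens_bin (2 * n + w)) => /=; [by rewrite r7|by apply: ltnW_big; nia|].
apply: (@ens_get (cell s (2 * n + w))) => //=.
  by apply: ltnW_big; have := mb w; nia.
apply: ens_if => /=.
have [wm|wm] := boolP (w \in marked s); last first.
  have -> : cell s (2 * n + w) = 0%N by move: wm; rewrite inE => /negPn/eqP.
  apply: (@ens_time (8 * j + 1 + T).+1) => /=; first by lia.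
  apply: (@ens_bin j) => /=; [by rewrite r25 r2 subn1|exact: ltnW|].
  apply: (IH found) => //=; first exact: ltnW.
    by have := fok w; rewrite (negPf wm) orbF.
  move=> s' f' v' cs' cst' kp; apply: okk => //.
  by move=> y yin; rewrite kp //=; move: yin; rewrite !inE; do !case/orP; move/eqP->.
have -> /= : cell s (2 * n + w) != 0%N by move: wm; rewrite inE.
apply: (@ens_bin w) => /=; [by rewrite r3 addn0|by apply: ltnW_big; nia|].
apply: ens_const; first by apply: ltnW_big; nia.
apply: (@ens_bin j) => /=; [by rewrite r25 r2 subn1|exact: ltnW|].
apply: (IH true) => //=; first exact: ltnW.
- by move=> _; exists w; rewrite ?uw.
- by have := fok w; rewrite wm orbT.
move=> s' f' v' cs' cst' kp; apply: okk => //.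
by move=> y yin; rewrite kp //=; move: yin; rewrite !inE; do !case/orP; move/eqP->.
Qed.

Record searching (s : state) (c : 'I_n -> 'I_n) (B : nat) : Prop := Searching {
  searching_forest : forest G (cell s) c;
  searching_consts : consts s;
  searching_marks : marks_bit s;
  searching_samples : reg s 18 = L;
  searching_budget : reg s 19 = B;
  searching_budget_le : (B <= 2 * n)%N
}.

(** The budget starts at [2 * n], and a scan of [u] spends [deg G u] while marking at least half as
    many new vertices. The first part says that the amount spent is at most twice the number of
    marks; the second makes joining a marked vertex useful. *)
Definition covered (d : nat) (s : state) (c : 'I_n -> 'I_n) (B : nat) : Prop :=
  (2 * n <= B + 2 * #|marked s|)%N /\
  forall x, x \in marked s -> (d < #|component c x|)%N.

Lemma component_coarser (c c' : 'I_n -> 'I_n) x : coarser c c' ->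
  (#|component c x| <= #|component c' x|)%N.
Proof.
move=> cc'; apply/subset_leq_card/subsetP=> y; rewrite !inE => /eqP/cc' ->.
exact: eqxx.
Qed.

Lemma component_eq (c : 'I_n -> 'I_n) x y : c x = c y -> component c x = component c y.
Proof. by rewrite /component => ->. Qed.

Definition visit_time : nat := (8 * L + unite_time + 20)%N.
Definition scan_time : nat := (unite_time + 5)%N.

(** The remaining budget [B'] also measures time in the continuation, so that scans are amortized
    over the whole phase. [P] transports facts of the caller that are known only on runs not given
    up. *)
Lemma visit_spec (P : Prop) d B T k s c (u : 'I_n) v :
  searching s c B -> reg s 20 = d -> reg s 22 = u ->
  v <= 0 \/ (covered d s c B /\ P) /\ v <= V - 2 ^- L ->
  (forall s' c' B' v', searching s' c' B' -> (B' <= B)%N -> coarser c c' ->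
    (forall y, y \in [:: 20; 21; 22; 33]%N -> reg s' y = reg s y) ->
    v' <= 0 \/ [/\ v' <= V, covered d s' c' B' /\ P &
                 (d < deg G u)%N -> (d < #|component c' u|)%N] ->
    ens (B' * scan_time + T) (k, s') v') ->
  ens (visit_time + (B * scan_time + T)) (visit ++ k, s) v.
Proof.
move=> [fs cs mb r18 r19 Bn] r20 r22 vok ok; have [r2 r3 r4 r7 r8] := cs.
have un := ltn_ord u; have du : (deg G u <= n)%N := card_nbrs u.
rewrite (_ : (visit_time + _)%N = (8 * L + 1 + (unite_time + 13 +
  (B * scan_time + T))).+4.+2); last by rewrite /visit_time; lia.
apply: (@ens_bin u) => /=; [by rewrite r22 r3 addn0|by apply: ltnW_big; nia|].
apply: (@ens_deg u) => //=.
apply: (@ens_bin (d < deg G u)%N) => /=; [by rewrite r20| |].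
  by apply: ltnW_big; case: (_ < _)%N; nia.
have vV : v <= 0 \/ v <= V.
  case: vok => [|[_ /le_trans h]]; [by left|right; apply: h].
  by rewrite gerBl invr_ge0 exprn_ge0.
apply: ens_if => /=; case: ltnP => [ddeg|degd] /=; last first.
  apply: (@ens_time (B * scan_time + T)); first by lia.
  apply: (ok _ c B) => //.
    by move=> y; rewrite !inE; do !case/orP; move/eqP->.
  case: vok => [|[cov vle]]; [by left|right]; split=> //.
    by case: vV => // v0; apply: le_trans vle _; rewrite gerBl invr_ge0 exprn_ge0.
  by rewrite ltnNge degd.
have u0 : nbrs G u != [::].
  by apply/eqP => u0; move: ddeg; rewrite /deg u0.
apply: (@ens_bin L) => /=; [by rewrite r18 r3 addn0|by []|].
apply: ens_const; first by apply: ltnW_big; nia.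
set s0 := (upd_reg _ 26 _).
apply: (@probe_nbrs_spec L false _ _ s0 u u (covered d s c B /\ P)) => //.
  case: vok => [|[cov vle]]; [by left|right; split=> //].
    by apply: le_trans vle _; rewrite gerBl invr_ge0 exprn_ge0.
  by rewrite vle orbT.
move=> s1 found v1 cs1 cst1 kp1 r26 fnd v1ok.
have [c2 c3 c4 c7 c8] := cst1.
rewrite (_ : (unite_time + 13 + _)%N =
  (12 + (unite_time + (B * scan_time + T))).+1); last lia.
apply: ens_if; rewrite r26; case: found r26 fnd v1ok => r26 fnd v1ok /=.
  have [w r6 /andP[uw wm]] := fnd isT.
  apply: (@ens_time (unite_time + (B * scan_time + T))); first by lia.
  apply: (@unite_spec c u w) => //; rewrite ?cs1 //; first by rewrite kp1.
  move=> s2 c2' fs2 sm2 fr2 un2.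
  have m2 : marked s2 = marked s.
    by rewrite (same_marks_marked sm2); apply/setP=> x; rewrite !inE cs1.
  have cc2 := united_coarser un2.
  have c2w : c2' w = c2' u.
    move: un2; rewrite /united uw /=; case: eqVneq => [cuw -> //|cuw [l [z [lz ->]]]].
    by rewrite /merge; case/orP: lz => /andP[/eqP-> /eqP->]; rewrite !eqxx; case: eqP.
  apply: (ok _ c2' B) => //.
  - split=> //; first exact: frame_consts cst1.
    + by apply: same_marks_bit sm2 _ => x; rewrite cs1; apply: mb.
    + by rewrite fr2 // kp1.
    + by rewrite fr2 // kp1.
  - by move=> y; rewrite !inE; do !case/orP; move/eqP->; rewrite fr2 // kp1.
  - case: v1ok => [|[[[Bm mcomp] p] v1V _]]; [by left|right]; split=> //.
      split=> //; split; first by rewrite m2.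
      by move=> x; rewrite m2 => /mcomp/leq_trans; apply; apply: component_coarser.
    move=> _; rewrite (component_eq (esym c2w)).
    by apply: leq_trans (mcomp _ wm) _; apply: component_coarser.
apply: (@ens_bin (B < deg G u)%N) => /=.
- by rewrite !kp1 //= r19.
- by apply: ltnW_big; case: (_ < _)%N; nia.
have v1cov : v1 <= 0 \/ [/\ covered d s c B /\ P, v1 <= V & (deg G u <= 2 * unmarked_nbrs s u)%N].
  case: v1ok => [|[cov v1V /= /orP[few|v1le]]]; [by left|by right|].
  by left; apply: le_trans v1le _; rewrite expr0 invr1 subr_le0.
have unmarkedE : (unmarked_nbrs s u = #|[set w | w \in nbrs G u] :\: marked s|)%N.
  rewrite /unmarked_nbrs -size_filter -(card_uniqP _); last first.
    exact: filter_uniq (nbrs_uniq G u).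
  by apply: eq_card => w; rewrite mem_filter !inE.
apply: ens_if => /=; case: ltnP => [Bdeg|degB] /=.
  apply: (@ens_time (B * scan_time + T)); first by lia.
  apply: (ok _ c B) => //.
  - split=> //=; rewrite ?cs1 //; try by rewrite kp1.
    by move=> x /=; rewrite cs1; apply: mb.
  - by move=> y; rewrite !inE; do !case/orP; move/eqP->; rewrite /= kp1.
  (* By [covered] the budget is at least twice the number of unmarked vertices, hence at least
     [deg G u] when half of the neighbors are unmarked. A refused scan therefore occurs only on a
     run given up. *)
  - left; case: v1cov => [//|[[[Bm _] _] _ few]].
    have := cardsC (marked s); rewrite card_ord.
    have : (unmarked_nbrs s u <= #|~: marked s|)%N.
      by rewrite unmarkedE; apply/subset_leq_card; rewrite setDE subsetIr.
    lia.
apply: (@ens_bin (B - deg G u)) => /=.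
- by rewrite !kp1 //= r19.
- by apply: ltnW_big; nia.
apply: (@ens_bin (deg G u)) => /=.
- by rewrite c3 addn0 kp1.
- by apply: ltnW_big; nia.
apply: (@ens_time (deg G u * scan_time + 1 + ((B - deg G u) * scan_time + T))).
  by rewrite -[in leqRHS](subnK degB) mulnDl; lia.
apply: (@scan_nbrs_spec _ _ _ _ c u) => //=.
- by rewrite cs1.
- by move=> x /=; rewrite cs1; apply: mb.
- by rewrite kp1.
move=> s2 c2' fs2 cst2 mb2 fr2 cc2 c2w m2; rewrite take_size in c2w m2.
have m2' : marked s2 = marked s :|: [set w in nbrs G u].
  by rewrite m2; congr (_ :|: _); apply/setP=> x; rewrite !inE /= cs1.
have big : (deg G u < #|component c2' u|)%N.
  have uN : u \notin [set w in nbrs G u] by rewrite inE mem_nbrs adj_irr.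
  rewrite (_ : (deg G u).+1 = #|u |: [set w in nbrs G u]|).
    apply/subset_leq_card/subsetP=> x; rewrite !inE => /orP[/eqP->//|/c2w->].
    exact: eqxx.
  by rewrite cardsU1 uN cardsE (card_uniqP (nbrs_uniq G u)).
apply: (ok _ c2' (B - deg G u)%N) => //.
- split=> //; rewrite ?fr2 //=; first by rewrite kp1.
  by rewrite (leq_trans (leq_subr _ _)).
- exact: leq_subr.
- by move=> y; rewrite !inE; do !case/orP; move/eqP->; rewrite fr2 //= kp1.
- case: v1cov => [|[[[Bm mcomp] p] v1V few]]; [by left|right]; split=> //.
    split=> //; split.
      (* The new marks are at least half of the degree just taken from the budget. *)
      have : (#|marked s| + unmarked_nbrs s u <= #|marked s2|)%N.
        rewrite unmarkedE -cardsUI (_ : _ :&: _ = set0); last first.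
          by rewrite setIDA setIC setDIl setDv setI0.
        rewrite cards0 addn0 m2'; apply/subset_leq_card/subsetP=> x.
        by rewrite !inE; case: (cell _ _ != 0%N).
      lia.
    move=> x; rewrite m2' inE => /orP[/mcomp/leq_trans|].
      by apply; apply: component_coarser.
    rewrite inE => /c2w xu; rewrite (component_eq xu).
    exact: ltn_trans big.
  by move=> _; apply: ltn_trans big.
Qed.

End Visits.

(** * Rounds of decreasing degree thresholds *)

Definition threshold_round : seq instr :=
  [:: Const 24 2; Bin Quo 20 20 24; Bin Plus 22 4 3;
      While 22 (Bin Minus 22 22 2 :: visit); Bin Plus 21 20 3].

Section Covering.
Variables (L : nat).
Hypotheses (LW : (L < W)%N) (n0 : (0 < n)%N).

(** A union bound over the vertices: each visit may fail with probability [2 ^- L]. *)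
Lemma visits_spec (Q : Prop) j d B T k s c V v : V <= 1 ->
  searching L s c B -> reg s 20 = d -> reg s 22 = j -> (j <= n)%N ->
  v <= 0 \/ [/\ covered d s c B /\ Q, v <= V - j%:R * 2 ^- L &
    forall x : 'I_n, (j <= x)%N -> (d < deg G x)%N -> (d < #|component c x|)%N] ->
  (forall s' c' B' v', searching L s' c' B' -> (B' <= B)%N -> coarser c c' ->
    (forall y, y \in [:: 20; 21; 33]%N -> reg s' y = reg s y) ->
    v' <= 0 \/ [/\ v' <= V, covered d s' c' B' /\ Q &
      forall x : 'I_n, (d < deg G x)%N -> (d < #|component c' x|)%N] ->
    ens (B' * scan_time + T) (k, s') v') ->
  ens (j * (visit_time L + 2) + 1 + (B * scan_time + T))
    (While 22 (Bin Minus 22 22 2 :: visit) :: k, s) v.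
Proof.
move=> V1; elim: j B s c V v V1 => [|j IH] B s c V v V1 ss r20 r22 jn vok ok.
  apply: ens_while; rewrite r22 /=; apply: (ok s c) => //.
  by case: vok => [|[cov vV big]]; [left|right; rewrite mul0r subr0 in vV; split=> // x; apply: big].
have [r2 r3 r4 r7 r8] := searching_consts ss.
rewrite (_ : (_ + (B * scan_time + T))%N = (visit_time L + (B * scan_time +
   (j * (visit_time L + 2) + 1 + T))).+2); last lia.
apply: ens_while; rewrite r22 /=.
apply: (@ens_bin j) => /=; [by rewrite r22 r2 subn1|by apply: ltnW_big; nia|].
pose u := Ordinal jn.
have V'1 : V - j%:R * 2 ^- L <= 1.
  by apply: le_trans V1; rewrite gerBl mulr_ge0 ?invr_ge0 ?exprn_ge0.
pose P := Q /\ forall x : 'I_n, (j < x)%N -> (d < deg G x)%N ->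
  (d < #|component c x|)%N.
apply: (@visit_spec L _ LW V'1 P d B _ _ _ c u) => //=.
- case: ss => fs cs mb r18 r19 Bn; split=> //=.
- case: vok => [|[[cov q] vV big]]; [by left|right]; split; first by split.
  by apply: le_trans vV _; rewrite -addn1 natrD mulrDl mul1r opprD addrA.
move=> s1 c1 B1 v1 ss1 BB1 cc1 fr1 v1ok.
have [e2 e3 e4 e7 e8] := searching_consts ss1.
rewrite (_ : (B1 * scan_time + _)%N =
  (j * (visit_time L + 2) + 1 + (B1 * scan_time + T))%N); last lia.
apply: (IH _ _ c1 V) => //; rewrite ?fr1 //=; first exact: ltnW.
  case: v1ok => [|[v1V [cov1 [q big]] big1]]; [by left|right]; split=> // x jx dx.
  have [xj|jx'] := eqVneq (val x) j.
    have xu : x = u by apply: val_inj.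
    by rewrite xu in dx *; apply: big1.
  apply: leq_trans (big x _ dx) (component_coarser _ cc1).
  by rewrite ltn_neqAle eq_sym jx'.
move=> s2 c2 B2 v2 ss2 BB2 cc2 fr2 v2ok; apply: (ok _ c2) => //.
- exact: leq_trans BB2 BB1.
- exact: coarser_trans cc1 cc2.
- by move=> y; rewrite !inE => yin; rewrite fr2 ?inE // fr1 /= ?inE; move: yin; do !case/orP; move/eqP->.
Qed.

Lemma sum_component (c : 'I_n -> 'I_n) : (\sum_r #|[set u | c u == r]| = n)%N.
Proof.
transitivity (\sum_(u : 'I_n) 1)%N; last by rewrite sum1_card card_ord.
rewrite [RHS](partition_big c predT) //=.
by apply: eq_bigr => r _; rewrite -sum1_card; apply: eq_bigl => u; rewrite inE.
Qed.

Lemma potential_bound (c : 'I_n -> 'I_n) :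
  (forall x, (0 < deg G x)%N -> (deg G x < 2 * #|component c x|)%N) ->
  (potential G c <= 2 * n)%N.
Proof.
move=> big; rewrite -[in leqRHS](sum_component c) big_distrr /=.
apply: leq_sum => r _; apply/bigmax_leqP => u /eqP cu.
case: (posnP (deg G u)) => [-> //|/big/ltnW]; by rewrite /component cu.
Qed.

Definition covering_time (i B : nat) : nat :=
  (i * (n * (visit_time L + 2) + 6) + 1 + B * scan_time)%N.

Lemma covering_stop (T : nat) k s c V v (a : R) : 0 <= a ->
  forest G (cell s) c -> consts s -> reg s 21 = 0%N ->
  v <= 0 \/ v <= V - a /\
    (forall x, (0 < deg G x)%N -> (deg G x < 2 * #|component c x|)%N) ->
  (forall s' c' v', forest G (cell s') c' -> consts s' -> reg s' 33 = reg s 33 ->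
    v' <= 0 \/ v' <= V /\ (potential G c' <= 2 * n)%N ->
    ens T (k, s') v') ->
  ens T.+1 (While 21 threshold_round :: k, s) v.
Proof.
move=> a0 fs cs r21 vok ok; apply: ens_while; rewrite r21 /=.
apply: (ok _ c) => //; case: vok => [|[vV big]]; [by left|right]; split.
  by apply: le_trans vV _; rewrite gerBl.
exact: potential_bound.
Qed.

(** Register 21 keeps the threshold of the round just finished, so the loop ends only after a round
    with threshold 0; [i] bounds the rounds that are left. Marks and budget are never reset: a class
    larger than one threshold is larger than all later ones. *)
Lemma covering_spec i d f B T k s c V v : V <= 1 ->
  searching L s c B -> reg s 20 = d -> reg s 21 = f -> (d <= n)%N ->
  (if f == 0%N then d = 0%N else (0 < d < 2 ^ i)%N) ->
  v <= 0 \/ [/\ covered d s c B, v <= V - (i * n)%:R * 2 ^- L &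
    forall x, (d < deg G x)%N -> (deg G x < 2 * #|component c x|)%N] ->
  (forall s' c' v', forest G (cell s') c' -> consts s' -> reg s' 33 = reg s 33 ->
    v' <= 0 \/ v' <= V /\ (potential G c' <= 2 * n)%N ->
    ens T (k, s') v') ->
  ens (covering_time i B + T) (While 21 threshold_round :: k, s) v.
Proof.
move=> V1; elim: i d f B s c v => [|i IH] d f B s c v ss r20 r21 dn fd vok ok;
    rewrite /covering_time; have [fs cs _ _ _ _] := ss.
- have f0 : f = 0%N.
    by move: fd; case: eqP => // _; case: (d) => // ? /andP[].
  rewrite f0 /= in fd; rewrite fd in vok; apply: (@ens_time T.+1); first lia.
  apply: (@covering_stop _ _ _ c V v 0) => //; first by rewrite r21.
  by case: vok => [|[_ vV big]]; [left|right; split=> //; rewrite mul0n mul0r in vV].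
have [f0|f0] := eqVneq f 0%N.
  rewrite f0 /= in fd; rewrite fd in vok; apply: (@ens_time T.+1); first lia.
  apply: (@covering_stop _ _ _ c V v ((i.+1 * n)%:R * 2 ^- L)) => //.
  - by rewrite mulr_ge0 ?invr_ge0 ?exprn_ge0.
  - by rewrite r21.
  - by case: vok => [|[_ vV big]]; [left|right; split].
rewrite (negPf f0) in fd; case/andP: fd => _ fd.
have [r2 r3 r4 r7 r8] := cs.
rewrite (_ : (_ + T)%N = (n * (visit_time L + 2) + 1 + (B * scan_time +
   (1 + (i * (n * (visit_time L + 2) + 6) + 1 + T)))).+4); last lia.
apply: ens_while; rewrite r21 f0 /=.
apply: ens_const; first by apply: ltnW_big; nia.
apply: (@ens_bin (d %/ 2)) => /=; [by rewrite r20| |].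
  by apply: ltnW_big; apply: leq_trans (leq_div _ _) _; nia.
apply: (@ens_bin n) => /=; [by rewrite r4 r3 addn0|by apply: ltnW_big; nia|].
set d' := (d %/ 2)%N; have dd' : (d <= 2 * d' + 1)%N.
  by rewrite /d' {1}(divn_eq d 2); have := ltn_pmod d (isT : 0 < 2)%N; lia.
have d'd : (d' <= d)%N by apply: leq_div.
pose Q := forall x, (d < deg G x)%N -> (deg G x < 2 * #|component c x|)%N.
have V'1 : V - (i * n)%:R * 2 ^- L <= 1.
  by apply: le_trans V1; rewrite gerBl mulr_ge0 ?invr_ge0 ?exprn_ge0.
apply: (@visits_spec Q n d' B _ _ _ c _ _ V'1) => //=.
- by case: ss.
- case: vok => [|[[Bm mcomp] vV big]]; [by left|right]; split.
  + by split=> //; split=> // x /mcomp; apply: leq_ltn_trans.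
  + by apply: le_trans vV _; rewrite mulSn addnC natrD mulrDl opprD addrA.
  + by move=> x; rewrite leqNgt ltn_ord.
move=> s1 c1 B1 v1 ss1 BB1 cc1 fr1 v1ok.
have [e2 e3 e4 e7 e8] := searching_consts ss1.
rewrite addnCA add1n.
apply: (@ens_bin d') => /=; [by rewrite fr1 // e3 addn0|by apply: ltnW_big; nia|].
rewrite (_ : (B1 * scan_time + _)%N = (covering_time i B1 + T)%N); last first.
  by rewrite /covering_time; lia.
apply: (IH d' d' B1 _ c1) => //=.
- by case: ss1.
- by rewrite fr1.
- exact: leq_trans d'd dn.
- by case: posnP => // _; rewrite ltn_divLR // -expnSr.
- case: v1ok => [|[v1V [cov1 q] big1]]; [by left|right]; split=> // x dx.
  (* Between the two thresholds, [deg G x <= d <= 2 * d' + 1] and the class has more than [d']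
     vertices. Above the old threshold the bound is inherited, since classes only grow. *)
  have [xd|dx'] := leqP (deg G x) d.
    by apply: leq_ltn_trans xd _; apply: leq_ltn_trans dd' _; have := big1 x dx; lia.
  apply: leq_trans (q x dx') _; rewrite leq_mul2l /=.
  exact: component_coarser.
- by move=> s2 c2 v2 fs2 cs2 r33 v2ok; apply: ok fs2 cs2 _ v2ok; rewrite r33 fr1.
Qed.

End Covering.
(* Doubling modulo W until 0 computes W / 2 and the word length, which serves as
   the number of probes. *)
Definition doubling : seq instr :=
  [:: Bin Plus 30 24 3; Bin Plus 24 30 30; Bin Plus 18 18 2].

(** [W] is not itself a word, so [1 / eps] is approximated as [W / 2] over half of the fixed-point
    [eps], plus 1 to avoid a zero divisor. The cap at [n] keeps the number of samples within a word
    when [eps] is tiny or truncated to 0. *)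
Definition setup : seq instr :=
  [:: Const 2 1; Bin Plus 4 0 3; Bin Plus 7 4 4; Bin Plus 8 7 4;
      Bin Plus 19 7 3; Bin Plus 20 4 3; Bin Plus 21 2 3;
      Bin Plus 30 2 3; Bin Plus 18 2 3; Bin Plus 24 2 2;
      While 24 doubling;
      Const 24 2; Bin Quo 1 1 24; Bin Plus 1 1 2; Bin Quo 30 30 1;
      Bin Less 24 4 30; If 24 [:: Bin Plus 30 4 3] [::];
      Bin Plus 30 30 2; Bin Times 33 4 30; Bin Times 33 33 18;
      Bin Plus 33 33 33; Bin Plus 33 33 33].

Definition construction_program : seq instr :=
  setup ++ [:: While 21 threshold_round; While 33 sample_edge].

Lemma doubling_spec K i m T k s v : W = (2 ^ K)%N -> K = (i + m).+1 -> (K < W)%N ->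
  reg s 2 = 1%N -> reg s 3 = 0%N -> reg s 30 = (2 ^ i)%N ->
  reg s 24 = (2 ^ i.+1 %% W)%N -> reg s 18 = i.+1 ->
  (forall s', cell s' = cell s ->
     (forall y, y \notin [:: 18; 24; 30]%N -> reg s' y = reg s y) ->
     reg s' 30 = (2 ^ K.-1)%N -> reg s' 18 = K -> ens T (k, s') v) ->
  ens (4 * m + 1 + T) (While 24 doubling :: k, s) v.
Proof.
move=> WE; elim: m i s => [|m IH] i s KE KW r2 r3 r30 r24 r18 ok.
  rewrite addn0 in KE; have {}r24 : reg s 24 = 0%N by rewrite r24 WE KE modnn.
  apply: ens_while; rewrite r24 /=.
  by apply: ok => //; rewrite KE.
rewrite (_ : (4 * m.+1 + 1 + T)%N = (4 * m + 1 + T).+4); last lia.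
have iK : (i.+1 < K)%N by rewrite KE; lia.
have iW : (2 ^ i.+1 < W)%N by rewrite WE ltn_exp2l.
apply: ens_while; rewrite r24 modn_small // -lt0n expn_gt0 /=.
apply: (@ens_bin (2 ^ i.+1)) => /=; [by rewrite r24 r3 addn0 modn_small|by []|].
apply: ensures_det; first by [].
apply: (@ens_bin i.+2) => /=; [by rewrite r18 r2 addn1|by lia|].
apply: (IH i.+1) => //=; first by rewrite KE; lia.
  by rewrite addnn -mul2n -expnS.
move=> s' cs' fr r30' r18'; apply: ok => // y yin.
by rewrite fr //=; move: yin; rewrite !inE; case: (y == 18%N); case: (y == 24%N); case: (y == 30%N).
Qed.

Lemma setup_spec K e T k s v : W = (2 ^ K)%N -> (0 < K)%N ->
  (64 * (n + 1) * (n + 1) * K < W)%N -> (e < W)%N ->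
  reg s 0 = n -> reg s 1 = e -> reg s 3 = 0%N ->
  let q := minn (2 ^ K.-1 %/ (e %/ 2).+1) n in
  (forall s', cell s' = cell s -> consts s' -> reg s' 18 = K ->
    reg s' 19 = (2 * n)%N -> reg s' 20 = n -> reg s' 21 = 1%N ->
    reg s' 33 = (4 * (n * q.+1 * K))%N -> ens T (k, s') v) ->
  ens (4 * K + 22 + T) (setup ++ k, s) v.
Proof.
move=> WE K0 KW eW r0 r1 r3 q ok.
have W1 : (1 < W)%N by nia.
have K_W : (K < W)%N by nia.
have e2W : ((e %/ 2).+1 < W)%N.
  by have := leq_div2r 2 (ltnW eW); have := divn_eq e 2; have := ltn_pmod e (isT : 0 < 2)%N; lia.
have q0W : (2 ^ K.-1 %/ (e %/ 2).+1 < W)%N.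
  apply: leq_ltn_trans (leq_div _ _) _; rewrite WE ltn_exp2l //; lia.
have qn : (q <= n)%N by apply: geq_minr.
have tW : (64 * (n * q.+1 * K) < W)%N.
  by apply: leq_ltn_trans KW; rewrite -!mulnA leq_mul2l /=; apply: leq_mul; [lia|]; apply: leq_mul; lia.
rewrite (_ : (4 * K + 22 + T)%N =
  ((4 * K.-1 + 1 + (15 + T)).+4).+4.+2); last lia.
apply: ens_const => //.
apply: (@ens_bin n) => /=; [by rewrite r0 r3 addn0|by apply: ltnW_big; nia|].
apply: (@ens_bin (2 * n)) => /=; [by lia|by apply: ltnW_big; nia|].
apply: (@ens_bin (3 * n)) => /=; [by lia|by apply: ltnW_big; nia|].
apply: (@ens_bin (2 * n)) => /=; [by rewrite r3 addn0|by apply: ltnW_big; nia|].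
apply: (@ens_bin n) => /=; [by rewrite r3 addn0|by apply: ltnW_big; nia|].
apply: (@ens_bin 1) => /=; [by rewrite r3 addn0|by []|].
apply: (@ens_bin 1) => /=; [by rewrite r3 addn0|by []|].
apply: (@ens_bin 1) => /=; [by rewrite r3 addn0|by []|].
apply: (@ens_bin 2) => /=; [by []|by apply: ltnW_big; nia|].
apply: (@doubling_spec K 0 K.-1) => //=.
- by rewrite add0n prednK.
- by rewrite modn_small //; apply: ltnW_big; nia.
move=> s1 cs1 fr1 r30 r18.
apply: ens_const; first by apply: ltnW_big; nia.
apply: (@ens_bin (e %/ 2)) => /=; [by rewrite fr1 //= r1|by lia|].
apply: (@ens_bin (e %/ 2).+1) => /=; [by rewrite fr1 //= addn1|by []|].
apply: (@ens_bin (2 ^ K.-1 %/ (e %/ 2).+1)) => /=; [by rewrite r30|by []|].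
apply: (@ens_bin (n < 2 ^ K.-1 %/ (e %/ 2).+1)%N) => /=; [by rewrite fr1| |].
  by apply: leq_ltn_trans W1; case: (_ < _)%N.
have fin s2 : cell s2 = cell s -> (forall y, y \notin [:: 1; 18; 24; 30]%N -> reg s2 y = reg s1 y) ->
    reg s2 18 = K -> reg s2 30 = q -> ens (5 + T) ([:: Bin Plus 30 30 2; Bin Times 33 4 30; Bin Times 33 33 18;
      Bin Plus 33 33 33; Bin Plus 33 33 33] ++ k, s2) v.
  move=> cs2 fr2 r18' r30'.
  apply: (@ens_bin q.+1) => /=; [by rewrite r30' fr2 // fr1 //= addn1|by apply: ltnW_big; nia|].
  apply: (@ens_bin (n * q.+1)) => /=; [by rewrite fr2 // fr1|by apply: leq_ltn_trans tW; nia|].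
  apply: (@ens_bin (n * q.+1 * K)) => /=; [by rewrite r18'|by apply: leq_ltn_trans tW; nia|].
  apply: (@ens_bin (2 * (n * q.+1 * K))) => /=; [by lia|by apply: leq_ltn_trans tW; nia|].
  apply: (@ens_bin (4 * (n * q.+1 * K))) => /=; [by lia|by apply: leq_ltn_trans tW; nia|].
  by apply: ok => //=; try split; rewrite /= ?fr2 //= fr1 //= r3.
apply: ens_if => /=; case: ltnP => [nq|qn'] /=.
  apply: (@ens_time (6 + T)); first lia.
  apply: (@ens_bin n) => /=; [by rewrite !fr1 //= r3 addn0|by apply: ltnW_big; nia|].
  apply: fin => //=.
  - by move=> y; rewrite !inE; case: (y == 1%N); case: (y == 18%N); case: (y == 24%N); case: (y == 30%N).
  - by rewrite /q; apply/esym/minn_idPr/ltnW.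
apply: (@ens_time (5 + T)); first lia.
apply: fin => //=.
- by move=> y; rewrite !inE; case: (y == 1%N); case: (y == 18%N); case: (y == 24%N); case: (y == 30%N).
- by rewrite /q; apply/esym/minn_idPl.
Qed.

(** * The oracle and the whole construction *)

Definition query_program : seq instr :=
  [:: Adj 12 0 1; Bin Times 13 0 4; Bin Plus 13 13 1; Bin Plus 13 13 8;
      Get 14 13; Bin Plus 10 0 3] ++ find_root ++
  [:: Bin Plus 15 10 3; Bin Plus 10 1 3] ++ find_root ++
  [:: Bin Same 15 15 10; Bin Minus 15 2 15; Bin Times 15 15 12;
      Bin Plus 0 15 14].

Definition answer (m : nat -> nat) (c : 'I_n -> 'I_n) : rel 'I_n :=
  fun u v => tree m u v || cross G c u v.

Definition query_time : nat := (6 * bit_length n + 16)%N.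

Lemma query_spec c (u v : 'I_n) T k s val :
  forest G (cell s) c -> consts s -> reg s 0 = u -> reg s 1 = v ->
  (forall s', (reg s' 0 != 0%N) = answer (cell s) c u v -> ens T (k, s') val) ->
  ens (query_time + T) (query_program ++ k, s) val.
Proof.
move=> fs [r2 r3 r4 r7 r8] r0 r1 ok.
have un := ltn_ord u; have vn := ltn_ord v.
have unn : (u * n <= n * n)%N by rewrite leq_mul2r ltnW ?orbT.
have b1 (b : bool) : (b < W)%N by apply: ltnW_big; case: b; nia.
have small (x : 'I_n) : (x < W)%N by apply: ltnW_big; have := ltn_ord x; nia.
rewrite (_ : (query_time + T)%N = (3 * bit_length n + 2 +
  (3 * bit_length n + 2 + (4 + T)).+2).+4.+2); last by rewrite /query_time; lia.
apply: (ens_adj r0 r1).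
apply: (@ens_bin (u * n)) => /=; [by rewrite r0 r4|by apply: ltnW_big; nia|].
apply: (@ens_bin (u * n + v)) => /=; [by rewrite r1|by apply: ltnW_big; nia|].
apply: (@ens_bin (3 * n + u * n + v)) => /=; [by rewrite r8; lia|by apply: ltnW_big; nia|].
apply: (@ens_get (cell s (3 * n + u * n + v))) => //=.
  by apply: ltnW_big; have := tree_bit fs u v; nia.
apply: (@ens_bin u) => //=; first by rewrite r0 r3 addn0.
apply: (@find_root_spec c u) => //= s1 cs1 r10 fr1.
apply: (@ens_bin (c u)) => //=; first by rewrite r10 fr1 //= r3 addn0.
apply: (@ens_bin v) => //=; first by rewrite !fr1 //= r1 r3 addn0.
apply: (@find_root_spec c v) => //=; rewrite ?cs1 //=; first by rewrite fr1.
move=> s2 cs2 r10' fr2.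
apply: (@ens_bin (c u == c v)) => //=; first by rewrite r10' fr2.
apply: (@ens_bin (c u != c v)) => //=.
  by rewrite fr2 //= fr1 //= r2; case: (c u == c v).
apply: (@ens_bin (cross G c u v)) => //=.
  by rewrite fr2 //= fr1 //= /cross mulnC mulnb.
apply: (@ens_bin (cross G c u v + cell s (3 * n + u * n + v))) => /=.
- by rewrite fr2 //= fr1.
- by apply: ltnW_big; have := tree_bit fs u v; case: cross; nia.
apply: ok => /=; rewrite /answer /tree addn_eq0 negb_and orbC eqb0 negbK.
by [].
Qed.

(** An edge of [G] inside a class is replaced by a tree path, all others are kept; the forest
    contributes at most [n] edges and the crossings at most [eps * n]. *)
Lemma answer_spanning c (m : nat -> nat) (eps : R) : forest G m c ->
  good eps c -> sparse_spanning_subgraph G eps (answer m c).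
Proof.
move=> fm gc; have crossC : symmetric (cross G c).
  by move=> u v; rewrite /cross adj_sym eq_sym.
have sub : subrel (answer m c) (adj G).
  by move=> u v /orP[/(tree_sub fm)|/andP[]].
have symA : symmetric (answer m c).
  by move=> u v; rewrite /answer (tree_sym fm) crossC.
split=> //.
  rewrite mulrDl mul1r; apply: le_trans (lerD (lexx _) gc); rewrite -natrD ler_nat.
  have := tree_edges fm; rewrite /crossings.
  have : (#|edges (answer m c)| <= #|edges (@tree n m)| + #|edges (cross G c)|)%N.
    apply: leq_trans (leq_card_setU _ _); apply/subset_leq_card/subsetP=> A.
    case/imsetP=> [[x y]]; rewrite inE /= => /orP[xy|xy] ->; rewrite inE ?(edges_set2 xy) //.
    by rewrite orbT.
  lia.
move=> u v; apply/idP/idP; apply: connect_sub => x y xy.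
  by apply/connect1/sub.
have [cxy|cxy] := eqVneq (c x) (c y); last first.
  by apply: connect1; rewrite /answer /cross xy cxy orbT.
apply: connect_sub (tree_connect fm cxy) => a b ab.
by apply: connect1; rewrite /answer ab.
Qed.

Lemma forest_init : forest G (fun=> 0%N) id.
Proof.
have treeE : @tree n (fun=> 0%N) = fun _ _ => false by [].
split=> //.
- by move=> x; rewrite expn0; apply/card_gt0P; exists x; rewrite inE.
- by move=> u v ->.
rewrite (_ : edges _ = set0).
  by rewrite cards0 add0n -[leqRHS]card_ord max_card.
by apply/setP=> A; rewrite inE; apply/imsetP=> -[p]; rewrite inE.
Qed.

Definition construction_time (K t : nat) : nat :=
  (4 * K + 22 + (covering_time K (bit_length n) (2 * n) +
    (t * (unite_time + 4) + 1 + 0)))%N.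

(** The failures add up: [bit_length n * n] visits with [K] probes each, and the sampling phase with
    initial potential at most [2 * n]. *)
Lemma construction_spec K e s v (eps lam : R) :
  let q := minn (2 ^ K.-1 %/ (e %/ 2).+1) n in
  let t := (4 * (n * q.+1 * K))%N in
  (0 < n)%N -> W = (2 ^ K)%N -> (0 < K)%N ->
  (64 * (n + 1) * (n + 1) * K < W)%N -> (e < W)%N ->
  reg s 0 = n -> reg s 1 = e -> reg s 3 = 0%N -> cell s = (fun=> 0%N) ->
  0 <= eps -> 0 <= lam -> lam <= 1 ->
  (forall c, ~~ good eps c ->
    (1 - lam) * (2 * n)%:R * n%:R <= (crossings G c)%:R) ->
  v <= 1 - lam ^+ t * (2 * n)%:R - (bit_length n * n)%:R * 2 ^- K ->
  (forall s' c' v', forest G (cell s') c' -> consts s' ->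
     v' <= 0 \/ v' <= 1 /\ good eps c' -> ens 0 ([::], s') v') ->
  ens (construction_time K t) (construction_program, s) v.
Proof.
move=> q t n0 WE K0 KW eW r0 r1 r3 cs0 eps0 lam0 lam1 drift vle ok.
have V1 : 1 - lam ^+ t * (2 * n)%:R <= 1.
  by rewrite gerBl mulr_ge0 ?exprn_ge0.
have marks0 (s1 : state) : cell s1 = (fun=> 0%N) -> marked s1 = set0.
  by move=> cs1; apply/setP=> x; rewrite !inE cs1.
have KltW : (K < W)%N by nia.
have qn : (q <= n)%N by apply: geq_minr.
have tW : (t < W)%N.
  apply: leq_ltn_trans KW; rewrite /t -!mulnA; apply: leq_mul => //.
  by apply: leq_mul; [lia|]; apply: leq_mul; lia.
apply: (setup_spec WE K0 KW eW r0 r1 r3) => s1 cs1 cst1 r18 r19 r20 r21 r33.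
rewrite cs0 in cs1.
apply: (@covering_spec _ KltW n0 _ n 1 _ _ _ _ id (1 - lam ^+ t * (2 * n)%:R)) => //.
- by split=> //; [rewrite cs1; apply: forest_init|move=> x; rewrite cs1].
- rewrite n0 /=; exact: trunc_log_ltn.
- right; split=> //.
    by split; [rewrite leq_addr|move=> x; rewrite marks0 // inE].
  by move=> x; rewrite ltnNge card_nbrs.
move=> s2 c2 v2 fs2 cst2 r33' v2ok.
apply: (@sampling_spec eps lam eps0 lam0 lam1 drift t _ _ _ c2) => //.
- by rewrite r33' r33.
- case: v2ok => [|[v2V Pn]]; [by left|right]; split=> //.
    exact: le_trans v2V V1.
  apply/orP; right; apply: le_trans v2V _; rewrite lerD2l lerN2.
  by rewrite ler_wpM2l ?exprn_ge0 // ler_nat.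
Qed.

End Steps.

(** * Numerical choice of the parameters *)

Lemma failure_count (m l a b : nat) : (m < a)%N -> (l < a)%N -> (1 < b)%N ->
  ((2 * m + l * m) * m <= a * a * (a * b))%N.
Proof.
move=> ma la b1; have h1 : (m * m <= a * a)%N by apply: leq_mul; apply: ltnW.
have h2 : (2 + l <= a * b)%N.
  by apply: leq_trans (leq_mul (leqnn a) b1); lia.
by rewrite -mulnDl -mulnA mulnC leq_mul.
Qed.

Lemma query_program_deterministic : all deterministic query_program.
Proof. by []. Qed.

Definition sparsifier : algorithm :=
  @Algorithm 16 construction_program query_program query_program_deterministic.

Section Sparsifier.
Variables (R : realType) (n : nat) (G : graph n).
Hypothesis n0 : (0 < n)%N.

Local Notation W := (word_bound sparsifier n).
Local Notation bl := (bit_length n).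

Lemma ltn_bit_length : (n < 2 ^ bl)%N.
Proof. exact: trunc_log_ltn. Qed.

(** Of the sixteen factors [2 ^ bl], three exceed [(n + 1) * (n + 1) * bl] and the other thirteen
    exceed [64 * 16 = 1024]. *)
Lemma word_bound_large : (64 * (n + 1) * (n + 1) * (16 * bl) < W)%N.
Proof.
have nb := ltn_bit_length; have bb := ltn_expl bl (isT : 1 < 2)%N.
have -> : (W = 2 ^ bl * 2 ^ bl * 2 ^ bl * (2 ^ (13 * bl)))%N.
  by rewrite -!expnD; congr (2 ^ _)%N; rewrite /=; clear; lia.
have b1 : (0 < bl)%N by [].
have : (2 ^ 13 <= 2 ^ (13 * bl))%N by rewrite leq_exp2l // leq_pmulr.
set a := (2 ^ bl)%N in nb bb *; set b := (2 ^ (13 * bl))%N => ab.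
have h1 : ((n + 1) * (n + 1) <= a * a)%N by apply: leq_mul; lia.
have h2 : ((n + 1) * (n + 1) * bl < a * a * a)%N.
  apply: leq_ltn_trans (leq_mul h1 (leqnn _)) _; rewrite ltn_pmul2l //; nia.
have {}ab : (1024 <= b)%N by apply: leq_trans ab.
have : ((n + 1) * (n + 1) * bl * 1024 < a * a * a * b)%N.
  by apply: leq_trans (leq_mul (leqnn _) ab); rewrite ltn_mul2r h2.
lia.
Qed.

Lemma adjacency_oracle_answer s c q : forest G (cell s) c -> consts n s ->
  (query_time n)%:R <= q :> R ->
  adjacency_oracle sparsifier G s q (answer G (cell s) c).
Proof.
move=> fs [r2 r3 r4 r7 r8] qle; rewrite /adjacency_oracle; cbv zeta => u v; exists (query_time n) => //.
have big := word_bound_large; have un := ltn_ord u; have vn := ltn_ord v.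
have Wbig : (4 * n * n + 8 * n + 8 < W)%N.
  by apply: leq_ltn_trans big; have b1 : (0 < bl)%N by []; nia.
pose F cf := halted cf && ((reg cf.2 0 != 0%N) == answer G (cell s) c u v).
have FH cf : F cf -> halted cf by case/andP.
have uW : (u < W)%N by nia.
have vW : (v < W)%N by nia.
(* The answer is put into [F], which covers all outcomes; the probabilistic half of the judgement is
   trivial. *)
suff [] : @ensures R W n G F (fun=> True) (query_time n)
    (query_program, set_reg W (set_reg W s 0 u) 1 v) 0 by [].
rewrite -[query_program]cats0 -[query_time n]addn0.
rewrite (set_regE _ _ uW) (set_regE _ _ vW).
apply: (@query_spec R W n G F (fun=> True) FH Wbig c u v) => //= s' s'ok.
apply: ensures_halt => //; by rewrite /F /= s'ok eqxx.
Qed.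

(** With [x = 1 / N], multiply by [(1 + x) ^+ N], which is at least 2 by Bernoulli, and use
    [(1 - x) * (1 + x) <= 1]. *)
Lemma expr_half (N : nat) : (0 < N)%N -> (1 - N%:R^-1) ^+ N <= 2^-1 :> R.
Proof.
move=> N0; have NR : 0 < N%:R :> R by rewrite ltr0n.
set x := N%:R^-1; have x0 : 0 < x by rewrite invr_gt0.
have x1 : x <= 1 by rewrite invf_le1 // ler1n.
have bern m : 1 + m%:R * x <= (1 + x) ^+ m.
  elim: m => [|m IH]; first by rewrite mul0r addr0 expr0.
  rewrite exprS; apply: le_trans (ler_wpM2l _ IH); last by lra.
  by rewrite -natr1; have : 0 <= m%:R :> R := ler0n _ _; nra.
have two : 2 <= (1 + x) ^+ N.
  by apply: le_trans (bern N); rewrite mulfV ?gt_eqF.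
rewrite -[2^-1]mul1r ler_pdivlMr //.
apply: le_trans (ler_wpM2l _ two) _; first by rewrite exprn_ge0 // subr_ge0.
rewrite -exprMn; apply: exprn_ile1; last by nra.
by apply: mulr_ge0; lra.
Qed.

Section Budget.
Variable eps : R.
Hypothesis eps01 : 0 < eps < 1.

Let K : nat := (16 * bl)%N.
Let e : nat := Num.truncn (eps * W%:R).
Let q : nat := minn (2 ^ K.-1 %/ (e %/ 2).+1) n.
Let N : nat := (4 * (n * q.+1))%N.

Let eps0 : 0 < eps. Proof. by case/andP: eps01. Qed.
Let eps1 : eps < 1. Proof. by case/andP: eps01. Qed.

Let WE : W = (2 ^ K.-1 * 2)%N.
Proof. by rewrite -expnSr prednK. Qed.

Let e_bounds : e%:R <= eps * W%:R < e.+1%:R.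
Proof. by apply: truncn_itv; rewrite mulr_ge0 // ltW. Qed.

Lemma truncn_eps_lt : (e < W)%N.
Proof.
have /andP[ele _] := e_bounds; rewrite -(ltr_nat R).
by apply: le_lt_trans ele _; rewrite gtr_pMl // ltr0n expn_gt0.
Qed.

Let half_bounds : (e %/ 2)%:R <= eps * (2 ^ K.-1)%:R < (e %/ 2).+1%:R.
Proof.
have /andP[ele elt] := e_bounds; rewrite WE natrM in ele elt.
have e2 := divn_eq e 2; have := ltn_pmod e (isT : 0 < 2)%N => m2.
apply/andP; split.
  have : ((e %/ 2 * 2)%:R <= e%:R :> R) by rewrite ler_nat {2}e2 leq_addr.
  by rewrite natrM; lra.
have : (e.+1%:R <= ((e %/ 2).+1 * 2)%:R :> R) by rewrite ler_nat {1}e2; lia.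
by rewrite natrM; lra.
Qed.

Lemma rounds_upper : q.+1%:R <= 2 / eps.
Proof.
have /andP[_ lt2] := half_bounds.
have q1 : (q * (e %/ 2).+1 <= 2 ^ K.-1)%N.
  apply: (@leq_trans (2 ^ K.-1 %/ (e %/ 2).+1 * (e %/ 2).+1)%N).
    by rewrite leq_mul2r geq_minl orbT.
  exact: leq_trunc_div.
rewrite ler_pdivlMr //.
have : (q * (e %/ 2).+1)%:R <= (2 ^ K.-1)%:R :> R by rewrite ler_nat.
rewrite natrM -[q.+1%:R]natr1; set a := (2 ^ _)%:R in lt2 *; set b := _.+1%:R in lt2 *.
have b0 : 0 < b by rewrite ltr0n.
have q0 : 0 <= q%:R :> R by rewrite ler0n.
move=> qba; suff : q%:R * eps <= 1 by have := eps1; lra.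
rewrite -(ler_pM2r b0) mul1r; apply: le_trans (ltW lt2).
by rewrite mulrAC mulrC ler_wpM2l // ltW.
Qed.

(** This provides [drift]. If [q] is capped at [n], the one crossing edge that a bad partition must
    have is enough; otherwise the rounding still leaves [q.+1] at least [1 / (2 * eps)]. *)
Lemma crossings_lower c : ~~ good G eps c ->
  n%:R / (2 * q.+1%:R) <= (crossings G c)%:R :> R.
Proof.
rewrite /good -ltNge => bad; have n0R : 0 < n%:R :> R by rewrite ltr0n.
have m1 : 1 <= (crossings G c)%:R :> R.
  by rewrite ler1n -(ltr_nat R); apply: le_lt_trans bad; rewrite mulr_ge0 ?ltW.
have q0 : 0 < q.+1%:R :> R by rewrite ltr0n.
rewrite ler_pdivrMr ?mulr_gt0 //.
have [nq|qn] := leqP n (2 ^ K.-1 %/ (e %/ 2).+1).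
  have qE : q = n by apply/minn_idPr.
  have nq1 : n%:R <= q.+1%:R :> R by rewrite qE ler_nat.
  apply: le_trans nq1 _; apply: le_trans (ler_wpM2r _ m1); last by lra.
  by rewrite mul1r; lra.
have qE : q = (2 ^ K.-1 %/ (e %/ 2).+1)%N by apply/minn_idPl/ltnW.
have e2 : (0 < e %/ 2)%N.
  rewrite lt0n; apply/eqP => e20; move: qn; rewrite e20 divn1 ltnNge.
  rewrite (leq_trans (ltnW ltn_bit_length)) // leq_exp2l // /K.
  by have b1 : (0 < bl)%N by []; move: b1; clear; lia.
have /andP[le2 _] := half_bounds.
have ltq : (2 ^ K.-1 < q.+1 * (e %/ 2).+1)%N by rewrite qE ltn_ceil.
have ltq' : ((2 ^ K.-1)%:R < q.+1%:R * (2 * (e %/ 2)%:R) :> R).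
  rewrite -!natrM ltr_nat; apply: leq_trans ltq _; rewrite leq_mul2l /=.
  by move: e2; clear; lia.
suff h : 1 <= eps * (2 * q.+1%:R).
  apply: le_trans (ler_wpM2r _ (ltW bad)); last by lra.
  by rewrite mulrAC ler_peMl // ltW.
have e2R : 0 < (e %/ 2)%:R :> R by rewrite ltr0n.
rewrite -(ler_pM2r e2R) mul1r; apply: le_trans le2 _.
rewrite -!mulrA ler_wpM2l ?ltW // mulrCA; apply: lt_le_trans ltq' _.
by rewrite mulrCA.
Qed.

Lemma construction_time_le :
  (construction_time n K (4 * (n * q.+1 * K)))%:R <= 3000 * 2 * (n%:R / eps) * polylog R 2 n.
Proof.
have b1 : (0 < bl)%N by [].
have : (construction_time n K (4 * (n * q.+1 * K)) <= 3000 * (n * q.+1 * (bl * bl)))%N.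
  rewrite /construction_time /covering_time /visit_time /scan_time /unite_time /K.
  set b := bl in b1 *; nia.
rewrite -(ler_nat R) => /le_trans; apply.
rewrite /polylog !natrM expr2; have := rounds_upper.
set a := q.+1%:R; set b := bl%:R => ale.
rewrite [leRHS](_ : _ = 3000%:R * (n%:R * (2 / eps) * (b * b))); last by ring.
rewrite ler_wpM2l // ler_wpM2r ?mulr_ge0 ?ler0n //.
by rewrite ler_wpM2l ?ler0n.
Qed.

Lemma failure_le (lam : R) : 0 <= lam -> lam ^+ N <= 2^-1 ->
  n%:R^-1 >= lam ^+ (4 * (n * q.+1 * K)) * (2 * n)%:R + (bl * n)%:R * 2 ^- K.
Proof.
move=> lam0 lamN.
have -> : (4 * (n * q.+1 * K) = N * K)%N by rewrite /N; lia.
have lamK : lam ^+ (N * K) <= 2 ^- K.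
  by rewrite exprM -exprVn; apply: lerXn2r; rewrite ?nnegrE ?exprn_ge0 ?invr_ge0.
have n0R : 0 < n%:R :> R by rewrite ltr0n.
apply: le_trans (lerD (ler_wpM2r _ lamK) (lexx _)) _; first by rewrite ler0n.
rewrite [X in _ + X]mulrC -mulrDr -natrD -[leRHS]mul1r ler_pdivlMr //.
rewrite -mulrA -natrM mulrC ler_pdivrMr ?exprn_gt0 // mul1r -natrX ler_nat.
have nb := ltn_bit_length; have bb := ltn_expl bl (isT : 1 < 2)%N.
have -> : (2 ^ K = 2 ^ bl * 2 ^ bl * (2 ^ bl * 2 ^ (13 * bl)))%N.
  by rewrite -!expnD; congr (2 ^ _)%N; rewrite /K; clear; lia.
have b1 : (1 < 2 ^ (13 * bl))%N by rewrite -{1}(expn0 2) ltn_exp2l.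
exact: failure_count.
Qed.

End Budget.
End Sparsifier.

Lemma sparsifier_solves (R : realType) (eps : R) (n : nat) (G : graph n) :
  0 < eps < 1 -> (0 < n)%N ->
  solves_within sparsifier eps G (3000 * 2 * (n%:R / eps) * polylog R 2 n)
    (3000 * 2 * polylog R 2 n) n%:R^-1.
Proof.
move=> eps01 n0; have /andP[eps0 eps1] := eps01.
set W := word_bound sparsifier n; pose K := (16 * bit_length n)%N.
pose e := Num.truncn (eps * W%:R).
pose q := minn (2 ^ K.-1 %/ (e %/ 2).+1) n.
pose N := (4 * (n * q.+1))%N.
have N0 : (0 < N)%N by rewrite /N; nia.
(* With [lam = 1 - 1 / N], [drift] becomes exactly [crossings_lower], and [N * K] samples bring
   [lam] down to [2 ^- K]. *)
have lamN := expr_half R N0; set lam := 1 - _ in lamN.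
have N0R : 0 < N%:R :> R by rewrite ltr0n.
have lam0 : 0 <= lam by rewrite subr_ge0 invf_le1 // ler1n.
have lam1 : lam <= 1 by rewrite gerBl invr_ge0 ler0n.
have W_big := word_bound_large n0; rewrite -/W in W_big.
have W4 : (4 * n * n + 8 * n + 8 < W)%N.
  by apply: leq_ltn_trans W_big; have b1 : (0 < bit_length n)%N by []; nia.
have nW : (n < W)%N by nia.
have eW : (e < W)%N := truncn_eps_lt n eps01.
exists (construction_time n K (4 * (n * q.+1 * K))).
pose E (cf : config) := exists2 H, sparse_spanning_subgraph G eps H &
  adjacency_oracle sparsifier G cf.2 (3000 * 2 * polylog R 2 n) H.
suff [ok1 ok2] : @ensures R W n G halted E
    (construction_time n K (4 * (n * q.+1 * K)))
    (construction sparsifier, initial_state sparsifier n eps) (1 - n%:R^-1).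
  by split=> //; apply: construction_time_le.
apply: (@construction_spec R W n G halted E (fun _ h => h) W4 K e _ _ eps lam) => //=.
- by rewrite !modn_small.
- by rewrite modn_small.
- exact: ltW.
- move=> c /(crossings_lower n0 eps01)/(le_trans _); apply.
  rewrite /lam subKr /N !natrM -/W -/e -/K -/q.
  have n0R : n%:R != 0 :> R by rewrite pnatr_eq0 -lt0n.
  have q0R : q.+1%:R != 0 :> R by rewrite pnatr_eq0.
  rewrite le_eqVlt; apply/orP; left; apply/eqP; field.
  by rewrite nat1r q0R n0R.
- rewrite -addrA -opprD lerD2l lerN2.
  exact: failure_le.
move=> s c v fs cs vok; apply: ensures_halt => //.
case: vok => [v0|[v1 gc]]; first by apply: le_trans v0 _; rewrite ler0n.
rewrite asboolT //; exists (answer G (cell s) c); first exact: answer_spanning.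
apply: adjacency_oracle_answer => //.
rewrite /polylog; apply: (@le_trans _ _ (3000 * 2 * (bit_length n * bit_length n))%:R).
  have : (0 < bit_length n)%N by [].
  rewrite ler_nat /query_time; move: (bit_length n) => b b1; clear -b1.
  by have := leq_pmulr b b1; lia.
by rewrite !natrM expr2.
Qed.

(** * Runs on a tape of random numbers *)

Definition answer_step (W : nat) (l : seq nat) (cf : config) : seq config :=
  let: (k, s) := cf in
  let r := reg s in
  if k is i :: k' then
    let assign x a : config := (k', set_reg W s x a) in
    match i with
    | Const x a => [:: assign x a]
    | Bin o x y z => [:: assign x (eval_binop o (r y) (r z))]
    | Get x y => [:: assign x (cell s (r y))]
    | Put x y => [:: (k', set_cell W s (r x) (r y))]
    | Deg x y => [:: assign x (size l)]
    | Nbr x y z => [:: assign x (nth 0%N l (r z))]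
    | Adj x y z => [:: assign x (r z \in l : nat)]
    | RandNbr x y => [seq assign x a | a <- choices l]
    | Rand x y => [seq assign x a | a <- choices (iota 0 (r y))]
    | If x c1 c2 => [:: ((if r x != 0%N then c1 else c2) ++ k', s)]
    | While x c => [:: (if r x != 0%N then c ++ k else k', s)]
    end
  else [:: cf].

Definition choose (m : nat) (l : seq config) (cf : config) : config :=
  nth cf l (m %% size l).

Section Runs.
Variables (W n : nat).
Implicit Type G : graph n.

Definition asked (cf : config) : option 'I_n :=
  if cf.1 is i :: _ then
    match i with
    | Deg _ y | Nbr _ y _ | Adj _ y _ | RandNbr _ y => insub (reg cf.2 y)
    | _ => None
    end
  else None.

Definition answered G (cf : config) : seq nat :=
  if asked cf is Some u then [seq val w | w <- nbrs G u] else [::].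

(** Even [Adj] is answered from the list of one endpoint, so a step learns at most one neighbor
    list. This subsumes matrix access under list access. *)
Lemma stepE G cf : step W G cf = answer_step W (answered G cf) cf.
Proof.
by case: cf => -[|i k] s //; case: i => //= *; rewrite /answered /asked /= /nbr_words;
  case: insub.
Qed.

Fixpoint run G (w : seq nat) (cf : config) : config :=
  if w is m :: w' then run G w' (choose m (step W G cf) cf) else cf.

Fixpoint trace G (w : seq nat) (cf : config) : seq 'I_n :=
  if w is m :: w' then
    seq_of_opt (asked cf) ++ trace G w' (choose m (step W G cf) cf)
  else [::].

Lemma size_trace G w cf : (size (trace G w cf) <= size w)%N.
Proof.
elim: w cf => //= m w IH cf; rewrite size_cat.
by case: (asked cf) => [u|] /=; [rewrite add1n ltnS|rewrite add0n (leq_trans (IH _))].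
Qed.

(** The indistinguishability principle: inductively both runs ask the same vertices, so agreement
    along the trace in one graph is enough. *)
Lemma run_agree G G' w cf :
  (forall u, u \in trace G w cf -> nbrs G u = nbrs G' u) ->
  run G' w cf = run G w cf /\ trace G' w cf = trace G w cf.
Proof.
elim: w cf => //= m w IH cf agree.
have stE : step W G' cf = step W G cf.
  rewrite !stepE; congr answer_step; rewrite /answered.
  by case: (asked cf) agree => //= u agree; rewrite agree ?inE ?eqxx.
rewrite stE; have [|-> ->//] := IH (choose m (step W G cf) cf).
by move=> u uw; apply: agree; rewrite mem_cat uw orbT.
Qed.

Lemma run_outcomes (F : pred config) G t w cf : (forall d, F d -> halted d) ->
  all F (outcomes W G t cf) -> (t <= size w)%N -> F (run G w cf).
Proof.
move=> FH; have run_halt d w' : F d -> F (run G w' d).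
  move=> Fd; elim: w' => //= m w' IH; rewrite step_halted ?FH //=.
  by rewrite /choose modn1.
elim: t w cf => [|t IH] w cf; first by rewrite /= andbT => /run_halt.
case: w => // m w; rewrite ltnS /= => allF tw; apply: IH tw.
rewrite /choose; set l := step W G cf in allF *.
have : (m %% size l < size l)%N by rewrite ltn_mod size_step.
elim: (l) (m %% _)%N allF => //= d l' IHl [|i] /=; rewrite all_cat => /andP[Fd Fl] //.
by rewrite ltnS; apply: IHl.
Qed.

(* If every branching divides N, reducing a uniform number below N modulo the
   branching is a uniform choice, so that tapes make the runs deterministic. *)
Fixpoint tapes (N t : nat) : seq (seq nat) :=
  if t is t'.+1 then [seq m :: w | m <- iota 0 N, w <- tapes N t'] else [:: [::]].

Lemma size_tapes N t : size (tapes N t) = (N ^ t)%N.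
Proof. by elim: t => //= t IH; rewrite size_allpairs size_iota IH expnS. Qed.

Lemma size_tape N t w : w \in tapes N t -> size w = t.
Proof.
by elim: t w => [|t IH] w /=; [rewrite inE => /eqP->|case/allpairsP=> -[m w'] /= [_ /IH <- ->]].
Qed.

Lemma sum_modn (R : nmodType) (F : nat -> R) q L :
  \sum_(m <- iota 0 (q * L)) F (m %% L)%N = (\sum_(m <- iota 0 L) F m) *+ q.
Proof.
have -> : iota 0 (q * L) = index_iota 0 (q * L) by rewrite /index_iota subn0.
have -> : iota 0 L = index_iota 0 L by rewrite /index_iota subn0.
elim: q => [|q IH]; first by rewrite mul0n big_geq.
rewrite mulSn addnC (@big_cat_nat _ _ _ (q * L)%N) ?leq_addr //= IH mulrSr; congr (_ + _).
rewrite -{1}[(q * L)%N]add0n [(q * L + L)%N]addnC big_addn addnK big_seq [RHS]big_seq.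
apply: eq_bigr => m; rewrite mem_index_iota /= => mL.
by rewrite addnC modnMDl modn_small.
Qed.

Definition words_below (cf : config) : Prop := forall x, (reg cf.2 x < W)%N.

Lemma words_below_choose G m cf : (0 < W)%N -> words_below cf ->
  words_below (choose m (step W G cf) cf).
Proof.
move=> W0; case: cf => k s sW.
have setW x a k' : words_below (k', set_reg W s x a).
  by move=> y /=; case: eqP => _; rewrite ?ltn_pmod //; apply: sW.
have mapW x k' l j : words_below (nth (k, s) [seq (k', set_reg W s x a) | a <- l] j).
  by elim: l j => [|a l IH] [|j] //=; apply: setW.
rewrite /choose; case: k sW setW mapW => [|i k] sW setW mapW; first by rewrite modn1.
case: i sW setW mapW => [x a|o x y z|x y|x y|x y|x y z|x y z|x y|x y|x c1 c2|x c] sW setW mapW;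
  by rewrite /= ?modn1 /=; first [exact: setW|exact: mapW|exact: sW].
Qed.

Lemma size_step_le G cf : words_below cf -> (size (step W G cf) <= W + n)%N.
Proof.
case: cf => k s sW; have W0 : (0 < W)%N by apply: leq_ltn_trans (sW 0%N).
have W1 : (1 <= W + n)%N by rewrite addn_gt0 W0.
have {}sW : forall x, (reg s x < W)%N by apply: sW.
case: k => //= i k; case: i => //= x y; rewrite size_map.
  rewrite /nbr_words; case: insubP => // u _ _; case E : [seq _ | _ <- _] => //.
  rewrite /choices -E size_map; apply: leq_trans (leq_addl _ _).
  by rewrite -(card_uniqP (nbrs_uniq G u)) -[leqRHS](card_ord n) max_card.
have := sW y; case: (reg s y) => // r rW.
by rewrite /choices /= size_iota; apply: leq_trans (ltnW rW) (leq_addr _ _).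
Qed.

(** Branchings are at most [W + n]: [Rand] draws below a register, which is a word, and [RandNbr]
    among at most [n] neighbors. Hence all of them divide the factorial. *)
Lemma prob_tapes (R : realType) G t cf E : words_below cf ->
  prob R W G t cf E =
  (\sum_(w <- tapes (W + n)`! t) `[< E (run G w cf) >]%:R) / ((W + n)`! ^ t)%:R.
Proof.
elim: t cf => [|t IH] cf cfW; first by rewrite /= big_seq1 divr1.
have W0 : (0 < W)%N by apply: leq_ltn_trans (cfW 0%N).
set N := (W + n)`!; have N0 : (N%:R != 0 :> R) by rewrite pnatr_eq0 -lt0n fact_gt0.
have := size_step_le G cfW; have := size_step W G cf.
rewrite [LHS]/= [in RHS]/=; set l := step W G cf => l0 lW.
have /dvdnP[q Nq] : (size l %| N)%N by apply: dvdn_fact; rewrite l0.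
have q0 : q%:R != 0 :> R by apply: contra N0; rewrite Nq natrM => /eqP->; rewrite mul0r.
rewrite big_allpairs_dep /=.
pose f (d : config) : R := \sum_(w <- tapes N t) `[< E (run G w d) >]%:R.
rewrite (eq_bigr (fun m => f (nth cf l (m %% size l)))) //.
rewrite [in iota 0 N]Nq (sum_modn (fun m => f (nth cf l m))).
have -> : \sum_(m <- iota 0 (size l)) f (nth cf l m) = \sum_(d <- l) f d.
  by rewrite [RHS](big_nth cf) /index_iota subn0.
have -> : \sum_(d <- l) prob R W G t d E = (\sum_(d <- l) f d) / (N ^ t)%:R.
  rewrite mulr_suml !(big_nth cf) !big_seq; apply: eq_bigr => m.
  rewrite mem_index_iota /= => ml; rewrite IH //.
  by have := @words_below_choose G m cf W0 cfW; rewrite /choose modn_small.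
rewrite -[_ *+ q]mulr_natr expnS natrM [in N%:R]Nq natrM.
have lR : (size l)%:R != 0 :> R by rewrite pnatr_eq0 -lt0n.
have Nt : (N ^ t)%:R != 0 :> R by rewrite pnatr_eq0 -lt0n expn_gt0 fact_gt0.
by field; rewrite q0 lR Nt.
Qed.

End Runs.

(** * Double covers of random lifts *)

Section Lift.
Local Open Scope nat_scope.
Variables (D h : nat).

(* Side, fibre and position of a vertex of the h-fold lift of K_{D,D} given by
   al : matchings. *)
Notation base := (bool * 'I_D * 'I_h)%type.

Notation matchings := {ffun ('I_D * 'I_D)%type -> {perm 'I_h}}.

Definition nbr (al : matchings) (v : base) (k : 'I_D) : base :=
  (~~ v.1.1, k, if v.1.1 then (al (k, v.1.2))^-1%g v.2 else al (v.1.2, k) v.2).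

Lemma nbrK al v k : nbr al (nbr al v k) v.1.2 = v.
Proof.
by case: v => [[[] i] x]; rewrite /nbr /= ?permKV ?permK.
Qed.

Definition badj (al : matchings) (v w : base) : bool := nbr al v w.1.2 == w.

Lemma badj_nbr al v k : badj al v (nbr al v k).
Proof. by rewrite /badj /= eqxx. Qed.

Lemma badj_sym al : symmetric (badj al).
Proof.
suff half v w : badj al v w -> badj al w v.
  by move=> v w; apply/idP/idP; apply: half.
by move=> /eqP <-; rewrite /badj nbrK.
Qed.

Lemma badjP al v w : reflect (exists k, w = nbr al v k) (badj al v w).
Proof.
apply: (iffP idP) => [/eqP<-|[k ->]]; last exact: badj_nbr.
by exists w.1.2.
Qed.

Lemma badj_side al v w : badj al v w -> w.1.1 = ~~ v.1.1.
Proof. by move=> /eqP <-. Qed.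

Implicit Types (al : matchings) (c : {ffun base -> bool}) (o : option (base * base)).

Definition special o (v w : base) : bool := (o == Some (v, w)) || (o == Some (w, v)).

(* The double cover is trivial up to the gauge c, except that the edge o, if
   there is one, has the opposite sign. *)
Definition sign c o (v w : base) : bool := c v (+) c w (+) special o v w.

Lemma sign_sym c o v w : sign c o v w = sign c o w v.
Proof. by rewrite /sign /special [c v (+) _]addbC orbC. Qed.

Notation cover := (base * bool)%type.
Notation edge := ('I_D * 'I_h * 'I_D)%type.
Implicit Type e : edge.
Notation size_cover := #|{: cover}|.

(** Vertex numbers reveal side, fibre, position and sheet, and list positions reveal ports; only
    [al], [c] and [o] are hidden from an algorithm. *)
Definition lift_nbr al c o (p : cover) (k : 'I_D) : cover :=
  (nbr al p.1 k, p.2 (+) sign c o p.1 (nbr al p.1 k)).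

Definition lift_adj al c o : rel 'I_size_cover := fun u w =>
  let p := enum_val u in let q := enum_val w in
  badj al p.1 q.1 && (q.2 == p.2 (+) sign c o p.1 q.1).

Definition lift_nbrs al c o (u : 'I_size_cover) : seq 'I_size_cover :=
  [seq enum_rank (lift_nbr al c o (enum_val u) k) | k <- enum 'I_D].

Lemma lift_sym al c o : symmetric (lift_adj al c o).
Proof.
move=> u w; rewrite /lift_adj badj_sym sign_sym; congr andb.
set s := sign _ _ _ _.
by case: (enum_val u).2; case: (enum_val w).2; case: s.
Qed.

Lemma lift_irr al c o : irreflexive (lift_adj al c o).
Proof.
move=> u; apply/negP => /andP[/badj_side]; by case: (enum_val u).1.1.1.
Qed.

Lemma lift_uniq al c o u : uniq (lift_nbrs al c o u).
Proof.
rewrite map_inj_uniq ?enum_uniq // => k l /enum_rank_inj[] kl _.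
by [].
Qed.

Lemma mem_lift_nbrs al c o u w : (w \in lift_nbrs al c o u) = lift_adj al c o u w.
Proof.
rewrite /lift_adj; apply/mapP/andP => [[k _ ->]|[/eqP uw /eqP sw]].
  by rewrite enum_rankK /= badj_nbr eqxx.
exists (enum_val w).1.1.2; rewrite ?mem_enum //.
apply: enum_val_inj; rewrite enum_rankK /lift_nbr uw -sw.
by case: (enum_val w).
Qed.

Definition lift al c o : graph size_cover :=
  Graph (lift_sym al c o) (lift_irr al c o) (lift_uniq al c o)
        (mem_lift_nbrs al c o).

Lemma card_cover : size_cover = (4 * D * h)%N.
Proof. by rewrite !card_prod !card_bool !card_ord; lia. Qed.

Lemma lift_adjE al c o (v w : base) (b d : bool) :
  adj (lift al c o) (enum_rank (v, b)) (enum_rank (w, d)) =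
  badj al v w && (d == b (+) sign c o v w).
Proof. by rewrite /= /lift_adj !enum_rankK. Qed.

(** * Cuts of the explored region *)

Implicit Types (P : seq base) (K : {set base}) (v w : base).

Definition nearby al (P : seq base) (w : base) : bool :=
  has (fun p => badj al p w) P.

(** The event that asking about [v] may close a cycle: an unexplored neighbor of [v] is already
    attached to the explored part. *)
Definition collision al (P : seq base) (v : base) : bool :=
  [exists k, (nbr al v k \notin P) && nearby al P (nbr al v k)].

Fixpoint clean al (P L : seq base) : bool :=
  if L is v :: L' then
    ((v \in P) || ~~ collision al P v) && clean al (v :: P) L'
  else true.

(* Of the base edges with an end in P, only XY leaves K. *)
Definition separates al (X Y : base) (P : seq base) (K : {set base}) : bool :=
  [&& X \in K, Y \notin K & [forall p, (p \in P) ==> [forall k,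
    special (Some (X, Y)) p (nbr al p k) || ((p \in K) == (nbr al p k \in K))]]].

Lemma separatesP al X Y P K :
  reflect [/\ X \in K, Y \notin K & forall p w, p \in P -> badj al p w ->
             ~~ special (Some (X, Y)) p w -> (p \in K) = (w \in K)]
          (separates al X Y P K).
Proof.
apply: (iffP and3P) => -[XK YK cl]; split=> //.
  move=> p w pP /badjP[k ->] /negPf sp.
  by have /forallP/(_ p)/implyP/(_ pP)/forallP/(_ k) := cl; rewrite sp => /eqP.
apply/forallP=> p; apply/implyP=> pP; apply/forallP=> k.
have [//|sp] := boolP (special _ _ _); apply/eqP/cl => //; exact: badj_nbr.
Qed.

Lemma collisionPn al P v w : ~~ collision al P v -> badj al v w -> w \notin P ->
  ~~ nearby al P w.
Proof.
move=> /existsPn col /badjP[k ->] wP; have := col k; by rewrite wP.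
Qed.

(** [K] grows with the exploration: if [v] is in [K], its unexplored neighbors join. Without a
    collision these touch no vertex explored earlier, so no edge already controlled changes its
    status. As [K] stays within the explored vertices and their neighbors, the fresh neighbors of a
    [v] outside [K] are outside too. *)
Lemma clean_separated al X Y P L K :
  X \in P -> badj al X Y -> separates al X Y P K ->
  (forall w, w \in K -> (w \in P) || nearby al P w) -> clean al P L ->
  exists K', separates al X Y (catrev L P) K'.
Proof.
move=> XP XY; elim: L P K XP => [|v L IH] P K XP sep Kn /=; first by exists K.
have /separatesP[XK YK cl] := sep.
case/andP; have [vP _|vP /= ncol] := boolP (v \in P).
  have memv w : (w \in v :: P) = (w \in P) by rewrite inE; case: eqP => // ->.
  apply: (IH _ K); rewrite ?memv //.
    by apply/separatesP; split=> // p w; rewrite memv; apply: cl.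
  by move=> w /Kn; rewrite memv /nearby /=; case: (w \in P); case: (badj al v w).
pose K' := if v \in K then K :|: [set w | badj al v w & w \notin P] else K.
have K'E w : (w \in K') = (w \in K) || [&& v \in K, badj al v w & w \notin P].
  by rewrite /K'; case: ifP; rewrite ?orbF // !inE.
have memK' w : w \in P -> (w \in K') = (w \in K).
  by move=> wP; rewrite K'E wP !andbF orbF.
have farK' p w : p \in P -> badj al p w -> (w \in K') = (w \in K).
  move=> pP pw; rewrite K'E; case: (boolP (w \in P)) => wP; rewrite ?andbF ?orbF //.
  rewrite andbT; case: (boolP (badj al v w)) => [vw|]; rewrite ?andbF ?orbF //.
  by have /hasPn/(_ p pP) := collisionPn ncol vw wP; rewrite pw.
apply: (IH _ K').
- by rewrite inE XP orbT.
- apply/separatesP; split.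
  + by rewrite memK'.
  + by rewrite (farK' X).
  move=> p w; rewrite inE; case: (boolP (p \in P)) => [pP _ pw sp|pP].
    by rewrite (memK' p pP) (farK' p w pP pw); apply: cl.
  rewrite orbF => /eqP-> vw sp.
  have vK' : (v \in K') = (v \in K).
    by rewrite K'E; case: badjP => [[k vv]|_]; rewrite ?andbF ?orbF //;
      have := congr1 (fun z => z.1.1) vv => /=; case: v.1.1.
  rewrite vK'; case: (boolP (w \in P)) => [wP|wP].
    rewrite memK' //; apply/esym/cl => //; first by rewrite badj_sym.
    by rewrite /special orbC.
  rewrite K'E vw wP /=; case: (boolP (v \in K)) => vK; rewrite ?orbT // orbF.
  apply/esym/negP => /Kn; rewrite (negPf wP) /=; apply/negP.
  exact: collisionPn ncol vw wP.
- move=> w; rewrite K'E => /orP[/Kn|/and3P[_ vw _]].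
    by rewrite inE /nearby /=; case: (w \in P); case: (has _ P); rewrite ?orbT.
  by rewrite /nearby /= vw orbT.
Qed.

(** Nothing in [P], whatever cycles it contains, touches the star of [X]; so the cut can start as
    this star without [Y]. *)
Lemma fresh_separates al X Y P : badj al X Y -> X \notin P -> ~~ nearby al P X ->
  ~~ collision al P X ->
  separates al X Y (X :: P) (X |: [set w | badj al X w & w != Y]).
Proof.
move=> XY XP nX ncol; set K := _ |: _.
have farX p : p \in P -> badj al p X = false.
  by move=> pP; apply/negbTE; have /hasPn/(_ p pP) := nX.
have XX : badj al X X = false.
  by apply/badjP => -[k XX]; have := congr1 (fun z => z.1.1) XX => /=; case: X.1.1.
have YX : Y != X by apply/eqP => YX; rewrite YX XX in XY.
apply/separatesP; split; rewrite ?inE ?eqxx //= ?negb_or ?YX ?andbF //.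
move=> p w; rewrite inE => /orP[/eqP->|pP] pw sp.
  rewrite !inE eqxx pw /=; have [wY|] := eqVneq w Y; last by rewrite orbT.
  by rewrite wY /special eqxx in sp.
rewrite !inE [badj al X p]badj_sym farX // /= orbF.
have -> : (w == X) = false by apply/eqP => wX; rewrite wX farX in pw.
have -> : (p == X) = false by apply/eqP => pX; rewrite pX (negPf XP) in pP.
case: (boolP (badj al X w)) => //= Xw; apply/esym/negbTE/negP => _.
have wP : w \notin P by apply/negP => wP; rewrite badj_sym farX in Xw.
by have /hasPn/(_ p pP) := collisionPn ncol Xw wP; rewrite pw.
Qed.

Definition flip c (K : {set base}) : {ffun base -> bool} :=
  [ffun v => c v (+) (v \in K)].

Lemma flipK c K : flip (flip c K) K = c.
Proof. by apply/ffunP=> v; rewrite !ffunE addbK. Qed.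

(** The flip reverses the signs of the edges leaving [K]. At explored vertices only [XY] leaves, and
    there [special] reverses the sign back. *)
Lemma sign_flip al X Y P K c p w : separates al X Y P K -> p \in P -> badj al p w ->
  sign (flip c K) (Some (X, Y)) p w = sign c None p w.
Proof.
move=> /separatesP[XK YK cl] pP pw; rewrite /sign !ffunE.
have -> : special None p w = false by [].
have [sp|sp] := boolP (special _ p w).
  suff : (p \in K) (+) (w \in K) by case: (c p); case: (c w); case: (p \in K); case: (w \in K).
  by case/orP: sp => /eqP[<- <-]; rewrite XK (negPf YK).
rewrite (cl p w) //; by case: (c p); case: (c w); case: (w \in K).
Qed.

Lemma nbrs_flip al X Y P K c u : separates al X Y P K -> (enum_val u).1 \in P ->
  nbrs (lift al (flip c K) (Some (X, Y))) u = nbrs (lift al c None) u.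
Proof.
move=> sep uP /=; rewrite /lift_nbrs; apply: eq_map => k.
by rewrite /lift_nbr (sign_flip _ sep) // badj_nbr.
Qed.

(** * Random matchings conditioned on answers *)

Definition answers al v : {ffun 'I_D -> base} := [ffun k => nbr al v k].

Definition consistent al P : {set matchings} :=
  [set al' | all (fun p => answers al' p == answers al p) P].

Lemma answersP al al' p : reflect (nbr al p =1 nbr al' p) (answers al p == answers al' p).
Proof.
apply: (iffP eqP) => [/ffunP eq_a k|eq_n]; first by have := eq_a k; rewrite !ffunE.
by apply/ffunP=> k; rewrite !ffunE.
Qed.

Lemma consistentP al al' P :
  reflect (forall p, p \in P -> nbr al' p =1 nbr al p) (al' \in consistent al P).
Proof.
rewrite inE; apply: (iffP allP) => [eqP p /eqP /answersP //|eqP p pP].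
exact/answersP/eqP.
Qed.

Lemma consistent_nearby al al' P : al' \in consistent al P ->
  nearby al' P =1 nearby al P.
Proof.
move=> /consistentP cons w; apply: eq_in_has => p pP.
by rewrite /badj cons.
Qed.

(* Switching the partners of a and b, in the matching seen from fibre (s, i)
   through port k. *)
Definition switch (s : bool) (i k : 'I_D) (a b : 'I_h) al : matchings :=
  [ffun q => if s then (if q == (k, i) then (tperm a b * al q)%g else al q)
             else (if q == (i, k) then (al q * tperm a b)%g else al q)].

Lemma switchK s i k a b : involutive (switch s i k a b).
Proof.
move=> al; apply/ffunP=> q; rewrite !ffunE; case: s; case: eqP => // _.
  by rewrite mulgA tperm2 mul1g.
by rewrite -mulgA tperm2 mulg1.
Qed.

Lemma nbr_switch s i k a b al u l :
  nbr (switch s i k a b al) u l =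
    if (u.1 == (s, i)) && (l == k) then (~~ s, k, tperm a b (nbr al u l).2)
    else if (u.1 == (~~ s, k)) && (l == i) then nbr al (u.1, tperm a b u.2) l
    else nbr al u l.
Proof.
case: u => [[t j] x]; rewrite /nbr /= !ffunE !xpair_eqE.
case: s; case: t => //=.
- case: (eqVneq j i) => [->|ji] /=; rewrite ?andbT ?andbF //.
  by case: (eqVneq l k) => [->|lk] //=; rewrite invMg permM tpermV.
- case: (eqVneq l i) => [->|li] /=; rewrite ?andbT ?andbF //.
  by case: (eqVneq j k) => [->|jk] //=; rewrite permM.
- case: (eqVneq l i) => [->|li] /=; rewrite ?andbT ?andbF //.
  by case: (eqVneq j k) => [->|jk] //=; rewrite invMg permM tpermV.
- case: (eqVneq j i) => [->|ji] /=; rewrite ?andbT ?andbF //.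
  by case: (eqVneq l k) => [->|lk] //=; rewrite permM.
Qed.

(** Any given partner is unlikely: exchange the partner [a] with a position [b] such that neither
    [b] nor its own partner is explored. This preserves all answers on [P], at most [2 * size P]
    positions are excluded, and the pair is recovered from the result, in which [b] is the new
    partner. *)
Lemma card_switch al0 P s i x k a :
  (s, i, x) \notin P -> (~~ s, k, a) \notin P ->
  (#|[set al in consistent al0 P | nbr al (s, i, x) k == (~~ s, k, a)]| *
     (h - 2 * size P) <= #|consistent al0 P|)%N.
Proof.
move=> vP wP; set B := [set al in _ | _].
pose Z al := [set b | ((~~ s, k, b) \notin P) && (nbr al (~~ s, k, b) i \notin P)].
have cardZ al : (h - 2 * size P <= #|Z al|)%N.
  have bound (f : 'I_h -> base) : injective f ->
      (#|[set b | f b \in P]| <= size P)%N.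
    move=> f_inj; rewrite -(card_imset _ f_inj).
    apply: leq_trans (card_size P); apply/subset_leq_card/subsetP=> p.
    by case/imsetP=> b; rewrite inE => bP ->.
  have inj1 : injective (fun b : 'I_h => (~~ s, k, b)) by move=> b d [].
  have inj2 : injective (fun b : 'I_h => nbr al (~~ s, k, b) i).
    move=> b d eq_n; have := nbrK al (~~ s, k, b) i; rewrite eq_n.
    by rewrite (nbrK al (~~ s, k, d) i) => -[].
  have compl : (#|~: Z al| <= size P + size P)%N.
    rewrite (_ : ~: Z al = [set b | (~~ s, k, b) \in P] :|:
      [set b | nbr al (~~ s, k, b) i \in P]).
      exact: leq_trans (leq_card_setU _ _) (leq_add (bound _ inj1) (bound _ inj2)).
    by apply/setP=> b; rewrite !inE negb_and !negbK.
  by have := cardsC (Z al); rewrite card_ord; move: compl; lia.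
pose pairs := [set q : matchings * 'I_h | (q.1 \in B) && (q.2 \in Z q.1)].
have -> : (#|B| * (h - 2 * size P) = \sum_(al in B) (h - 2 * size P))%N.
  by rewrite sum_nat_const.
apply: (@leq_trans (\sum_(al in B) #|Z al|)); first by apply: leq_sum => al _.
have -> : (\sum_(al in B) #|Z al| = #|pairs|)%N.
  rewrite -sum1_card (eq_bigl (fun q => (q.1 \in B) && (q.2 \in Z q.1))).
    rewrite -(pair_big_dep (mem B) (fun al b => b \in Z al) (fun _ _ => 1%N)) /=.
    by apply: eq_bigr => al _; rewrite sum1_card.
  by move=> q; rewrite inE.
pose sw (q : matchings * 'I_h) := switch s i k a q.2 q.1.
have at_v q : q \in pairs -> nbr (sw q) (s, i, x) k = (~~ s, k, q.2).
  rewrite inE => /andP[]; rewrite [q.1 \in B]inE => /andP[_ /eqP qv] _.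
  by rewrite nbr_switch qv tpermL /= !eqxx.
have sw_inj : {in pairs &, injective sw}.
  move=> q q' qp q'p eq_sw; have := at_v q qp; rewrite eq_sw (at_v q' q'p) => -[q2].
  have q1 : q.1 = q'.1.
    by have := eq_sw; rewrite /sw q2 => /(congr1 (switch s i k a q.2)); rewrite !switchK.
  by rewrite [q]surjective_pairing [q']surjective_pairing q1 q2.
rewrite -(card_in_imset sw_inj); apply/subset_leq_card/subsetP=> _ /imsetP[q qp ->].
move: qp; rewrite inE [q.1 \in B]inE [q.2 \in _]inE.
move=> /andP[/andP[/consistentP cons /eqP qv] /andP[zP zP']].
apply/consistentP=> p pP l; rewrite -cons // nbr_switch.
case: ifP => [/andP[/eqP p1 /eqP lk]|_].
  have pE : p = (s, i, p.2) by rewrite -p1; case: (p).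
  have nE : nbr q.1 p l = (~~ s, k, (nbr q.1 p l).2) by rewrite lk /nbr p1.
  rewrite [RHS]nE; congr (_, _, _); rewrite tpermD //.
    apply/eqP => an; rewrite -an -qv lk in nE.
    have := nbrK q.1 p k; rewrite nE [p.1.2](congr1 snd p1).
    rewrite -[i]/((s, i, x).1.2) nbrK => pv.
    by move: pP; rewrite -pv /=; apply/negP.
  apply/eqP => zn; move: zP'; rewrite zn -nE lk.
  by have -> : i = p.1.2; [rewrite p1|rewrite nbrK pP].
case: ifP => // /andP[/eqP p1 _]; congr nbr.
have pE : p = (~~ s, k, p.2) by rewrite -p1; case: (p).
rewrite [RHS]pE p1; congr (_, _, _); rewrite tpermD //; apply/eqP => ap.
  by rewrite ap -pE pP in wP.
by rewrite ap -pE pP in zP.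
Qed.

(** An explored vertex has one neighbor through each port, so every port of [v] has at most [size P]
    dangerous partners, each bounded by [card_switch]. *)
Lemma card_collision al0 P v : v \notin P ->
  (#|[set al in consistent al0 P | collision al P v]| * (h - 2 * size P) <=
   D * size P * #|consistent al0 P|)%N.
Proof.
move=> vP; case: v vP => [[s i] x] vP; set v := (s, i, x).
pose W k := [set a | ((~~ s, k, a) \notin P) && nearby al0 P (~~ s, k, a)].
have cardW k : (#|W k| <= size P)%N.
  rewrite -(size_map (fun p => (nbr al0 p k).2) P).
  apply: leq_trans (card_size _); apply/subset_leq_card/subsetP=> a.
  rewrite inE => /andP[_ /hasP[p pP /eqP pa]]; apply/mapP; exists p => //.
  by rewrite /= in pa; rewrite pa.
pose B k a := [set al in consistent al0 P | nbr al v k == (~~ s, k, a)].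
have cover : (#|[set al in consistent al0 P | collision al P v]| <=
    \sum_k \sum_(a in W k) #|B k a|)%N.
  have cardE (Q : pred matchings) : #|[set al in consistent al0 P | Q al]| =
      (\sum_(al in consistent al0 P) Q al)%N.
    rewrite -sum1_card (eq_bigl (fun al => (al \in consistent al0 P) && Q al)).
      by rewrite big_mkcondr /=; apply: eq_bigr => al _; case: (Q al).
    by move=> al; rewrite inE.
  under eq_bigr do under eq_bigr do rewrite cardE.
  under eq_bigr do rewrite exchange_big /=.
  rewrite exchange_big /= cardE; apply: leq_sum => al cons.
  case: (boolP (collision al P v)) => //= /existsP[k /andP[nP near]].
  rewrite (bigD1 k) //= (bigD1 (nbr al v k).2) /=; last first.
    by rewrite inE -(consistent_nearby cons); apply/andP.
  by rewrite eqxx.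
have BW k a : a \in W k -> (#|B k a| * (h - 2 * size P) <= #|consistent al0 P|)%N.
  by rewrite inE => /andP[aP _]; apply: card_switch.
apply: leq_trans (leq_mul cover (leqnn _)) _.
rewrite big_distrl /= -mulnA.
have -> (m : nat) : (D * m = \sum_(k < D) m)%N by rewrite sum_nat_const card_ord.
apply: leq_sum => k _; rewrite big_distrl /=.
apply: (@leq_trans (\sum_(a in W k) #|consistent al0 P|)).
  by apply: leq_sum => a /BW.
by rewrite sum_nat_const leq_mul2r cardW orbT.
Qed.

(* A decision tree over the matchings, asking for all neighbors of a vertex at
   once; only the collisions at the marked questions are recorded. *)
Inductive strategy :=
| Stop
| Ask (mark : bool) (v : base) (k : {ffun 'I_D -> base} -> strategy).

Fixpoint bounded (f d : nat) (s : strategy) : Prop :=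
  if s is Ask b v k then
    [/\ (0 < d)%N, (b <= f)%N & forall a, bounded (f - b) d.-1 (k a)]
  else True.

Fixpoint unclean al P (s : strategy) : bool :=
  if s is Ask b v k then
    [&& b, v \notin P & collision al P v] ||
    unclean al (v :: P) (k (answers al v))
  else false.

Lemma consistent_cons al v P :
  consistent al (v :: P) = [set al' in consistent al P | answers al' v == answers al v].
Proof. by apply/setP=> al'; rewrite !inE /= andbC. Qed.

Lemma consistent_eq al al' P : al' \in consistent al P ->
  consistent al' P = consistent al P.
Proof.
rewrite inE => /allP cons; apply/setP=> al''; rewrite !inE; apply: eq_in_all => p pP.
by rewrite (eqP (cons p pP)).
Qed.

(** A union bound along the tree, with matchings uniform on [consistent al0 P] given the answers so
    far. Unmarked questions cost nothing by themselves; they enter only through [M]. So a long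
    construction is affordable. *)
Lemma card_unclean M s al0 P f d : bounded f d s -> (size P + d <= M)%N ->
  (#|[set al in consistent al0 P | unclean al P s]| * (h - 2 * M) <=
   f * (D * M) * #|consistent al0 P|)%N.
Proof.
elim: s al0 P f d => [|b v k IH] al0 P f d /=.
  move=> _ _; rewrite (_ : [set al in _ | false] = set0) ?cards0 ?mul0n //.
  by apply/setP=> al; rewrite !inE andbF.
move=> [d0 bf bk] Pd; have Pd' : (size (v :: P) + d.-1 <= M)%N by rewrite /=; lia.
set C := consistent al0 P.
pose coll := [set al in C | [&& b, v \notin P & collision al P v]].
pose next := [set al in C | unclean al (v :: P) (k (answers al v))].
have collM : (#|coll| * (h - 2 * M) <= b * (D * M) * #|C|)%N.
  rewrite /coll; case: b {bf bk coll} => /=; last first.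
    by rewrite (_ : [set al in C | false] = set0) ?cards0 //; apply/setP=> al; rewrite !inE andbF.
  case: (boolP (v \in P)) => vP /=.
    by rewrite (_ : [set al in C | false] = set0) ?cards0 //; apply/setP=> al; rewrite !inE andbF.
  have leM : (h - 2 * M <= h - 2 * size P)%N by lia.
  apply: leq_trans (leq_mul (leqnn _) leM) _.
  apply: leq_trans (card_collision al0 vP) _.
  by rewrite mul1n leq_mul // leq_mul //; lia.
have nextM : (#|next| * (h - 2 * M) <= (f - b) * (D * M) * #|C|)%N.
  (* Splitting by the answer at [v] gives sets that are again of the form [consistent], to which the
     induction applies. *)
  have partC (S : {set matchings}) :
      (#|S| = \sum_(a : {ffun 'I_D -> base}) #|[set al in S | answers al v == a]|)%N.
    rewrite -sum1_card (partition_big (fun al => answers al v) predT) //=.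
    by apply: eq_bigr => a _; rewrite -sum1_card; apply: eq_bigl => al; rewrite inE.
  rewrite (partC next) (partC C) big_distrl big_distrr /=; apply: leq_sum => a _.
  set Na := [set al in next | _]; set Ca := [set al in C | _].
  have NC : Na \subset Ca.
    by apply/subsetP=> al /setIdP[/setIdP[alC _] alv]; apply/setIdP.
  have [Ca0|/set0Pn[al1 al1C]] := eqVneq Ca set0.
    by move: NC; rewrite Ca0 subset0 => /eqP ->; rewrite cards0.
  have [al1c /eqP al1v] : al1 \in C /\ answers al1 v == a.
    by case/setIdP: al1C.
  have CaE : Ca = consistent al1 (v :: P).
    rewrite consistent_cons (consistent_eq al1c) al1v.
    by apply/setP=> al; rewrite !inE.
  have NaE : Na \subset [set al in consistent al1 (v :: P) | unclean al (v :: P) (k a)].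
    apply/subsetP=> al alN; have := subsetP NC _ alN; rewrite CaE => alCa.
    by have /setIdP[/setIdP[_ un] /eqP av] := alN; apply/setIdP; rewrite -av.
  rewrite CaE; apply: leq_trans (IH a al1 (v :: P) _ _ (bk a) Pd').
  by rewrite leq_mul2r subset_leq_card ?orbT.
apply: (@leq_trans ((#|coll| + #|next|) * (h - 2 * M))).
  rewrite leq_mul2r; apply/orP; right.
  apply: leq_trans (leq_card_setU _ _); apply/subset_leq_card/subsetP=> al.
  by move=> /setIdP[alC /orP[h1|h1]]; rewrite inE; apply/orP; [left|right]; apply/setIdP.
rewrite mulnDl; apply: leq_trans (leq_add collM nextM) _.
by rewrite -!mulnDl subnKC.
Qed.

Lemma bounded_le s f d f' d' : bounded f d s -> f <= f' -> d <= d' -> bounded f' d' s.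
Proof.
elim: s f d f' d' => //= b v k IH f d f' d' [d0 bf bk] ff' dd'; split; try lia.
by move=> a; apply: IH (bk a) _ _; lia.
Qed.

Lemma clean_cat al P L1 L2 :
  clean al P (L1 ++ L2) = clean al P L1 && clean al (catrev L1 P) L2.
Proof. by elim: L1 P => //= v L1 IH P; rewrite IH andbA. Qed.

Section Asking.
Variables (W : nat) (c : {ffun base -> bool}).

Definition lifted (a : {ffun 'I_D -> base}) (p : cover) : seq nat :=
  [seq val (enum_rank (a k, p.2 (+) sign c None p.1 (a k))) | k <- enum 'I_D].

Lemma answers_lifted al u :
  [seq val z | z <- nbrs (lift al c None) u] =
  lifted (answers al (enum_val u).1) (enum_val u).
Proof.
by rewrite /= /lift_nbrs -map_comp; apply: eq_map => k /=; rewrite ffunE.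
Qed.

(** With tape and gauge fixed, a run on the trivial cover is a decision tree over the matchings: the
    list in the cover is computed from the base answer and the signs. *)
Fixpoint ask_run (b : bool) (t : seq nat) (cf : config) (cont : config -> strategy) :
    strategy :=
  if t is m :: t' then
    if @asked size_cover cf is Some u then
      Ask b (enum_val u).1 (fun a =>
        ask_run b t' (choose m (answer_step W (lifted a (enum_val u)) cf) cf) cont)
    else ask_run b t' (choose m (answer_step W [::] cf) cf) cont
  else cont cf.

Definition base_trace (G : graph size_cover) (t : seq nat) (cf : config) : seq base :=
  [seq (enum_val u).1 | u <- trace W G t cf].

Lemma unclean_ask_run al b P t cf cont :
  let G := lift al c None in
  ~~ unclean al P (ask_run b t cf cont) ->
  (b -> clean al P (base_trace G t cf)) /\
  ~~ unclean al (catrev (base_trace G t cf) P) (cont (run W G t cf)).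
Proof.
move=> G; elim: t cf P => //= m t IH cf P; rewrite /base_trace /= stepE /answered.
case: (asked _ cf) => [u|] /=; last exact: IH.
rewrite -answers_lifted negb_or => /andP[ncol /IH[cl un]]; split=> //.
by move=> b1; rewrite cl // andbT; move: ncol; rewrite b1 /= negb_and negbK.
Qed.

Lemma bounded_ask_run (b : bool) t cf cont f d :
  (forall cf', bounded f d (cont cf')) ->
  bounded (b * size t + f) (size t + d) (ask_run b t cf cont).
Proof.
move=> bc; elim: t cf => [|m t IH] cf /=; first by rewrite muln0.
case: asked => [u|] /=; last by apply: bounded_le (IH _) _ _; rewrite ?leq_add2r ?leq_mul.
split; rewrite ?addSn //=; first by case: b {IH} => //=; lia.
move=> a; apply: bounded_le (IH _) _ _ => //; case: b {IH} => /=; lia.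
Qed.

End Asking.

(** * Queries at a hidden edge *)

Section Experiment.
Variables (W Q : nat) (start : config) (query_code : seq instr).

Definition query_config (s : state) (u v : cover) : config :=
  (query_code, set_reg W (set_reg W s 0 (enum_rank u)) 1 (enum_rank v)).

Section OneRun.
Variables (G : graph size_cover) (t : seq nat) (X Y : base) (sg : bool).

Definition query_start (b : bool) : config :=
  query_config (run W G t start).2 (X, b) (Y, b (+) sg).

(** An oracle answers alike on all tapes, so the zero tape represents them all. *)
Definition rejected (b : bool) : bool :=
  reg (run W G (nseq Q 0) (query_start b)).2 0 == 0.

Definition probed : seq base :=
  catrev (base_trace W G (nseq Q 0) (query_start true))
    (catrev (base_trace W G (nseq Q 0) (query_start false))
      (X :: catrev (base_trace W G t start) [::])).

End OneRun.

Lemma mem_catrev (s1 s2 : seq base) x : (x \in catrev s1 s2) = (x \in s1) || (x \in s2).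
Proof. by rewrite catrevE mem_cat mem_rev. Qed.

Lemma probed_flip al X Y K c t :
  let G := lift al c None in
  let G' := lift al (flip c K) (Some (X, Y)) in
  let sg := sign c None X Y in
  separates al X Y (probed G t X Y sg) K -> badj al X Y ->
  [/\ sign (flip c K) (Some (X, Y)) X Y = sg,
      probed G' t X Y sg = probed G t X Y sg &
      forall b, rejected G' t X Y sg b = rejected G t X Y sg b].
Proof.
move=> G G' sg sep XY.
have memP u cf t' : u \in trace W G t' cf -> (enum_val u).1 \in base_trace W G t' cf.
  by move=> uw; apply/mapP; exists u.
have sgE : sign (flip c K) (Some (X, Y)) X Y = sg.
  by apply: (sign_flip _ sep); rewrite // /probed !mem_catrev inE eqxx !orbT.
have agree u : (enum_val u).1 \in probed G t X Y sg -> nbrs G u = nbrs G' u.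
  by move=> uP; apply/esym/(nbrs_flip _ sep).
have [r0 tr0] : run W G' t start = run W G t start /\
    trace W G' t start = trace W G t start.
  apply: run_agree => u uw; apply: agree; rewrite /probed !mem_catrev inE mem_catrev.
  by rewrite (memP _ _ _ uw) !orbT.
have qE b : query_start G' t X Y sg b = query_start G t X Y sg b.
  by rewrite /query_start r0.
have rq b : run W G' (nseq Q 0) (query_start G t X Y sg b) =
    run W G (nseq Q 0) (query_start G t X Y sg b) /\
    trace W G' (nseq Q 0) (query_start G t X Y sg b) =
    trace W G (nseq Q 0) (query_start G t X Y sg b).
  apply: run_agree => u uw; apply: agree; rewrite /probed !mem_catrev.
  by case: b uw => /memP->; rewrite ?orbT.
split=> //.
  by rewrite /probed /base_trace !qE tr0 (rq true).2 (rq false).2.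
by move=> b; rewrite /rejected qE (rq b).1.
Qed.

(** The edge is given by [X] and a port, so its other end is known only after asking about [X]. That
    question and both queries are marked, the construction is not. *)
Definition exploration c t X j : strategy :=
  ask_run W c false t start (fun cf => Ask true X (fun a =>
    let q b := query_config cf.2 (X, b) (a j, b (+) sign c None X (a j)) in
    ask_run W c true (nseq Q 0) (q false) (fun _ =>
      ask_run W c true (nseq Q 0) (q true) (fun _ => Stop)))).

Lemma bounded_exploration c t X j :
  bounded (2 * Q + 1) (size t + (2 * Q + 1)) (exploration c t X j).
Proof.
apply: (@bounded_le _ (false * size t + (2 * Q + 1)) (size t + (2 * Q + 1))); try lia.
apply: bounded_ask_run => cf; split=> [||a]; try lia.
apply: (@bounded_le _ (true * size (nseq Q 0) + (true * size (nseq Q 0) + 0))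
  (size (nseq Q 0) + (size (nseq Q 0) + 0))); try (rewrite !size_nseq; lia).
by do 2![apply: bounded_ask_run => ?].
Qed.

Lemma separated al c t X j : let G := lift al c None in
  let P := catrev (base_trace W G t start) [::] in
  let Y := nbr al X j in
  X \notin P -> ~~ nearby al P X -> ~~ unclean al [::] (exploration c t X j) ->
  exists K, separates al X Y (probed G t X Y (sign c None X Y)) K.
Proof.
move=> G P Y XP nX /unclean_ask_run[_]; rewrite -/G -/P /= XP /= negb_or.
move=> /andP[ncol]; rewrite ffunE -/Y => /unclean_ask_run[cl1].
move=> /unclean_ask_run[cl2 _].
have XY : badj al X Y by apply: badj_nbr.
have sep0 := fresh_separates XY XP nX ncol.
have cl : clean al (X :: P) (base_trace W G (nseq Q 0)
      (query_start G t X Y (sign c None X Y) false) ++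
    base_trace W G (nseq Q 0) (query_start G t X Y (sign c None X Y) true)).
  by rewrite clean_cat cl1 // cl2.
have [|K sep] := clean_separated (mem_head X P) XY sep0 _ cl; last first.
  by exists K; move: sep; rewrite /probed catrev_catl.
by move=> v; rewrite !inE => /orP[->//|/andP[Xv _]]; rewrite /nearby /= Xv !orbT.
Qed.

Definition left_end (e : edge) : base := (false, e.1.1, e.1.2).
Definition right_end al (e : edge) : base := nbr al (left_end e) e.2.

Definition seen (G : graph size_cover) c o al t (e : edge) : seq base :=
  probed G t (left_end e) (right_end al e) (sign c o (left_end e) (right_end al e)).

Definition hidden al c t (e : edge) : bool :=
  [exists K : {set base}, separates al (left_end e) (right_end al e)
     (seen (lift al c None) c None al t e) K].

Definition rejects al c o t (e : edge) : bool :=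
  let X := left_end e in let Y := right_end al e in
  let r := rejected (lift al c o) t X Y (sign c o X Y) in r false && r true.

Definition bridge al (e : edge) : option (base * base) :=
  Some (left_end e, right_end al e).

Lemma badj_edge al (e : edge) : badj al (left_end e) (right_end al e).
Proof. exact: badj_nbr. Qed.

(* Flipping the gauge on the side of the cut that contains its left end makes
   a hidden edge a bridge, and changes none of the answers. *)
Lemma card_rejects t :
  #|[set q : matchings * {ffun base -> bool} * edge |
      hidden q.1.1 q.1.2 t q.2 && rejects q.1.1 q.1.2 None t q.2]| <=
  #|[set q : matchings * {ffun base -> bool} * edge |
      rejects q.1.1 q.1.2 (bridge q.1.1 q.2) t q.2]|.
Proof.
set S := [set q | _]; set S' := [set q | _].
(* The cut is a function of the matchings, the edge and the seen vertices only. The flip changes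
   none of them, so the cut can be read off the image and the flip undone: this gives
   injectivity. *)
pose cut al (e : edge) P := odflt set0 [pick K | separates al (left_end e) (right_end al e) P K].
pose K (q : matchings * {ffun base -> bool} * edge) :=
  cut q.1.1 q.2 (seen (lift q.1.1 q.1.2 None) q.1.2 None q.1.1 t q.2).
have KP q : q \in S -> separates q.1.1 (left_end q.2) (right_end q.1.1 q.2)
    (seen (lift q.1.1 q.1.2 None) q.1.2 None q.1.1 t q.2) (K q).
  rewrite inE => /andP[/existsP[K0 sep0] _]; rewrite /K /cut.
  by case: pickP => [K1 //|/(_ K0)]; rewrite sep0.
pose f (q : matchings * {ffun base -> bool} * edge) := (q.1.1, flip q.1.2 (K q), q.2).
have seenE q : q \in S -> seen (lift q.1.1 (flip q.1.2 (K q)) (bridge q.1.1 q.2))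
    (flip q.1.2 (K q)) (bridge q.1.1 q.2) q.1.1 t q.2 =
    seen (lift q.1.1 q.1.2 None) q.1.2 None q.1.1 t q.2.
  move=> /KP sep; have [sE pE _] := probed_flip sep (badj_edge _ _).
  by rewrite /seen /bridge sE pE.
have f_inj : {in S &, injective f}.
  move=> [[al c] e] [[al' c'] e'] qS q'S [ealE ecE eeE].
  have := seenE _ qS; have := seenE _ q'S; rewrite /= -ealE -eeE in q'S ecE *.
  rewrite -ecE => -> sE.
  have KE : K (al, c, e) = K (al, c', e) by rewrite /K /= sE.
  by rewrite -(flipK c (K (al, c, e))) ecE KE flipK.
rewrite -(card_in_imset f_inj); apply/subset_leq_card/subsetP=> _ /imsetP[q qS ->].
have [sE _ rE] := probed_flip (KP q qS) (badj_edge _ _).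
move: qS; rewrite [q \in S]inE => /andP[_ rq].
by rewrite inE /rejects /= /bridge sE !rE.
Qed.

Lemma card_touched al P :
  #|[set e : edge | (left_end e \in P) || nearby al P (left_end e)]| <=
  D * (D.+1 * size P).
Proof.
pose near := P ++ [seq nbr al p k | p <- P, k <- enum 'I_D].
have nearE v : (v \in P) || nearby al P v -> v \in near.
  rewrite mem_cat => /orP[->//|/hasP[p pP /badjP[k ->]]].
  by apply/orP; right; apply/allpairsP; exists (p, k); rewrite mem_enum.
have size_near : size near = D.+1 * size P.
  by rewrite size_cat size_allpairs size_enum_ord mulSn mulnC.
pose f (e : edge) := (left_end e, e.2).
have f_inj : injective f by move=> [[i x] j] [[i' x'] j'] [] -> -> ->.
rewrite -(card_imset _ f_inj) -size_near -[D in D * _](size_enum_ord D).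
rewrite mulnC -(size_allpairs (fun v j => (v, j)) near (enum 'I_D)).
apply: (@leq_trans #|[seq (v, j) | v <- near, j <- enum 'I_D]|); last exact: card_size.
apply/subset_leq_card/subsetP=> q /imsetP[e].
rewrite inE => /nearE en ->; apply/allpairsP; exists (left_end e, e.2).
by rewrite en mem_enum.
Qed.

Lemma card_exposed c t T M : size t = T -> M = T + (2 * Q + 1) ->
  #|[set q : matchings * edge | ~~ hidden q.1 c t q.2]| * (h - 2 * M) <=
  #|{: matchings}| * (D * (D.+1 * T) * (h - 2 * M) +
    #|{: edge}| * ((2 * Q + 1) * (D * M))).
Proof.
move=> tT ME; pose P1 al := catrev (base_trace W (lift al c None) t start) [::].
pose A := [set q : matchings * edge | (left_end q.2 \in P1 q.1) ||
  nearby q.1 (P1 q.1) (left_end q.2)].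
pose B := [set q : matchings * edge |
  unclean q.1 [::] (exploration c t (left_end q.2) q.2.2)].
have sub : [set q : matchings * edge | ~~ hidden q.1 c t q.2] \subset A :|: B.
  apply/subsetP=> -[al e]; rewrite in_set => nhid; rewrite in_setU; apply: contraNT nhid.
  rewrite negb_or !in_set negb_or => /andP[/andP[XP nX] ncl].
  by apply/existsP; apply: separated.
have sumE (S : {set matchings * edge}) :
    #|S| = \sum_al #|[set e : edge | (al, e) \in S]|.
  rewrite -sum1_card (eq_bigr (fun al => \sum_(e : edge | (al, e) \in S) 1)); last first.
    by move=> al _; rewrite -sum1_card; apply: eq_bigl => e; rewrite inE.
  by rewrite pair_big_dep /=; apply: eq_bigl => -[].
have sumE' (S : {set matchings * edge}) :
    #|S| = \sum_(e : edge) #|[set al | (al, e) \in S]|.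
  rewrite -sum1_card (eq_bigr (fun e : edge => \sum_(al | (al, e) \in S) 1)); last first.
    by move=> al _; rewrite -sum1_card; apply: eq_bigl => e; rewrite inE.
  rewrite (exchange_big_dep predT) //= pair_big_dep /=; by apply: eq_bigl => -[].
have cardA : #|A| <= #|{: matchings}| * (D * (D.+1 * T)).
  rewrite sumE -sum_nat_const; apply: leq_sum => al _.
  apply: leq_trans (_ : _ <= D * (D.+1 * size (P1 al))) _.
    apply: leq_trans (card_touched al (P1 al)); apply/eq_leq/eq_card => e.
    by rewrite !inE.
  rewrite !leq_mul2l; apply/orP; right; apply/orP; right.
  by rewrite /P1 catrevE cats0 size_rev size_map -tT size_trace.
have cardB : #|B| * (h - 2 * M) <= #|{: matchings}| * (#|{: edge}| * ((2 * Q + 1) * (D * M))).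
  rewrite sumE' big_distrl /= mulnCA -sum_nat_const; apply: leq_sum => e _.
  have := card_unclean (M := M) (s := exploration c t (left_end e) e.2) ([ffun=> 1%g])
    (P := [::]) (bounded_exploration c t (left_end e) e.2).
  rewrite /= add0n tT -ME => /(_ (leqnn _)); rewrite mulnC => bound.
  rewrite mulnC; apply: leq_trans (_ : _ <= (h - 2 * M) * #|[set al in consistent [ffun=> 1%g] [::] |
     unclean al [::] (exploration c t (left_end e) e.2)]|) _.
    by rewrite leq_mul2l; apply/orP; right; apply/eq_leq/eq_card => al; rewrite !inE.
  apply: leq_trans bound _; rewrite mulnC leq_mul2r; apply/orP; right.
  exact: max_card.
apply: leq_trans (leq_mul (subset_leq_card sub) (leqnn _)) _.
apply: leq_trans (leq_mul (leq_card_setU _ _) (leqnn _)) _.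
rewrite mulnDl mulnDr; apply: leq_add => //.
by rewrite [X in _ <= X]mulnA leq_mul.
Qed.

End Experiment.

Section Edges.
Variables (al : matchings) (c : {ffun base -> bool}) (o : option (base * base)).

Definition lift_tail (e : edge) (b : bool) : 'I_size_cover :=
  enum_rank (left_end e, b).

Definition lift_head (e : edge) (b : bool) : 'I_size_cover :=
  enum_rank (right_end al e, b (+) sign c o (left_end e) (right_end al e)).

Lemma adj_lift_edge e b : adj (lift al c o) (lift_tail e b) (lift_head e b).
Proof. by rewrite lift_adjE badj_edge /=. Qed.

(** Choose one kept lift over each base edge; lifts of different base edges are different. *)
Lemma card_kept (H : rel 'I_size_cover) :
  #|[set e | H (lift_tail e false) (lift_head e false) ||
             H (lift_tail e true) (lift_head e true)]| <= #|edges H|.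
Proof.
set S := [set e | _].
pose b e := ~~ H (lift_tail e false) (lift_head e false).
pose f e := [set lift_tail e (b e); lift_head e (b e)].
have f_inj : injective f.
  move=> e e' /setP eq_f.
  have := eq_f (lift_tail e (b e)); rewrite !inE eqxx /= => /esym/orP[/eqP/enum_rank_inj|/eqP/enum_rank_inj//].
  move=> -[e1 e2 eb].
  have := eq_f (lift_head e (b e)); rewrite !inE eqxx orbT => /esym/orP[/eqP/enum_rank_inj//|/eqP/enum_rank_inj].
  move=> -[e3 _ _].
  by move: e e' {eq_f eb} e1 e2 e3 => [[i x] j] [[i' x'] j'] /= -> -> ->.
rewrite -(card_imset _ f_inj); apply/subset_leq_card/subsetP=> _ /imsetP[e eS ->].
move: eS; rewrite inE => eS; apply/imsetP.
exists (lift_tail e (b e), lift_head e (b e)) => //; rewrite inE /=.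
by rewrite /b; case: (boolP (H _ (lift_head e false))) eS.
Qed.

End Edges.

(* The two lifts of a bridge form a cut, so one of them is in every spanning
   subgraph. *)
Lemma bridge_kept al c (e : edge) (H : rel 'I_size_cover) :
  let G := lift al c (bridge al e) in
  symmetric H -> subrel H (adj G) -> same_components H (adj G) ->
  H (lift_tail e false) (lift_head al c (bridge al e) e false) ||
  H (lift_tail e true) (lift_head al c (bridge al e) e true).
Proof.
move=> G Hsym Hsub Hcomp; apply/negPn/negP; rewrite negb_or => /andP[H0 H1].
have noH b : ~~ H (lift_tail e b) (lift_head al c (bridge al e) e b) by case: b.
(* The sheet with the gauge undone: it is constant along every edge except the two lifts of the
   bridge, which [H] is assumed to omit. *)
pose label (u : 'I_size_cover) := (enum_val u).2 (+) c (enum_val u).1.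
have Hlabel (u v : 'I_size_cover) : H u v -> label u = label v.
  move=> uv; have := Hsub _ _ uv; rewrite /G /= /lift_adj.
  case Eu : (enum_val u) => [p b]; case Ev : (enum_val v) => [r d] /= /andP[pr /eqP dE].
  have uE : u = enum_rank (p, b) by rewrite -Eu enum_valK.
  have vE : v = enum_rank (r, d) by rewrite -Ev enum_valK.
  rewrite /label Eu Ev /= dE /sign.
  have [sp|sp] := boolP (special _ p r); last first.
    by case: b {uE Eu dE}; case: (c p); case: (c r).
  case/orP: sp => /eqP[pE rE].
    have := noH b; rewrite /lift_tail /lift_head pE rE -dE -uE -vE uv //.
  have := noH d; rewrite /lift_tail /lift_head pE rE sign_sym.
  have -> : d (+) sign c (bridge al e) p r = b by rewrite dE addbK.
  by rewrite -uE -vE Hsym uv.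
have con : connect H (lift_tail e false) (lift_head al c (bridge al e) e false).
  rewrite Hcomp; apply: connect1; exact: adj_lift_edge.
have : label (lift_tail e false) = label (lift_head al c (bridge al e) e false).
  case/connectP: con => s; elim: s (lift_tail e false) => [|v s IH] u /=.
    by move=> _ ->.
  by case/andP=> /Hlabel-> /IH.
rewrite /label /lift_tail /lift_head !enum_rankK /= /sign.
have -> : special (bridge al e) (left_end e) (right_end al e) by rewrite /special eqxx.
by case: (c (left_end e)); case: (c (right_end al e)).
Qed.

(** * Averaging over covers, edges and tapes *)

Section Algorithm.
Variables (R : realType) (A : algorithm) (eps : R) (Q : nat) (q : R).
Hypothesis qQ : (q < Q.+1%:R)%R.

Let W := word_bound A size_cover.
Let start : config := (construction A, initial_state A size_cover eps).

Lemma rejected_oracle al c o t e b (H : rel 'I_size_cover) :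
  let G := lift al c o in
  adjacency_oracle A G (run W G t start).2 q H ->
  rejected W Q start (query A) G t (left_end e) (right_end al e)
    (sign c o (left_end e) (right_end al e)) b =
  ~~ H (lift_tail e b) (lift_head al c o e b).
Proof.
move=> G /(_ (lift_tail e b) (lift_head al c o e b)) [m mq allF].
have mQ : m <= Q.
  by rewrite -ltnS -(ltr_nat R); apply: le_lt_trans mq qQ.
have := run_outcomes _ allF (w := nseq Q 0).
rewrite size_nseq => /(_ _ mQ) /=; rewrite /rejected /query_start /query_config.
by case/(_ (fun d Fd => proj1 (andP Fd)))/andP=> _ /eqP <-; rewrite negbK.
Qed.

Definition succeeds (G : graph size_cover) (t : seq nat) : bool :=
  `[< exists2 H, sparse_spanning_subgraph G eps H &
        adjacency_oracle A G (run W G t start).2 q H >].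

Lemma card_rejects_sparse al c t : (eps < 1)%R -> succeeds (lift al c None) t ->
  #|{: edge}| <= #|[set e | rejects W Q start (query A) al c None t e]| + 2 * size_cover.
Proof.
move=> eps1 /asboolP[H [Hsym Hsub Hcard Hcomp] orc].
have HE : #|edges H| <= 2 * size_cover.
  rewrite -(ler_nat R); apply: le_trans Hcard _; rewrite natrM.
  by rewrite ler_wpM2r ?ler0n // -natr1 addrC lerD2r ltW.
rewrite -(cardC [set e | rejects W Q start (query A) al c None t e]) leq_add2l.
apply: leq_trans HE; apply: leq_trans (card_kept al c None H).
apply/subset_leq_card/subsetP=> e; rewrite !inE /rejects !(rejected_oracle _ _ orc).
by rewrite negb_and !negbK.
Qed.

Lemma succeeds_bridge al c t e : succeeds (lift al c (bridge al e)) t ->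
  ~~ rejects W Q start (query A) al c (bridge al e) t e.
Proof.
move=> /asboolP[H [Hsym Hsub Hcard Hcomp] orc].
rewrite /rejects !(rejected_oracle _ _ orc) negb_and !negbK.
exact: bridge_kept.
Qed.

Local Open Scope ring_scope.

Variables (T M : nat) (p : R).
Hypotheses (eps1 : eps < 1) (ME : (M = T + (2 * Q + 1))%N).

Let success (cf : config) (G : graph size_cover) : Prop :=
  exists2 H, sparse_spanning_subgraph G eps H & adjacency_oracle A G cf.2 q H.

Hypothesis fast : forall G : graph size_cover,
  1 - p <= prob R W G T start (fun cf => success cf G).

Let tape_list : seq (seq nat) := tapes (W + size_cover)`! T.

Let number : R := (size tape_list)%:R.

Lemma number_gt0 : 0 < number.
Proof. by rewrite ltr0n size_tapes expn_gt0 fact_gt0. Qed.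

Lemma start_below : words_below W start.
Proof.
have W0 : (0 < W)%N by rewrite expn_gt0.
move=> x /=; do 2!(case: ifP => _; first by rewrite ltn_mod).
exact: W0.
Qed.

Lemma sum_succeeds G : (1 - p) * number <= \sum_(t <- tape_list) (succeeds G t)%:R.
Proof.
have := fast G; rewrite prob_tapes; last exact: start_below.
by rewrite ler_pdivlMr -size_tapes ?number_gt0.
Qed.

Let triple := (matchings * {ffun base -> bool} * edge)%type.

Let rejA (t : seq nat) (x : triple) : bool :=
  rejects W Q start (query A) x.1.1 x.1.2 None t x.2.
Let rejB (t : seq nat) (x : triple) : bool :=
  rejects W Q start (query A) x.1.1 x.1.2 (bridge x.1.1 x.2) t x.2.
Let hid (t : seq nat) (x : triple) : bool :=
  hidden W Q start (query A) x.1.1 x.1.2 t x.2.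

Let a : R := #|{: matchings}|%:R.
Let g : R := #|{ffun base -> bool}|%:R.
Let E : R := #|{: edge}|%:R.

Hypothesis dense : (2 * size_cover <= #|{: edge}|)%N.

Lemma sum_rejA : a * g * ((1 - p) * number * (E - (2 * size_cover)%:R)) <=
  \sum_(t <- tape_list) #|[set x | rejA t x]|%:R.
Proof.
have n2 : 0 <= E - (2 * size_cover)%:R by rewrite subr_ge0 ler_nat.
have -> : a * g * ((1 - p) * number * (E - (2 * size_cover)%:R)) =
    \sum_(x : matchings * {ffun base -> bool}) (1 - p) * number * (E - (2 * size_cover)%:R).
  by rewrite sumr_const -[RHS]mulr_natl; congr (_ * _); rewrite card_prod natrM.
have cardE t : #|[set x | rejA t x]|%:R = \sum_(x : matchings * {ffun base -> bool})
     #|[set e | rejects W Q start (query A) x.1 x.2 None t e]|%:R :> R.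
  rewrite -natr_sum; congr _%:R; rewrite -sum1_card.
  rewrite (eq_bigr (fun x : matchings * {ffun base -> bool} =>
    \sum_(e | rejects W Q start (query A) x.1 x.2 None t e) 1)%N); last first.
    by move=> x _; rewrite -sum1_card; apply: eq_bigl => e; rewrite inE.
  by rewrite pair_big_dep /=; apply: eq_bigl => -[x e]; rewrite inE.
rewrite (eq_bigr _ (fun t _ => cardE t)) exchange_big; apply: ler_sum => x _ /=.
apply: le_trans (ler_wpM2r n2 (sum_succeeds (lift x.1 x.2 None))) _.
rewrite mulr_suml; apply: ler_sum => t _.
have [/(card_rejects_sparse eps1)|_] := boolP (succeeds _ t); last by rewrite mul0r ler0n.
by rewrite mul1r lerBlDr -natrD ler_nat.
Qed.

(** On a bridged cover, rejecting both lifts of the bridge is an error, so for each triple at most a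
    fraction [p] of the tapes does it. *)
Lemma sum_rejB :
  \sum_(t <- tape_list) #|[set x | rejB t x]|%:R <= a * g * E * (p * number).
Proof.
have -> : a * g * E * (p * number) = \sum_(x : triple) p * number.
  by rewrite sumr_const -[RHS]mulr_natl; congr (_ * _); rewrite card_prod natrM card_prod natrM.
have cardE t : #|[set x | rejB t x]|%:R = \sum_x (rejB t x)%:R :> R.
  rewrite -sum1_card natr_sum big_mkcond /=.
  by apply: eq_bigr => x _; rewrite inE; case: rejB.
rewrite (eq_bigr _ (fun t _ => cardE t)) exchange_big; apply: ler_sum => x _ /=.
have := sum_succeeds (lift x.1.1 x.1.2 (bridge x.1.1 x.2)).
have : \sum_(t <- tape_list) (rejB t x)%:R <=
    \sum_(t <- tape_list) (1 - (succeeds (lift x.1.1 x.1.2 (bridge x.1.1 x.2)) t)%:R) :> R.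
  apply: ler_sum => t _; have [|_] := boolP (succeeds _ t).
    by move=> /succeeds_bridge/negbTE; rewrite /rejB => ->; rewrite subrr.
  by rewrite subr0 lern1; case: rejB.
rewrite sumrB big_const_seq count_predT iter_addr_0 -/number => le1 le2.
apply: le_trans le1 _; rewrite lerBlDr; lra.
Qed.

Lemma card_unhidden t : size t = T ->
  (#|[set x | ~~ hid t x]| * (h - 2 * M) <= #|{: matchings}| * #|{ffun base -> bool}| *
    (D * (D.+1 * T) * (h - 2 * M) + #|{: edge}| * ((2 * Q + 1) * (D * M))))%N.
Proof.
move=> tT.
have -> : #|[set x | ~~ hid t x]| = (\sum_(c : {ffun base -> bool})
    #|[set q : matchings * edge | ~~ hidden W Q start (query A) q.1 c t q.2]|)%N.
  rewrite -sum1_card (eq_bigr (fun c => \sum_(q : matchings * edge |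
    ~~ hidden W Q start (query A) q.1 c t q.2) 1)%N); last first.
    by move=> c _; rewrite -sum1_card; apply: eq_bigl => e; rewrite inE.
  rewrite pair_big_dep /=.
  rewrite (reindex (fun x : triple => (x.1.2, (x.1.1, x.2)))) /=.
    by apply: eq_bigl => x; rewrite inE.
  by exists (fun y => (y.2.1, y.1, y.2.2)) => [[[]]|[? []]].
rewrite big_distrl /= [(#|_| * #|_|)%N]mulnC -mulnA -sum_nat_const.
by apply: leq_sum => c _; apply: card_exposed.
Qed.

(** Tape by tape, rejections of hidden edges carry over to bridged covers by [card_rejects]; edges
    that are not hidden are given away. *)
Lemma sum_rejA_le : (h - 2 * M)%:R * \sum_(t <- tape_list) #|[set x | rejA t x]|%:R <=
  a * g * number * (E * p * (h - 2 * M)%:R + (D * (D.+1 * T))%:R * (h - 2 * M)%:R +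
     E * ((2 * Q + 1) * (D * M))%:R).
Proof.
set z := (h - 2 * M)%:R; have z0 : 0 <= z by rewrite ler0n.
pose B : R := a * g * ((D * (D.+1 * T))%:R * z + E * ((2 * Q + 1) * (D * M))%:R).
have split_t t : size t = T ->
    z * #|[set x | rejA t x]|%:R <= z * #|[set x | rejB t x]|%:R + B.
  move=> tT.
  have -> : B = (#|{: matchings}| * #|{ffun base -> bool}| *
    (D * (D.+1 * T) * (h - 2 * M) + #|{: edge}| * ((2 * Q + 1) * (D * M))))%:R.
    by rewrite /B /a /g /E /z -!(natrM, natrD).
  rewrite /z -!natrM -natrD ler_nat [((h - 2 * M) * _)%N]mulnC [((h - 2 * M) * _)%N]mulnC.
  apply: leq_trans (leq_add (leqnn _) (card_unhidden tT)).
  rewrite -mulnDl leq_mul2r; apply/orP; right.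
  rewrite -(cardsID [set x | hid t x]) leq_add //; last first.
    by apply/subset_leq_card/subsetP=> x; rewrite !inE => /andP[].
  apply: leq_trans (card_rejects _ _ _ _ t).
  by apply/subset_leq_card/subsetP=> x; rewrite !inE andbC.
apply: le_trans (_ : _ <= \sum_(t <- tape_list) (z * #|[set x | rejB t x]|%:R + B)) _.
  by rewrite mulr_sumr big_seq [leRHS]big_seq; apply: ler_sum => t /size_tape/split_t.
rewrite big_split /= -mulr_sumr big_const_seq count_predT iter_addr_0.
have := ler_wpM2l z0 sum_rejB; rewrite -[B *+ _]mulr_natl -/number /B; lra.
Qed.

Lemma lift_lower_bound : (1 - p) * (E - (2 * size_cover)%:R) * (h - 2 * M)%:R <=
  E * p * (h - 2 * M)%:R + (D * (D.+1 * T))%:R * (h - 2 * M)%:R +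
     E * ((2 * Q + 1) * (D * M))%:R.
Proof.
have a0 : 0 < a by rewrite ltr0n; apply/card_gt0P; exists [ffun=> 1%g].
have g0 : 0 < g by rewrite ltr0n; apply/card_gt0P; exists [ffun=> false].
rewrite -(ler_pM2l (mulr_gt0 (mulr_gt0 a0 g0) number_gt0)).
apply: le_trans sum_rejA_le.
have z0 : 0 <= (h - 2 * M)%:R :> R by rewrite ler0n.
have := ler_wpM2l z0 sum_rejA; lra.
Qed.

End Algorithm.

End Lift.

(** * The lower bound *)

Lemma polylog_le_powR (R : realType) (a Z : R) (m : nat) : 0 < a ->
  exists2 N : nat, (6 <= N)%N & Z * N.+1%:R ^+ m <= (2 ^ N)%:R `^ a.
Proof.
move=> a0; have ln2 : 0 < ln (2 : R) by rewrite ln_gt0 ?ltr1n.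
(* From [1 + x <= expR x], each of [m.+1] equal factors of the power is at least [b * N.+1]. This is
   one factor [N.+1] more than needed, which absorbs [Z] and the power of [b]. *)
pose b : R := Num.min 1 (a * ln 2 / m.+1%:R).
have b0 : 0 < b by rewrite lt_min ltr01 divr_gt0 ?mulr_gt0 ?ltr0n.
have bm : 0 < b ^+ m.+1 by rewrite exprn_gt0.
pose N := (6 + Num.truncn (Z / b ^+ m.+1))%N.
exists N; first exact: leq_addr.
have ZN : Z <= b ^+ m.+1 * N.+1%:R.
  rewrite mulrC -ler_pdivrMr //; apply: ltW; apply: lt_le_trans (truncnS_gt _) _.
  by rewrite ler_nat ltnS leq_addl.
apply: le_trans (ler_wpM2r _ ZN) _; first by rewrite exprn_ge0 ?ler0n.
rewrite -mulrA -exprS -exprMn.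
have -> : (2 ^ N)%:R `^ a = expR (N%:R * (a * ln 2 / m.+1%:R)) ^+ m.+1 :> R.
  rewrite /powR pnatr_eq0 expn_eq0 /= -expRM_natl; congr expR.
  rewrite natrX lnXn // -mulr_natl; field.
  by rewrite addrC natr1 pnatr_eq0.
rewrite lerXn2r ?nnegrE ?expR_ge0 ?mulr_ge0 ?ler0n ?(ltW b0) //.
apply: le_trans (expR_ge1Dx _).
rewrite -natr1 mulrDr mulr1 addrC lerD ?ge_min ?lexx // mulrC.
by rewrite ler_wpM2l ?ler0n ?ge_min ?lexx ?orbT.
Qed.

Lemma no_sublinear_algorithm (R : realType) (delta eps : R) (A : algorithm)
    (C c : R) (k : nat) : 0 < delta -> eps < 1 -> 0 < c ->
  ~ forall (n : nat) (G : graph n), (0 < n)%N ->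
    solves_within A eps G (C * n%:R `^ (1 - delta)) (C * polylog R k n) (n%:R `^ (- c)).
Proof.
move=> d0 eps1 c0 solves.
pose a : R := Num.min (Num.min delta 1) c.
have a0 : 0 < a by rewrite !lt_min d0 ltr01 c0.
have [ad a1 ac] : [/\ a <= delta, a <= 1 & a <= c].
  by rewrite !ge_min !lexx ?orbT.
pose B : R := Num.max 1 C.
have B1 : 1 <= B by rewrite le_max lexx.
have CB : C <= B by rewrite le_max lexx orbT.
(* 12 comes from the bounds [3 * (B * L)] on [K] and [4 * (B * L * y)] on [T + K], 64 from
   [n = 64 * h]; 258 leaves slack for the final comparison. *)
have [N N6 big] := polylog_le_powR (258 * 12 * 64 * B ^+ 2) (k + k) a0.
pose h := (2 ^ (N - 6))%N.
have h64 : (64 * h)%N = (2 ^ N)%N by rewrite -(subnKC N6) expnD.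
have h0 : (0 < h)%N by rewrite expn_gt0.
pose n := #|{: bool * 'I_16 * 'I_h * bool}|.
have nE : n = (2 ^ N)%N by rewrite -h64 [LHS]card_cover.
have bE : bit_length n = N.+1 by rewrite /bit_length nE trunc_expnK.
pose L : R := N.+1%:R ^+ k.
have L1 : 1 <= L by rewrite exprn_ege1 // ler1n.
have LE : polylog R k n = L by rewrite /polylog bE.
have n1 : 1 <= n%:R :> R by rewrite nE ler1n expn_gt0.
pose T := Num.truncn (C * n%:R `^ (1 - delta)).
pose Q := Num.truncn (C * L).
have qQ : C * L < Q.+1%:R by apply: truncnS_gt.
pose x : R := n%:R `^ a; pose y : R := n%:R `^ (1 - a).
have xy : x * y = n%:R.
  rewrite /x /y -powRD; last by apply/implyP => _; rewrite gt_eqF // (lt_le_trans ltr01).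
  by rewrite addrC subrK powRr1 ?ler0n.
have y1 : 1 <= y by rewrite -(powRr0 n%:R) ler_powR ?subr_ge0.
have yd : n%:R `^ (1 - delta) <= y by rewrite ler_powR // lerD2l lerN2.
have d_gt0 : 0 < n%:R `^ (1 - delta) :> R by rewrite powR_gt0 // (lt_le_trans ltr01).
(* [C] is an arbitrary real, but a halting time below its bound exists on any one graph. *)
have C0 : 0 <= C.
  have [t [tC _ _]] := solves _ (lift [ffun=> 1%g] [ffun=> false] None : graph n) (ltac:(by rewrite nE expn_gt0)).
  by rewrite -(pmulr_lge0 _ d_gt0); apply: le_trans tC.
have TB : T%:R <= B * y.
  apply: le_trans (_ : _ <= C * n%:R `^ (1 - delta)) _.
    by rewrite -truncn_ge_nat ?mulr_ge0 ?(ltW d_gt0).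
  by rewrite ler_pM ?(ltW d_gt0).
have QB : Q%:R <= B * L.
  apply: le_trans (_ : _ <= C * L) _.
    by rewrite -truncn_ge_nat ?mulr_ge0 ?(le_trans ler01 L1).
  by rewrite ler_pM ?(le_trans ler01 L1).
pose K := (2 * Q + 1)%N.
have KB : K%:R <= 3 * (B * L).
  have : 1 <= B * L by rewrite -[1]mulr1 ler_pM.
  by rewrite natrD natrM; lra.
have MB : (T + K)%:R <= 4 * (B * L * y).
  have BLy : B * y <= B * L * y.
    by rewrite ler_wpM2r ?(le_trans ler01 y1) // ler_peMr ?(le_trans ler01 B1).
  have BLy' : B * L <= B * L * y.
    by rewrite ler_peMr // mulr_ge0 ?(le_trans ler01 _).
  by rewrite natrD; lra.
have small : (258 * K * (T + K) <= h)%N.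
  rewrite -(@leq_pmul2l 64) // h64 -nE -(ler_nat R) -xy.
  apply: le_trans (_ : _ <= 258 * 12 * 64 * B ^+ 2 * L ^+ 2 * y) _.
    have := ler_pM (ler0n R K) (ler0n R (T + K)) KB MB.
    rewrite ![(_ * _)%:R]natrM; nra.
  rewrite ler_wpM2r ?(le_trans ler01 y1) // /x nE.
  by apply: le_trans big; rewrite /L -exprM addnn -muln2.
have Mh : (2 * (T + K) < h)%N.
  have K0 : (0 < K)%N by rewrite /K addn1.
  have := leq_mul (leq_mul (leqnn 258) K0) (leqnn (T + K)).
  by clear - small K0; nia.
have p16 : n%:R `^ (- c) <= 16^-1 :> R.
  rewrite powRN lef_pV2 ?posrE ?powR_gt0 ?(lt_le_trans ltr01 n1) //.
  apply: le_trans (_ : _ <= x) _; last by rewrite ler_powR.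
  rewrite /x nE; apply: le_trans big.
  have : 1 * 1 <= B ^+ 2 * N.+1%:R ^+ (k + k) by rewrite ler_pM // ?exprn_ege1 // ler1n.
  by lra.
have cardE : #|{: 'I_16 * 'I_h * 'I_16}| = (256 * h)%N.
  by rewrite !card_prod !card_ord mulnAC.
have n64 : n = (64 * h)%N by rewrite nE.
have fast (G : graph n) : 1 - n%:R `^ (- c) <=
    prob R (word_bound A n) G T (construction A, initial_state A n eps)
     (fun cf => exists2 H, sparse_spanning_subgraph G eps H &
        adjacency_oracle A G cf.2 (C * L) H).
  have [|t [tT halts ok]] := solves n G; first by rewrite nE expn_gt0.
  rewrite LE in ok.
  have tT' : (t <= T)%N by rewrite truncn_ge_nat // mulr_ge0 // ltW.
  have halted_le : forall cf, halted cf -> halted cf by [].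
  by case: (ensures_le halted_le (conj halts ok) tT' (lexx _)).
have := lift_lower_bound qQ eps1 (erefl (T + (2 * Q + 1))%N) fast.
rewrite -/n cardE n64 -n64 => /(_ _)/wrap[].
  by clear - n64; lia.
have cE : (256 * h)%:R - (2 * n)%:R = 128 * h%:R :> R.
  by rewrite n64 !natrM; lra.
rewrite {}cE -/K; move: (n%:R `^ (- c)) p16 => p p16.
pose M : R := (T + K)%:R; pose z : R := (h - 2 * (T + K))%:R.
have zE : z = h%:R - 2 * M by rewrite /z natrB ?natrM // ltnW.
have hR : 1 <= h%:R :> R by rewrite ler1n.
have M0 : 0 <= M by rewrite ler0n.
have TM : T%:R <= M by rewrite ler_nat leq_addr.
have K1 : 1 <= K%:R :> R by rewrite ler1n /K addn1.
have smallR : 258 * (K%:R * M) <= h%:R by rewrite mulrA -!natrM ler_nat.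
rewrite -/z ![(_ * _)%:R]natrM -/M => main.
have MS : M <= K%:R * M by rewrite ler_peMl.
have zh : 9 * h%:R <= 10 * z by rewrite zE; lra.
have z0 : 0 <= z by lra.
have e1 : p * (h%:R * z) <= 16^-1 * (h%:R * z) by rewrite ler_wpM2r // mulr_ge0 ?ler0n.
have e2 : 258 * (T%:R * z) <= h%:R * z by rewrite mulrA ler_wpM2r //; lra.
have e3 : 258 * (h%:R * (K%:R * M)) <= h%:R * h%:R.
  by rewrite mulrCA ler_wpM2l ?ler0n.
have e4 : 9 * (h%:R * h%:R) <= 10 * (h%:R * z).
  by rewrite mulrCA [leRHS]mulrCA ler_wpM2l ?ler0n.
have e5 : 1 * 1 <= h%:R * h%:R :> R by rewrite ler_pM.
(* After moving the [p] terms to the left, [p <= 1 / 16] leaves at least [104 * h * z] there, while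
   the touched edges and the collisions together contribute less than [20 * h * z]. *)
by lra.
Qed.

Theorem mainTheorem1 (R : realType) :
  (exists (A : algorithm) (C c : R) (k : nat), 0 < c /\
     forall eps : R, 0 < eps < 1 ->
     forall (n : nat) (G : graph n), (0 < n)%N ->
       solves_within A eps G
         (C * (n%:R / eps) * polylog R k n)
         (C * polylog R k n)
         (n%:R `^ (- c)))
  /\
  (forall delta eps : R, 0 < delta -> 0 < eps < 1 ->
     ~ exists (A : algorithm) (C c : R) (k : nat), 0 < c /\
       forall (n : nat) (G : graph n), (0 < n)%N ->
         solves_within A eps G
           (C * n%:R `^ (1 - delta))
           (C * polylog R k n)
           (n%:R `^ (- c))).
Proof.
split.
  exists sparsifier, (3000 * 2), 1, 2%N; split=> // eps eps01 n G n0.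
  rewrite powR_inv1 ?ler0n //; exact: sparsifier_solves.
move=> delta eps d0 /andP[_ eps1] [A [C [c [k [c0 solves]]]]].
exact: no_sublinear_algorithm d0 eps1 c0 solves.
Qed.
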